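(* (The statement is to be read either with all words in parentheses included, for a completely contractive Banach algebra $A$, or with all of them omitted, for a Banach algebra $A$.) Let $\{(\mathfrak A_i,\eta_i):i\in I\}$ be a set of (operator) HLDBAs over $A$. Then its subdirect product $(\mathfrak A_\vee,\eta_\vee)$ is the supremum of $\{(\mathfrak A_i,\eta_i):i\in I\}$ in $(\mathcal{HLD}(A),\le)$. Hence $(\mathcal{HLD}(A),\le)$ is a complete lattice, with maximum element equal to $A^{**}$ and minimum element equal to the trivial Banach algebra.
   Context: A bilinear map $m:X\times Y\to Z$ of operator spaces is completely contractive (c.c.) if $\|[m(x_{ij},y_{kl})]\|_{M_{rs}(Z)}\le\|[x_{ij}]\|_{M_r(X)}\|[y_{kl}]\|_{M_s(Y)}$ for all $r,s$ and all matrices. A c.c. Banach algebra is an associative algebra that is a (complete) operator space with c.c. multiplication. HLDBAs. Let $\mathfrak A$ be a (c.c.) Banach algebra with a fixed (operator space) predual $\mathfrak A_*$. The pair $(\mathfrak A,\eta_{\mathfrak A})$ is an (operator) homogeneous left dual Banach algebra ((operator) HLDBA) over $A$ if (i) for each $\nu\in\mathfrak A$, $\mu\mapsto\mu\nu$ is weak$^*$-weak$^*$ continuous on $\mathfrak A$; (ii) $\eta_{\mathfrak A}:A\to\mathfrak A$ is a (completely) contractive homomorphism with weak$^*$-dense range whose range is contained in $Z_t(\mathfrak A)=\{\mu:\nu\mapsto\mu\nu\text{ is weak}^*\text{-weak}^*\text{ continuous on }\mathfrak A\}$. Write $(\mathfrak A,\eta_{\mathfrak A})\ge(\mathfrak B,\eta_{\mathfrak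 B})$ if there is a weak$^*$-weak$^*$ continuous (complete) contraction $\Phi:\mathfrak A\to\mathfrak B$ with $\Phi\circ\eta_{\mathfrak A}=\eta_{\mathfrak B}$; the two are equivalent if $\Phi$ can be chosen a surjective (completely) isometric algebra isomorphism. $\mathcal{HLD}(A)$ is the set of (operator) HLDBAs over $A$ up to equivalence, partially ordered by $\le$. $A^{**}$ carries the first Arens product $\langle\mu\,\square\,\nu,\phi\rangle=\langle\mu,\nu\,\square\,\phi\rangle$, $\langle\nu\,\square\,\phi,a\rangle=\langle\nu,\phi\cdot a\rangle$, $\langle\phi\cdot a,b\rangle=\langle\phi,ab\rangle$, and is an (operator) HLDBA over $A$ with the canonical embedding $A\to A^{**}$. Subdirect product. Let $\prod_{i\in I}\mathfrak A_i=\ell^\infty\text{-}\bigoplus_{i}\mathfrak A_i$ with coordinatewise product and (matrix) norm $\|[\mu_{k,l}]\|=\sup_i\|[\mu_{k,l}(i)]\|_{M_n(\mathfrak A_i)}$; it is the dual of $\ell^1\text{-}\bigoplus_i(\mathfrak A_i)_*$. Put $\eta_\vee(a)=(\eta_i(a))_{i\in I}$ and let $\mathfrak A_\vee$ be the weak$^*$-closure of $\eta_\vee(A)$ in $\prod_i\mathfrak A_i$, with the inherited (operator space) norm and weak$^*$ topology (predual: the corresponding quotient of $\ell^1\text{-}\bigoplus_i(\mathfrak A_i)_*$). The pair $(\mathfrak A_\vee,\eta_\vee)$ is an (operator) HLDBA over $A$, called the subdirect product of $\{(\mathfrak A_i,\eta_i):i\in I\}$. *)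

(* Defs.v *)
From HB Require Import structures.
From mathcomp Require Import all_boot all_order all_algebra finmap.
From mathcomp Require Import all_classical all_reals all_analysis.
From mathcomp.analysis.showcase Require Import summability.
From mathcomp Require Import complex mxtens.

Set Implicit Arguments.
Unset Strict Implicit.
Unset Printing Implicit Defensive.

Import Order.TTheory GRing.Theory Num.Theory numFieldNormedType.Exports.

Local Open Scope classical_set_scope.
Local Open Scope ring_scope.
Local Open Scope complex_scope.

(* [Banach] omits the parenthesized words of the theory, [Operator] includes
   them: (operator), (completely), (operator space), (c.c.). *)
Variant setting := Banach | Operator.

Section OperatorSpaces.
Variable R : realType.
Local Notation C := R[i].

Definition l2norm n (v : 'cV[C]_n) : C := sqrtC (\sum_i `|v i 0| ^+ 2).

(* norm of the operator from l^2_n to l^2_m with matrix a *)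
Definition opnorm m n (a : 'M[C]_(m, n)) : C :=
  (sup [set complex.Re (l2norm (a *m v)) | v in [set v | l2norm v <= 1]])%:C.

Definition mxbimodule (X : lmodType C) m n
    (a : 'M[C]_(m, n)) (x : 'M[X]_n) (b : 'M[C]_(n, m)) : 'M[X]_m :=
  \matrix_(i, j) \sum_k \sum_l (a i k * b l j) *: x k l.

(* Ruan's axioms for an abstract operator space; completeness at level 1, which
   gives completeness of all the M_n(X), is carried by the type of X below. *)
Record operator_space (X : normedModType C) (N : forall n, 'M[X]_n -> C) :
    Prop := {
  mxnorm_triangle : forall n (x y : 'M[X]_n), N n (x + y) <= N n x + N n y;
  mxnorm_scale : forall n (c : C) (x : 'M[X]_n),
    N n (map_mx ( *:%R c) x) = `|c| * N n x;
  mxnorm_definite : forall n (x : 'M[X]_n), N n x = 0 -> x = 0;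
  mxnorm_level1 : forall x : 'M[X]_1, N 1%N x = `|x 0 0|;
  mxnorm_dsum : forall m n (x : 'M[X]_m) (y : 'M[X]_n),
    N (m + n)%N (block_mx x 0 0 y) = Num.max (N m x) (N n y);
  mxnorm_bimodule : forall m n (a : 'M[C]_(m, n)) (x : 'M[X]_n)
      (b : 'M[C]_(n, m)),
    N m (mxbimodule a x b) <= opnorm a * N n x * opnorm b }.

(* A Banach space, resp. a complete operator space. In the [Banach] setting
   [mxnorm] is unconstrained and no definition below uses it. *)
Record space (s : setting) := Space {
  carrier :> completeNormedModType C;
  mxnorm : forall n, 'M[carrier]_n -> C;
  mxnormP : s = Operator -> operator_space mxnorm }.

(* the matrix [m(x_ij, y_kl)], with rows (i, k) and columns (j, l) *)
Definition amplify (X Y Z : Type) (m : X -> Y -> Z) r t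
    (x : 'M[X]_r) (y : 'M[Y]_t) : 'M[Z]_(r * t) :=
  \matrix_(p, q) m (x (mxtens_unindex p).1 (mxtens_unindex q).1)
                   (y (mxtens_unindex p).2 (mxtens_unindex q).2).

Variable s : setting.

Definition contractive (X Y : space s) (f : X -> Y) : Prop :=
  match s with
  | Banach => forall x, `|f x| <= `|x|
  | Operator => forall n (x : 'M[X]_n), mxnorm (map_mx f x) <= mxnorm x
  end.

Definition isometric (X Y : space s) (f : X -> Y) : Prop :=
  match s with
  | Banach => forall x, `|f x| = `|x|
  | Operator => forall n (x : 'M[X]_n), mxnorm (map_mx f x) = mxnorm x
  end.

Definition contractive2 (X Y Z : space s) (m : X -> Y -> Z) : Prop :=
  match s with
  | Banach => forall x y, `|m x y| <= `|x| * `|y|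
  | Operator => forall r t (x : 'M[X]_r) (y : 'M[Y]_t),
      mxnorm (amplify m x y) <= mxnorm x * mxnorm y
  end.

(* The map y |-> b(-, y) is a (completely) isometric isomorphism of Y onto the
   dual of X. The (matrix) norm of the dual is given by its characterization as
   a least bound; M_n of the dual of X is normed as CB(X, M_n). *)
Definition is_dual (X Y : space s) (b : X -> Y -> C) : Prop :=
  [/\ forall y, linear (fun x => b x y : C^o),
      forall x, linear (fun y => b x y : C^o),
      match s with
      | Banach => forall (y : Y) (c : C), 0 <= c ->
          `|y| <= c <-> forall x, `|b x y| <= c * `|x|
      | Operator => forall n (y : 'M[Y]_n) (c : C), 0 <= c ->
          mxnorm y <= c <->
          forall m (x : 'M[X]_m), opnorm (amplify b x y) <= c * mxnorm x
      end &
      forall f : X -> C^o, linear f -> continuous f ->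
        exists y, forall x, f x = b x y].

Definition weakstar (X Y : space s) (b : X -> Y -> C) : topologicalType :=
  initial_topology (fun y : Y => (fun x => b x y) : {ptws X -> C^o}).

(* (completely contractive) Banach algebra, not assumed unital *)
Record balgebra := BAlgebra {
  balg_space :> space s;
  mul : balg_space -> balg_space -> balg_space;
  mul_linearl : forall y, linear (fun x => mul x y);
  mul_linearr : forall x, linear (mul x);
  mulA : associative mul;
  mul_contractive : contractive2 mul }.

Definition algebra_hom (A B : balgebra) (f : A -> B) : Prop :=
  linear f /\ {morph f : x y / mul x y}.

(* topological centre of B with respect to the weak* topology given by b *)
Definition Zt (X : space s) (B : balgebra) (b : X -> B -> C) : set B :=
  [set mu | continuous ((fun nu => mul mu nu) : weakstar b -> weakstar b)].

Record hldba (A : balgebra) := HLDBA {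
  alg :> balgebra;
  predual : space s;
  pairing : predual -> alg -> C;
  pairing_dual : is_dual pairing;
  eta : A -> alg;
  mul_weakstar : forall nu : alg,
    continuous ((fun mu => mul mu nu) : weakstar pairing -> weakstar pairing);
  eta_hom : algebra_hom eta;
  eta_contractive : contractive eta;
  eta_dense : closure (range eta : set (weakstar pairing)) = setT;
  eta_centre : range eta `<=` Zt pairing }.

End OperatorSpaces.

Arguments Zt {R s X B} b.
Arguments pairing {R s A} h x m.
Arguments eta {R s A} h a.

Section HLD.
Variables (R : realType) (s : setting) (A : balgebra R s).
Local Notation C := R[i].

Definition wstar (V : hldba A) : topologicalType := weakstar (pairing V).

Definition hldba_map (V W : hldba A) (Phi : V -> W) : Prop :=
  [/\ linear Phi, contractive Phi, continuous (Phi : wstar V -> wstar W) &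
      forall a, Phi (eta V a) = eta W a].

Definition hldba_le (W V : hldba A) : Prop :=
  exists Phi : V -> W, hldba_map Phi.

Definition hldba_equiv (V W : hldba A) : Prop :=
  exists Phi : V -> W,
    [/\ hldba_map Phi, isometric Phi, range Phi = setT & algebra_hom Phi].

(* HLD(A), as the type of the equivalence classes. Like subsets of it below, a
   class is a bare predicate: hldba A is too large a type for [set]. *)
Definition HLD := {P : hldba A -> Prop | exists V, P = hldba_equiv V}.

Definition hld_class (V : hldba A) : HLD :=
  exist _ (hldba_equiv V) (ex_intro _ V erefl).

Definition hld_le (p q : HLD) : Prop :=
  exists V W, [/\ sval p V, sval q W & hldba_le V W].

(* [V] is the second dual of A with the first Arens product: the predual of [V]
   is the dual of A through [ev a phi] = <phi, a>, and [V] is the dual of its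
   predual. This determines [V] up to equivalence. *)
Definition is_bidual (V : hldba A) : Prop :=
  exists (ev : A -> predual V -> C)
         (rdot : predual V -> A -> predual V)
         (arens : V -> predual V -> predual V),
  [/\ is_dual ev,
      forall a phi, pairing V phi (eta V a) = ev a phi,
      forall phi a b, ev b (rdot phi a) = ev (mul a b) phi,
      forall nu phi a, ev a (arens nu phi) = pairing V (rdot phi a) nu &
      forall mu nu phi, pairing V phi (mul mu nu) = pairing V (arens nu phi) mu].

Definition is_trivial (V : hldba A) : Prop := forall v : V, v = 0.

Section Subdirect.
Variables (I : choiceType) (F : I -> hldba A).

(* carrier of the l^oo-direct sum of the F i *)
Definition linf := set_type
  [set mu : forall i, F i | exists M : C, forall i, `|mu i| <= M].

(* carrier of the l^1-direct sum of the preduals of the F i *)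
Definition l1 := set_type
  [set phi : forall i, predual (F i) |
    exists M : C, forall D : {fset I}, partial_sum (fun i => `|phi i|) D <= M].

Definition l1_linf (phi : l1) (mu : linf) : C :=
  sum (fun i => pairing (F i) (\val phi i) (\val mu i) : C^o).

(* the l^oo-direct sum with the weak* topology from the l^1-direct sum *)
Definition wprod : topologicalType :=
  initial_topology (fun mu : linf => (fun phi => l1_linf phi mu) : {ptws l1 -> C^o}).

Definition eta_vee_range : set linf :=
  [set mu | exists a, forall i, \val mu i = eta (F i) a].

(* [V] is the subdirect product of the family F, i.e. through J it is the
   weak*-closure of eta_vee(A) with the inherited algebra structure, (matrix)
   norm and, through q, predual: q is the quotient map of the l^1-direct sum
   onto its quotient by the preannihilator of that closure. The weak* topology
   of V is thereby inherited from the product, and the norm of its predual is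
   the quotient norm, as V is the dual. This determines [V] up to equivalence. *)
Definition is_subdirect (V : hldba A) : Prop :=
  exists (J : V -> linf) (q : l1 -> predual V),
  [/\ forall i, algebra_hom (fun v => \val (J v) i),
      forall a i, \val (J (eta V a)) i = eta (F i) a,
      range J = closure (eta_vee_range : set wprod),
      match s with
      | Banach => forall (v : V) (c : C), 0 <= c ->
          `|v| <= c <-> forall i, `|\val (J v) i| <= c
      | Operator => forall n (v : 'M[V]_n) (c : C), 0 <= c ->
          mxnorm v <= c <->
          forall i, mxnorm (map_mx (fun x => \val (J x) i) v) <= c
      end &
      range q = setT /\
      forall phi v, pairing V (q phi) v = l1_linf phi (J v)].

End Subdirect.

End HLD.

Section Order.
Variables (T : Type) (le : T -> T -> Prop).

Definition partial_order :=
  [/\ forall x, le x x,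
      forall x y, le x y -> le y x -> x = y &
      forall x y z, le x y -> le y z -> le x z].

Definition is_sup (S : T -> Prop) (x : T) :=
  (forall y, S y -> le y x) /\ forall z, (forall y, S y -> le y z) -> le x z.

Definition is_inf (S : T -> Prop) (x : T) :=
  (forall y, S y -> le x y) /\ forall z, (forall y, S y -> le z y) -> le z x.

Definition complete_lattice :=
  partial_order /\
  forall S : T -> Prop, (exists x, is_sup S x) /\ (exists x, is_inf S x).

Definition is_max (x : T) := forall y, le y x.

Definition is_min (x : T) := forall y, le x y.

End Order.

(* Main.v *)
(* A weak*-continuous functional on a dual space lies in the predual, and by
   Hahn-Banach the predual carries the norm induced by its dual. Hence a
   weak*-continuous operator has a bounded preadjoint, and maps of HLDBAs are
   determined by their restriction to A; in particular two HLDBAs dominating each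
   other are equivalent, and there are, up to equivalence, only set-many of them.

   The preadjoints of maps from Z to all the factors of a family F add up, on the
   l^1-sum, to absolutely convergent series. So Z maps weak*-continuously into
   the l^oo-sum, and by density into the weak*-closure of the image of A, which
   makes the subdirect product a least upper bound. Complete Ruan-type matrix
   norms on its predual come for free by letting the closure act on it; at the
   first level the result is the quotient norm of the l^1-sum, again by
   Hahn-Banach and separation, and this gives completeness. Suprema yield the
   complete lattice, the empty one being the trivial algebra. Every HLDBA W is
   below the second dual because the predual of W acts on A by bounded
   functionals. *)
From Pilot Require Import Defs.
From HB Require Import structures.
From mathcomp Require Import all_boot all_order all_algebra finmap.
From mathcomp Require Import all_classical all_reals all_analysis.
From mathcomp.analysis.showcase Require Import summability.
From mathcomp Require Import complex mxtens ring.
Import Pilot.Defs.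
Set Implicit Arguments.
Unset Strict Implicit.
Unset Printing Implicit Defensive.
Import Order.TTheory GRing.Theory Num.Theory numFieldNormedType.Exports.
Local Open Scope classical_set_scope.
Local Open Scope ring_scope.
Local Open Scope complex_scope.

(** * Operator norms of complex matrices *)

Section CSup.
Variable R : realType.
Local Notation C := R[i].
Implicit Types (S : set C) (c x y : C).

(** In general only right multiplications are weak*-continuous; left ones are so for elements of
    [A]. This asymmetry fixes the construction of products: [A] acts on the predual from the right,
    an element [nu] of the dual acts on it by the preadjoint [L nu] of right multiplication, and the
    product is then defined by duality. Since [A] separates the predual, the algebraic identities
    can be checked on [A]. [introverted_hldba] carries this out once, for the second dual and for
    the subdirect product alike.

    The l^1- and l^oo-sums are bare sets without operations. The predual is therefore realized as a
    space of functions on the weak*-closure, with norms tested on the matrices whose coordinates all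
    have norm at most 1; the coordinatewise matrix norm is then the dual one, without a bipolar
    theorem at the matrix levels.

    Equivalence does not ask the inverse isomorphism to be weak*-continuous, so even its symmetry
    has content: the preadjoint of the given isometry must be shown to be onto. *)

Lemma ReK x : 0 <= x -> (complex.Re x)%:C = x.
Proof. by move=> x0; rewrite RRe_real// ger0_real. Qed.

(** Norms take values in [C], whose order is partial, so the supremum is taken of real parts. It is
    meaningful for bounded sets of nonnegative numbers; the empty set and sets whose real parts are
    unbounded above get the value 0. *)
Definition csup S : C := (sup [set complex.Re x | x in S])%:C.

Lemma csup_le S c : 0 <= c -> (forall x, S x -> x <= c) -> csup S <= c.
Proof.
move=> c0 Sc; rewrite -(ReK c0) lecR.
have Rc0 : 0 <= complex.Re c by move: c0; rewrite lecE => /andP[].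
have [[x Sx]|S0] := pselect (S !=set0); last first.
  suff -> : S = set0 by rewrite image_set0 sup0.
  by apply/seteqP; split=> // x Sx; apply: S0; exists x.
apply: ge_sup; first by exists (complex.Re x); exists x.
by move=> _ [y Sy <-]; have := Sc _ Sy; rewrite lecE => /andP[].
Qed.

Lemma csup_ub S c x : (forall y, S y -> 0 <= y <= c) -> S x -> x <= csup S.
Proof.
move=> Sc Sx; have /andP[x0 xc] := Sc _ Sx.
rewrite -(ReK x0) lecR; apply: ub_le_sup; last by exists x.
exists (complex.Re c) => _ [y Sy <-].
by have /andP[_] := Sc _ Sy; rewrite lecE => /andP[].
Qed.

Lemma csup_ge0 S : (forall y, S y -> 0 <= y) -> 0 <= csup S.
Proof.
move=> S0; rewrite /csup ler0c.
have [[B HB]|nB] := pselect (has_sup [set complex.Re x | x in S]); last by rewrite sup_out.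
case: B => _ [x Sx _]; apply: (@le_trans _ _ (complex.Re x)).
  by have := S0 _ Sx; rewrite lecE => /andP[].
by apply: ub_le_sup => //; exists x.
Qed.

End CSup.

Section L2.
Variable R : realType.
Local Notation C := R[i].

Lemma l2normE n (v : 'cV[C]_n) : l2norm v ^+ 2 = \sum_i `|v i 0| ^+ 2.
Proof. by rewrite sqrtCK. Qed.

Lemma l2norm_ge0 n (v : 'cV[C]_n) : 0 <= l2norm v.
Proof. by rewrite sqrtC_ge0 sumr_ge0// => i _; rewrite exprn_ge0. Qed.

Lemma l2norm_le n (v : 'cV[C]_n) (c : C) : 0 <= c ->
  (l2norm v <= c) = (\sum_i `|v i 0| ^+ 2 <= c ^+ 2).
Proof. by move=> c0; rewrite -l2normE ler_pXn2r ?nnegrE ?l2norm_ge0. Qed.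

Lemma l2norm_eq0 n (v : 'cV[C]_n) : l2norm v = 0 -> v = 0.
Proof.
move=> v0; apply/matrixP => i j; rewrite ord1 mxE; apply/eqP.
have := l2normE v; rewrite v0 expr0n/= => /esym/eqP.
rewrite psumr_eq0; last by move=> k _; rewrite exprn_ge0.
by move/allP/(_ i); rewrite mem_index_enum => /(_ isT)/=; rewrite sqrf_eq0 normr_eq0.
Qed.

Lemma l2normZ n c (v : 'cV[C]_n) : l2norm (c *: v) = `|c| * l2norm v.
Proof.
apply/eqP; rewrite -(@eqrXn2 _ 2) ?mulr_ge0 ?normr_ge0 ?opnorm_ge0 ?l2norm_ge0//.
rewrite exprMn !l2normE mulr_sumr.
by apply/eqP/eq_bigr => i _; rewrite mxE normrM exprMn.
Qed.

(** With a and b the norms of [u] and [v], summing 0 <= (b|u_i| - a|v_i|)^2 gives 2ab times the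
    claim. Zero norms are treated apart because 2ab is cancelled. *)
Lemma l2norm_cauchy n (u v : 'cV[C]_n) :
  \sum_i `|u i 0| * `|v i 0| <= l2norm u * l2norm v.
Proof.
have [/eqP u0|u0] := boolP (l2norm u == 0).
  rewrite u0 mul0r (l2norm_eq0 u0) big1// => i _.
  by rewrite mxE normr0 mul0r.
have [/eqP v0|v0] := boolP (l2norm v == 0).
  rewrite v0 mulr0 (l2norm_eq0 v0) big1// => i _.
  by rewrite mxE normr0 mulr0.
set a := l2norm u; set b := l2norm v.
have a0 : 0 < a by rewrite lt_def u0 l2norm_ge0.
have b0 : 0 < b by rewrite lt_def v0 l2norm_ge0.
have ab0 : 0 < 2 * (a * b) by rewrite !mulr_gt0.
rewrite -(ler_pM2l ab0) mulr_sumr.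
have -> : 2 * (a * b) * (a * b) =
    \sum_i (b ^+ 2 * `|u i 0| ^+ 2 + a ^+ 2 * `|v i 0| ^+ 2).
  by rewrite big_split/= -!mulr_sumr -!l2normE -/a -/b; ring.
apply: ler_sum => i _; rewrite -subr_ge0.
have -> : b ^+ 2 * `|u i 0| ^+ 2 + a ^+ 2 * `|v i 0| ^+ 2
    - 2 * (a * b) * (`|u i 0| * `|v i 0|) = (b * `|u i 0| - a * `|v i 0|) ^+ 2.
  by ring.
by rewrite real_exprn_even_ge0// rpredB// rpredM// ?ger0_real// ?normr_ge0// ltW.
Qed.

Lemma l2normD n (u v : 'cV[C]_n) : l2norm (u + v) <= l2norm u + l2norm v.
Proof.
rewrite l2norm_le ?addr_ge0 ?l2norm_ge0//.
apply: (@le_trans _ _ (\sum_i (`|u i 0| + `|v i 0|) ^+ 2)).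
  by apply: ler_sum => i _; rewrite ler_pXn2r ?nnegrE ?addr_ge0 ?normr_ge0// mxE ler_normD.
under eq_bigr do rewrite sqrrD.
rewrite !big_split/= -!l2normE sqrrD lerD2r lerD2l.
by rewrite mulr2n lerD// l2norm_cauchy.
Qed.

Lemma l2norm0 n : l2norm (0 : 'cV[C]_n) = 0.
Proof. by rewrite -(scale0r (0 : 'cV[C]_n)) l2normZ normr0 mul0r. Qed.

Lemma l2norm_sum n I (r : seq I) (F : I -> 'cV[C]_n) :
  l2norm (\sum_(i <- r) F i) <= \sum_(i <- r) l2norm (F i).
Proof.
elim/big_ind2: _ => //; first by rewrite l2norm0.
by move=> x a y b xa yb; apply: (le_trans (l2normD _ _)); rewrite lerD.
Qed.

Lemma l2norm_entry n (v : 'cV[C]_n) i : `|v i 0| <= l2norm v.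
Proof.
rewrite -(@ler_pXn2r _ 2) ?nnegrE ?normr_ge0 ?l2norm_ge0// l2normE (bigD1 i)//= lerDl.
by rewrite sumr_ge0// => j _; rewrite exprn_ge0.
Qed.

End L2.

Section OpNorm.
Variable R : realType.
Local Notation C := R[i].

Lemma opnormE m n (a : 'M[C]_(m, n)) :
  opnorm a = csup [set l2norm (a *m v) | v in [set v | l2norm v <= 1]].
Proof. by rewrite /csup image_comp. Qed.

Lemma opnorm_ge0 m n (a : 'M[C]_(m, n)) : 0 <= opnorm a.
Proof. by rewrite opnormE; apply: csup_ge0 => _ [v _ <-]; exact: l2norm_ge0. Qed.

Lemma opnorm_le m n (a : 'M[C]_(m, n)) (c : C) : 0 <= c ->
  (forall v, l2norm (a *m v) <= c * l2norm v) -> opnorm a <= c.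
Proof.
move=> c0 ac; rewrite opnormE; apply: csup_le => // _ [v /= v1 <-].
by rewrite (le_trans (ac v)) ?ler_piMr.
Qed.

Lemma opnormP m n (a : 'M[C]_(m, n)) v : l2norm (a *m v) <= opnorm a * l2norm v.
Proof.
have [/eqP v0|v0] := boolP (l2norm v == 0).
  by rewrite v0 (l2norm_eq0 v0) mulmx0 l2norm0 mulr0.
have v_gt0 : 0 < l2norm v by rewrite lt_def v0 l2norm_ge0.
rewrite -ler_pdivrMr// mulrC.
have -> : (l2norm v)^-1 * l2norm (a *m v) = l2norm (a *m ((l2norm v)^-1 *: v)).
  by rewrite -scalemxAr l2normZ ger0_norm ?invr_ge0 ?l2norm_ge0.
rewrite opnormE.
(* The constant only shows that the supremum is finite: on the unit ball, the image is a combination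
   of the columns of [a] with coefficients of modulus at most 1. *)
apply: (@csup_ub _ _ (\sum_j l2norm (col j a))); last first.
  by exists ((l2norm v)^-1 *: v) => //=; rewrite l2normZ ger0_norm ?invr_ge0 ?l2norm_ge0 ?mulVf.
move=> _ [w /= w1 <-]; rewrite l2norm_ge0/=.
have -> : a *m w = \sum_j w j 0 *: col j a.
  apply/matrixP => i k; rewrite !mxE summxE; apply: eq_bigr => j _.
  by rewrite !mxE ord1 mulrC.
apply: (le_trans (l2norm_sum _ _)); apply: ler_sum => j _.
by rewrite l2normZ ler_piMl ?l2norm_ge0 ?(le_trans (l2norm_entry _ _)).
Qed.

Lemma opnormD m n (a b : 'M[C]_(m, n)) : opnorm (a + b) <= opnorm a + opnorm b.
Proof.
apply: opnorm_le => [|v]; first by rewrite addr_ge0 ?opnorm_ge0.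
by rewrite mulmxDl mulrDl (le_trans (l2normD _ _))// lerD ?opnormP.
Qed.

Lemma opnormM m n p (a : 'M[C]_(m, n)) (b : 'M[C]_(n, p)) :
  opnorm (a *m b) <= opnorm a * opnorm b.
Proof.
apply: opnorm_le => [|v]; first by rewrite mulr_ge0 ?normr_ge0 ?opnorm_ge0.
by rewrite -mulmxA (le_trans (opnormP _ _))// -mulrA ler_wpM2l ?normr_ge0 ?opnorm_ge0 ?opnormP.
Qed.

Lemma opnorm_mul3_le m n p q (u : 'M[C]_(m, n)) (v : 'M[C]_(n, p)) (w : 'M[C]_(p, q))
    (a b c : C) :
  opnorm u <= a -> opnorm v <= b -> opnorm w <= c -> opnorm (u *m v *m w) <= a * b * c.
Proof.
move=> ua vb wc; apply: (le_trans (opnormM _ _)).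
rewrite ler_pM ?opnorm_ge0//; apply: (le_trans (opnormM _ _)).
by rewrite ler_pM ?opnorm_ge0.
Qed.

Lemma opnormZ m n c (a : 'M[C]_(m, n)) : opnorm (c *: a) = `|c| * opnorm a.
Proof.
have le d (b : 'M[C]_(m, n)) : opnorm (d *: b) <= `|d| * opnorm b.
  apply: opnorm_le => [|v]; first by rewrite mulr_ge0 ?normr_ge0 ?opnorm_ge0.
  by rewrite -scalemxAl l2normZ -mulrA ler_wpM2l ?normr_ge0 ?opnorm_ge0 ?opnormP.
have [->|c0] := eqVneq c 0.
  by apply/eqP; rewrite eq_le le normr0 mul0r opnorm_ge0.
apply/eqP; rewrite eq_le le/=.
have := le c^-1 (c *: a); rewrite scalerA mulVf// scale1r => ca.
apply: (le_trans (ler_wpM2l (normr_ge0 c) ca)).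
by rewrite mulrA -normrM mulfV// normr1 mul1r.
Qed.

(** [b] is a submatrix of [a] up to reindexing: vectors are extended by zero along [g], which keeps
    their norm, and dropping the rows outside the range of [f] can only decrease the norm of the
    image. Permutations of tensor indices are the bijective case. *)
Lemma opnorm_map_inj m n m' n' (a : 'M[C]_(m, n)) (b : 'M[C]_(m', n')) f g :
  injective f -> injective g -> (forall i j, b i j = a (f i) (g j)) ->
  opnorm b <= opnorm a.
Proof.
move=> f_inj g_inj ba; apply: opnorm_le => [|v]; first by rewrite ?opnorm_ge0 ?normr_ge0.
pose w : 'cV[C]_n := \col_j \sum_(l | g l == j) v l 0.
have wg l : w (g l) 0 = v l 0.
  rewrite mxE (eq_bigl (pred1 l)) ?big_pred1_eq// => k.
  by rewrite (inj_eq g_inj).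
have w0 j : (forall l, g l != j) -> w j 0 = 0.
  by move=> gj; rewrite mxE big1// => l /eqP gl; have := gj l; rewrite gl eqxx.
have red p q (h : 'I_p -> 'I_q) (F : 'I_q -> C) : injective h ->
    (forall j, (forall l, h l != j) -> F j = 0) -> \sum_j F j = \sum_l F (h l).
  move=> h_inj F0.
  rewrite (bigID (mem [set h l | l : 'I_p]%SET))/= [X in _ + X]big1 ?addr0.
    by rewrite big_imset/=; [apply: eq_bigl | by move=> x y _ _ /h_inj].
  move=> j nj; apply: F0 => l; apply: contraNneq nj => <-.
  exact: imset_f.
have bw i : (b *m v) i 0 = (a *m w) (f i) 0.
  rewrite !mxE (red _ _ g)//; last by move=> j /w0 ->; rewrite mulr0.
  by apply: eq_bigr => l _; rewrite wg ba.
have vw : l2norm w = l2norm v.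
  apply/eqP; rewrite -(@eqrXn2 _ 2) ?l2norm_ge0// !l2normE (red _ _ g)//.
    by apply/eqP/eq_bigr => l _; rewrite wg.
  by move=> j /w0 ->; rewrite normr0 expr0n.
apply: (@le_trans _ _ (l2norm (a *m w))); last by rewrite -vw opnormP.
rewrite l2norm_le ?l2norm_ge0// l2normE (bigID (mem [set f l | l : 'I_m']%SET))/=.
rewrite big_imset/=; last by move=> x y _ _ /f_inj.
under eq_bigr do rewrite bw.
under [X in _ <= X + _]eq_bigl do rewrite inE.
by rewrite lerDl sumr_ge0// => j _; rewrite exprn_ge0.
Qed.

Lemma opnorm11 (a : 'M[C]_1) : opnorm a = `|a 0 0|.
Proof.
have E (v : 'cV[C]_1) : l2norm v = `|v 0 0|.
  by rewrite /l2norm big_ord1 sqrCK.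
apply/eqP; rewrite eq_le; apply/andP; split.
  by apply: opnorm_le => [|v]; rewrite ?normr_ge0// !E mxE big_ord1 normrM.
by have := opnormP a 1%:M; rewrite !E mulmx1 !mxE normr1 mulr1.
Qed.

Lemma opnorm_entry m n (a : 'M[C]_(m, n)) i j : `|a i j| <= opnorm a.
Proof.
have -> : `|a i j| = opnorm (\matrix_(_ < 1, _ < 1) a i j) by rewrite opnorm11 mxE.
apply: (@opnorm_map_inj _ _ _ _ _ _ (fun=> i) (fun=> j)) => [x y _|x y _|k l].
- by rewrite !ord1.
- by rewrite !ord1.
- by rewrite mxE.
Qed.

Lemma opnorm_delta m n (i : 'I_m) (j : 'I_n) : opnorm (delta_mx i j : 'M[C]_(m, n)) <= 1.
Proof.
apply: opnorm_le => [|v]; rewrite ?ler01// mul1r -[leRHS]mul1r.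
have -> : delta_mx i j *m v = v j 0 *: delta_mx i 0.
  apply/matrixP => k l; rewrite !mxE (bigD1 j)//= big1 ?addr0; last first.
    by move=> q /negPf qj; rewrite mxE qj andbF mul0r.
  by rewrite mxE !ord1 !eqxx !andbT mulrC.
rewrite l2normZ mulrC ler_pM ?normr_ge0 ?l2norm_ge0 ?l2norm_entry//.
rewrite l2norm_le ?ler01// (bigD1 i)//= big1 ?addr0; last first.
  by move=> q /negPf qi; rewrite mxE qi normr0 expr0n.
by rewrite mxE !eqxx normr1.
Qed.

Lemma big_mxtens (V : nmodType) m n (F : 'I_(m * n) -> V) :
  \sum_p F p = \sum_i \sum_j F (mxtens_index (i, j)).
Proof.
rewrite pair_big/= (reindex (@mxtens_index m n)); last first.
  by exists (@mxtens_unindex m n) => i _; rewrite (mxtens_indexK, mxtens_unindexK).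
by apply: eq_bigr => -[].
Qed.

(** The matrix is block diagonal with [k] copies of [a], and the squared l^2-norm splits over the
    blocks. *)
Lemma opnorm_tens1mx k m n (a : 'M[C]_(m, n)) :
  opnorm (tensmx (1%:M : 'M[C]_k) a) <= opnorm a.
Proof.
apply: opnorm_le => [|v]; rewrite ?opnorm_ge0//.
rewrite l2norm_le ?mulr_ge0 ?normr_ge0 ?opnorm_ge0 ?l2norm_ge0// exprMn.
rewrite l2normE !big_mxtens mulr_sumr; apply: ler_sum => i _.
pose w : 'cV[C]_n := \col_j v (mxtens_index (i, j)) 0.
have E j : (tensmx (1%:M : 'M[C]_k) a *m v) (mxtens_index (i, j)) 0 = (a *m w) j 0.
  rewrite !mxE big_mxtens (bigD1 i)//= [X in _ + X]big1 ?addr0; last first.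
    move=> l li; rewrite big1// => q _.
    by rewrite tensmxE mxE eq_sym (negPf li) !mul0r.
  by apply: eq_bigr => q _; rewrite tensmxE !mxE eqxx mul1r.
under eq_bigr do rewrite E.
have -> : \sum_j `|v (mxtens_index (i, j)) 0| ^+ 2 = l2norm w ^+ 2.
  by rewrite l2normE; apply: eq_bigr => j _; rewrite mxE.
by rewrite -l2normE -exprMn ler_pXn2r ?nnegrE ?mulr_ge0 ?opnorm_ge0 ?l2norm_ge0 ?opnormP.
Qed.

Definition tens_swap m n (p : 'I_(m * n)) : 'I_(n * m) :=
  mxtens_index ((mxtens_unindex p).2, (mxtens_unindex p).1).

Lemma tens_swapK m n : cancel (@tens_swap m n) (@tens_swap n m).
Proof.
move=> p; rewrite /tens_swap mxtens_indexK -[RHS]mxtens_unindexK.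
by congr mxtens_index; case: (mxtens_unindex p).
Qed.

(** The tensor product factors as (a ⊗ 1)(1 ⊗ b), and a ⊗ 1 becomes 1 ⊗ a when the two tensor legs
    are swapped. *)
Lemma opnorm_tensmx m n p q (a : 'M[C]_(m, n)) (b : 'M[C]_(p, q)) :
  opnorm (tensmx a b) <= opnorm a * opnorm b.
Proof.
have -> : tensmx a b = tensmx a 1%:M *m tensmx 1%:M b.
  by rewrite tensmx_mul mulmx1 mul1mx.
rewrite (le_trans (opnormM _ _))// ler_pM ?opnorm_ge0//; last exact: opnorm_tens1mx.
apply: (le_trans _ (@opnorm_tens1mx p _ _ a)).
apply: (@opnorm_map_inj _ _ _ _ _ _ (@tens_swap m p) (@tens_swap n p)).
- exact: can_inj (@tens_swapK _ _).
- exact: can_inj (@tens_swapK _ _).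
- by move=> i j; rewrite !mxE !mxtens_indexK/= mulrC.
Qed.

(** Block diagonality up to a permutation: [f] and [g] partition the indices. Abstract index maps
    are used because the blocks of an amplified direct sum are interleaved, not contiguous. *)
Lemma opnorm_cover m p q (a : 'M[C]_m) (b : 'M[C]_p) (d : 'M[C]_q)
    (f : 'I_p -> 'I_m) (g : 'I_q -> 'I_m) :
  injective f -> injective g -> (forall i j, f i != g j) ->
  (forall k, (exists i, k = f i) \/ (exists j, k = g j)) ->
  (forall i j, a (f i) (f j) = b i j) -> (forall i j, a (g i) (g j) = d i j) ->
  (forall i j, a (f i) (g j) = 0) -> (forall i j, a (g i) (f j) = 0) ->
  opnorm a = Num.max (opnorm b) (opnorm d).
Proof.
move=> f_inj g_inj fg fgT af ag afg agf.
have cmp : opnorm b >=< opnorm d by rewrite real_comparable// ger0_real ?opnorm_ge0.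
have split_sum (V : nmodType) (F : 'I_m -> V) :
    \sum_k F k = \sum_i F (f i) + \sum_j F (g j).
  rewrite (bigID (mem [set f l | l : 'I_p]%SET))/= big_imset/=; last first.
    by move=> x y _ _ /f_inj.
  congr (_ + _).
  rewrite (eq_bigl (mem [set g l | l : 'I_q]%SET))/=.
    by rewrite big_imset/=; [apply: eq_bigl | move=> x y _ _ /g_inj].
  move=> k; apply/idP/idP => [/imsetP nf|/imsetP[j _ ->]].
    case: (fgT k) => -[i ki]; last by rewrite ki; apply: imset_f.
    by exfalso; apply: nf; exists i.
  by apply/imsetP => -[i _] /esym/eqP; rewrite (negPf (fg _ _)).
apply/eqP; rewrite eq_le; apply/andP; split; last first.
  rewrite comparable_ge_max//; apply/andP; split.
    by apply: (@opnorm_map_inj _ _ _ _ _ _ f f) => // i j; rewrite af.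
  by apply: (@opnorm_map_inj _ _ _ _ _ _ g g) => // i j; rewrite ag.
set c := Num.max _ _.
have bc : opnorm b <= c by rewrite /c comparable_le_max// lexx.
have dc : opnorm d <= c by rewrite /c comparable_le_max// lexx orbT.
have c0 : 0 <= c by apply: le_trans bc; exact: opnorm_ge0.
apply: opnorm_le => // v.
pose vf : 'cV[C]_p := \col_i v (f i) 0; pose vg : 'cV[C]_q := \col_i v (g i) 0.
have Ef i : (a *m v) (f i) 0 = (b *m vf) i 0.
  rewrite !mxE split_sum [X in _ + X]big1 ?addr0; last by move=> j _; rewrite afg mul0r.
  by apply: eq_bigr => j _; rewrite af mxE.
have Eg i : (a *m v) (g i) 0 = (d *m vg) i 0.
  rewrite !mxE split_sum big1 ?add0r; last by move=> j _; rewrite agf mul0r.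
  by apply: eq_bigr => j _; rewrite ag mxE.
rewrite l2norm_le ?mulr_ge0 ?normr_ge0 ?opnorm_ge0 ?l2norm_ge0// exprMn l2normE !split_sum mulrDr.
under eq_bigr do rewrite Ef.
under [X in _ + X <= _]eq_bigr do rewrite Eg.
have Vf : \sum_i `|v (f i) 0| ^+ 2 = l2norm vf ^+ 2.
  by rewrite l2normE; apply: eq_bigr => i _; rewrite mxE.
have Vg : \sum_i `|v (g i) 0| ^+ 2 = l2norm vg ^+ 2.
  by rewrite l2normE; apply: eq_bigr => i _; rewrite mxE.
rewrite Vf Vg -!l2normE -!exprMn lerD// ler_pXn2r ?nnegrE ?mulr_ge0 ?l2norm_ge0//.
  by rewrite (le_trans (opnormP _ _))// ler_wpM2r ?l2norm_ge0.
by rewrite (le_trans (opnormP _ _))// ler_wpM2r ?l2norm_ge0.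
Qed.

End OpNorm.

(** * The Hahn-Banach theorem *)

Section HahnBanach.
Variables (R : realType) (X : lmodType R[i]) (p : X -> R).
Local Notation C := R[i].
Hypothesis pD : forall x y, p (x + y) <= p x + p y.
Hypothesis pZ : forall (c : C) x, (p (c *: x))%:C = `|c| * (p x)%:C.

Let pZr (a : R) x : p (a%:C *: x) = `|a| * p x.
Proof.
apply: complexI; rewrite pZ normc_def/= expr0n/= addr0 sqrtr_sqr.
by rewrite rmorphM.
Qed.

Let p0 : p 0 = 0.
Proof. by have := pZr 0 0; rewrite scaler0 normr0 mul0r. Qed.

(* The graph of a real-linear functional on a real subspace, dominated by p. *)
Let dominated (G : set (X * R)) :=
  [/\ G (0, 0), forall a u v, G u -> G v -> G (a%:C *: u.1 + v.1, a * u.2 + v.2)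
    & forall u, G u -> u.2 <= p u.1].

(** Subadditivity puts every lower bound u.2 - p(u.1 - x1) below every upper bound p(v.1 + x1) - v.2
    for the value at [x1]; the supremum of the lower bounds fits between them. *)
Let extend_value (G : set (X * R)) x1 : dominated G ->
  exists t : R, forall u, G u -> u.2 + t <= p (u.1 + x1) /\ u.2 - t <= p (u.1 - x1).
Proof.
move=> [G0 GL Gp]; pose S := [set u.2 - p (u.1 - x1) | u in G].
have key u v : G u -> G v -> u.2 - p (u.1 - x1) <= p (v.1 + x1) - v.2.
  move=> Gu Gv; rewrite lerBlDr addrAC lerBrDr.
  have := Gp _ (GL 1 _ _ Gu Gv); rewrite /= mul1r rmorph1 scale1r => /le_trans; apply.
  have -> : u.1 + v.1 = (v.1 + x1) + (u.1 - x1) by rewrite addrACA subrr addr0 addrC.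
  exact: pD.
exists (sup S) => u Gu.
have Sub : has_ubound S.
  by exists (p (0 + x1) - 0) => _ [v Gv <-]; apply: (key v (0, 0)).
split; last by rewrite lerBlDr -lerBlDl; apply: ub_le_sup => //; exists u.
rewrite addrC -lerBrDr; apply: ge_sup.
  by exists (0 - p (0 - x1)); exists (0, 0).
by move=> _ [v Gv <-]; apply: key.
Qed.

Let extend (G : set (X * R)) x1 : dominated G ->
  exists H, [/\ dominated H, G `<=` H & exists t, H (x1, t)].
Proof.
move=> dG; have [t tP] := extend_value x1 dG; case: (dG) => G0 GL Gp.
exists [set w | exists u (a : R), G u /\ w = (u.1 + a%:C *: x1, u.2 + a * t)].
split; last 2 first.
- by move=> [x r] Gx; exists (x, r), 0; rewrite /= rmorph0 scale0r mul0r !addr0.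
- by exists t, (0, 0), 1; rewrite /= rmorph1 scale1r mul1r !add0r.
split.
- by exists (0, 0), 0; rewrite /= rmorph0 scale0r mul0r !addr0.
- move=> a _ _ [u [b [Gu ->]]] [v [c [Gv ->]]]/=.
  exists (a%:C *: u.1 + v.1, a * u.2 + v.2), (a * b + c); split; first exact: GL.
  congr pair => /=; last by ring.
  by rewrite scalerDr rmorphD rmorphM/= scalerDl scalerA addrACA.
- move=> _ [u [a [Gu ->]]]/=.
  have sc (b : R) : 0 < b -> G (b^-1%:C *: u.1, b^-1 * u.2).
    by move=> b0; have := GL b^-1 _ _ Gu G0; rewrite /= !addr0.
  have pZp (b : R) x : 0 < b -> b * p x = p (b%:C *: x) by move=> b0; rewrite pZr gtr0_norm.
  (* By homogeneity of [p], a nonzero multiple of [x1] reduces to [x1] or its opposite after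
     division by |a|; these are the two inequalities of [extend_value]. *)
  have [a0|a0|->] := ltgtP a 0; last 2 first.
  + have [/= + _] := tP _ (sc _ a0); rewrite -(ler_pM2l a0) (pZp _ _ a0).
    rewrite mulrDr mulrA mulfV ?gt_eqF// mul1r; congr (_ <= p _).
    by rewrite scalerDr scalerA -rmorphM/= mulfV ?gt_eqF// scale1r.
  + by rewrite rmorph0 scale0r mul0r !addr0 Gp.
  have b0 : 0 < - a by rewrite oppr_gt0.
  have [/= _] := tP _ (sc _ b0); rewrite -(ler_pM2l b0) (pZp _ _ b0).
  rewrite mulrBr mulrA mulfV ?gt_eqF// mul1r mulNr opprK; congr (_ <= p _).
  by rewrite scalerBr scalerA -rmorphM/= mulfV ?gt_eqF// scale1r rmorphN/= scaleNr opprK.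
Qed.

Let maximal_dominated G0 : dominated G0 ->
  exists G, [/\ dominated G, G0 `<=` G & forall H, dominated H -> G `<=` H -> H = G].
Proof.
move=> dG0; pose T := {G : set (X * R) | dominated G /\ G0 `<=` G}.
pose le (G H : T) := `[< sval G `<=` sval H >].
have lerefl G : le G G by apply/asboolP.
have letrans G H K : le G H -> le H K -> le G K.
  by move=> /asboolP GH /asboolP HK; apply/asboolP; apply: subset_trans HK.
have leanti G H : le G H -> le H G -> G = H.
  case: G H => [G dG] [H dH] /asboolP GH /asboolP HG.
  have E : G = H by apply/seteqP.
  by subst H; congr exist; apply: Prop_irrelevance.
have [A totA|G maxG] := Zorn lerefl letrans leanti.
  (* The union of an empty chain would be empty and miss [G0], so [G0] itself bounds that chain. *)
  have [[H0 AH0]|A0] := pselect (A !=set0); last first.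
    by exists (exist _ G0 (conj dG0 (@subset_refl _ G0))) => s As; exfalso; apply: A0; exists s.
  pose U : set (X * R) := [set w | exists2 H, A H & sval H w].
  have UP : dominated U /\ G0 `<=` U.
    split; last by move=> w G0w; exists H0 => //; apply: (svalP H0).2.
    split.
    - by exists H0 => //; case: (svalP H0) => -[].
    - move=> a u v [H AH Hu] [K AK Kv].
      have [/asboolP HK|/asboolP KH] := totA _ _ AH AK.
        by exists K => //; have [[_ KL _] _] := svalP K; apply: KL => //; apply: HK.
      by exists H => //; have [[_ HL _] _] := svalP H; apply: HL => //; apply: KH.
    - by move=> u [H AH Hu]; have [[_ _ Hp] _] := svalP H; apply: Hp.
  by exists (exist _ U UP) => H AH; apply/asboolP => w Hw; exists H.
exists (sval G); have [dG G0G] := svalP G; split=> // H dH GH.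
by have /(congr1 sval) := maxG (exist _ H (conj dH (subset_trans G0G GH))) (asboolT GH).
Qed.

Let real_hahn_banach x0 : exists g : X -> R,
  [/\ forall (a : R) x y, g (a%:C *: x + y) = a * g x + g y,
      forall x, g x <= p x & g x0 = p x0].
Proof.
pose G0 := [set w | exists a : R, w = (a%:C *: x0, a * p x0)].
have dG0 : dominated G0.
  split; first by exists 0; rewrite rmorph0 scale0r mul0r.
    move=> a _ _ [b ->] [c ->] /=; exists (a * b + c).
    by congr pair; rewrite ?mulrDl ?mulrA// rmorphD rmorphM/= scalerDl scalerA.
  move=> _ [a ->]/=; rewrite pZr ler_wpM2r ?ler_norm//.
  have := pD x0 (- x0); rewrite subrr p0.
  have := pZr (-1) x0; rewrite rmorphN rmorph1 scaleN1r normrN1 mul1r => ->.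
  by rewrite -mulr2n pmulrn_lge0.
have [G [dG G0G Gmax]] := maximal_dominated dG0.
have Gtot x : exists r, G (x, r).
  by have [H [dH GH [t Ht]]] := extend x dG; exists t; rewrite -(Gmax H dH GH).
have [G00 GL Gp] := dG.
have Gfun x r t : G (x, r) -> G (x, t) -> r = t.
  move=> Gr Gt.
  have le a b : G (x, a) -> G (x, b) -> a <= b.
    move=> Ga Gb; have := Gp _ (GL (-1) _ _ Gb Ga).
    by rewrite /= rmorphN rmorph1 scaleN1r addNr p0 mulN1r addrC subr_le0.
  by apply/eqP; rewrite eq_le !le.
have [g gP] := choice Gtot.
exists g; split=> [a x y|x|].
- by apply: Gfun (gP _) _; apply: (GL a (x, g x) (y, g y)).
- exact: Gp (gP x).
- by apply: Gfun (gP _) _; apply: G0G; exists 1; rewrite rmorph1 scale1r mul1r.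
Qed.

(** A real-linear [g] dominated by [p] is complexified to f(x) = g(x) - i g(ix). Rotating [x] by a
    unimodular scalar turns the bound on [g] into one on |f|. At [x0] the real part already equals
    p(x0), which leaves no room for an imaginary part. *)
Lemma hahn_banach x0 : exists f : X -> C,
  [/\ scalar f, forall x, `|f x| <= (p x)%:C & f x0 = (p x0)%:C].
Proof.
have [g [gL gp g0]] := real_hahn_banach x0.
have gD x y : g (x + y) = g x + g y.
  by have := gL 1 x y; rewrite rmorph1 scale1r mul1r.
have g00 : g 0 = 0 by have := gD 0 0; rewrite addr0 -{1}(addr0 (g 0)) => /addrI.
have gZ (a : R) x : g (a%:C *: x) = a * g x.
  by have := gL a x 0; rewrite !addr0 g00 addr0.
pose f x : C := g x +i* - g ('i%C *: x).
have fD x y : f (x + y) = f x + f y.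
  by rewrite /f scalerDr !gD opprD.
have fZr (a : R) x : f (a%:C *: x) = a%:C * f x.
  rewrite /f scalerA mulrC -scalerA !gZ.
  by apply/eqP; rewrite eq_complex/=; apply/andP; split; apply/eqP; ring.
have fZi x : f ('i%C *: x) = 'i%C * f x.
  rewrite /f scalerA -expr2 sqr_i scaleN1r.
  have -> : g (- x) = - g x by have := gZ (-1) x; rewrite rmorphN rmorph1 scaleN1r mulN1r.
  by apply/eqP; rewrite eq_complex/=; apply/andP; split; apply/eqP; ring.
have fZ c x : f (c *: x) = c * f x.
  by rewrite [c]complexE scalerDl fD -scalerA fZi !fZr mulrDl mulrA.
have fL : scalar f by move=> c x y; rewrite fD fZ.
have fp x : `|f x| <= (p x)%:C.
  have [fx0|fx0] := eqVneq (f x) 0.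
    have : (0 : C) <= `|f x| by [].
    rewrite fx0 normr0 => _; rewrite ler0c.
    have := gp x; have := gp (-1 *: x).
    have -> : (-1 : C) = (-1 : R)%:C by rewrite rmorphN rmorph1.
    by rewrite gZ pZr normrN1 mul1r mulN1r => h1 h2; have := lerD h1 h2;
       rewrite addNr -mulr2n pmulrn_lge0.
  pose c := `|f x| / f x.
  have nc : `|c| = 1 by rewrite normrM normfV normr_id mulfV// normr_eq0.
  have fc : f (c *: x) = `|f x| by rewrite fZ mulfVK.
  have -> : (p x)%:C = (p (c *: x))%:C by rewrite pZ nc mul1r.
  have : complex.Re (f (c *: x)) <= p (c *: x) by apply: gp.
  by rewrite fc -lecR RRe_real.
exists f; split=> //.
have Ref : complex.Re (f x0) = p x0 by rewrite /= g0.
have : `|f x0| = (p x0)%:C.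
  apply/eqP; rewrite eq_le fp -Ref/=.
  by apply: le_trans (normc_ge_Re _); rewrite lecR ler_norm.
rewrite normc_def => /complexI; rewrite Ref => e.
have : p x0 ^+ 2 + complex.Im (f x0) ^+ 2 = p x0 ^+ 2.
  by rewrite -{2}e sqr_sqrtr// addr_ge0// sqr_ge0.
rewrite -[RHS]addr0 => /addrI/eqP; rewrite sqrf_eq0 => /eqP Imf.
by apply/eqP; rewrite eq_complex Ref Imf !eqxx.
Qed.

End HahnBanach.

(** * Separation in weak topologies *)

Section Separation.
Variable R : realType.
Local Notation C := R[i].

Definition functional_space (E : lmodType C) (G : set (E -> C)) : Prop :=
  (forall g, G g -> scalar g) /\
  (forall a g h, G g -> G h -> G (fun e => a * g e + h e)).

Definition subspace (E : lmodType C) (S : set E) : Prop :=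
  S 0 /\ forall a x y, S x -> S y -> S (a *: x + y).

Lemma scalarE (E : lmodType C) (g : E -> C) : scalar g ->
  [/\ g 0 = 0, forall x y, g (x + y) = g x + g y & forall a x, g (a *: x) = a * g x].
Proof.
move=> gL; have gD x y : g (x + y) = g x + g y.
  by have := gL 1 x y; rewrite scale1r mul1r.
have g0 : g 0 = 0 by have := gD 0 0; rewrite addr0 -{1}(addr0 (g 0)) => /addrI.
by split=> // a x; have := gL a x 0; rewrite !addr0 g0 addr0.
Qed.

(* Induction on the number of functionals: if [g] is the first one and [y0] in
   [S] satisfies [g y0 = 1], then [S] is cut down to the kernel of [g] and [mu]
   is translated along [y0]. *)
Lemma separation_finite (E : lmodType C) (G : set (E -> C)) (s : seq (E -> C))
    (S : set E) (mu : E) :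
  functional_space G -> subspace S -> G (fun=> 0) -> (forall g, List.In g s -> G g) ->
  ~ (exists2 y, S y & forall g, List.In g s -> g y = g mu) ->
  exists g, [/\ G g, forall y, S y -> g y = 0 & g mu != 0].
Proof.
move=> [Glin GL]; elim: s S mu => [|g s IH] S mu [S0 SL] G0 sG nS.
  by exfalso; apply: nS; exists 0.
have Gg : G g by apply: sG; left.
have [g0 gD gZ] := scalarE (Glin _ Gg).
have sG' h : List.In h s -> G h by move=> hs; apply: sG; right.
have [gS|/existsNP[y1 /not_implyP[Sy1 /eqP gy1]]] :=
    pselect (forall y, S y -> g y = 0).
  have [gmu|gmu] := eqVneq (g mu) 0; last by exists g.
  apply: IH => // -[y Sy ysmu]; apply: nS; exists y => // h [<-|hs].
    by rewrite gmu gS.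
  exact: ysmu.
pose y0 := (g y1)^-1 *: y1.
have gy0 : g y0 = 1 by rewrite gZ mulVf.
have SZ a x : S x -> S (a *: x) by move=> Sx; rewrite -[_ *: _]addr0; apply: SL.
have Sy0 : S y0 by apply: SZ.
pose S' := [set y | S y /\ g y = 0].
have [||h [Gh hS' hmu]] := IH S' (mu - g mu *: y0) _ G0 sG'.
- split=> [|a x y [Sx gx] [Sy gy]]; first by split.
  by split; [exact: SL|rewrite gD gZ gx gy mulr0 addr0].
- move=> [y [Sy gy] ys]; apply: nS; exists (y + g mu *: y0).
    by rewrite addrC; apply: SL.
  move=> h [<-|hs]; first by rewrite gD gZ gy gy0 mulr1 add0r.
  have [_ hD hZ] := scalarE (Glin _ (sG' _ hs)).
  by rewrite hD ys// -hD subrK.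
have [h0 hD hZ] := scalarE (Glin _ Gh).
exists (fun e => - h y0 * g e + h e); split; first exact: GL.
  move=> y Sy; have : h (- g y *: y0 + y) = 0.
    by apply: hS'; split; [exact: SL|rewrite gD gZ gy0 mulr1 addNr].
  by rewrite hD hZ !mulNr mulrC.
have : h (- g mu *: y0 + mu) != 0 by rewrite addrC scaleNr.
by rewrite hD hZ !mulNr mulrC.
Qed.

(** Separation is applied in E * C to the graph of [f] and the point (0, 1), which no point of the
    graph matches on the second coordinate and on all of [s]. The separating functional g(y) + a c
    vanishes on the graph and has a nonzero, so f = - g / a. *)
Lemma kernel_functional (E : lmodType C) (G : set (E -> C)) (s : seq (E -> C)) f :
  functional_space G -> G (fun=> 0) -> (forall g, List.In g s -> G g) -> scalar f ->
  (forall y, (forall g, List.In g s -> g y = 0) -> f y = 0) -> G f.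
Proof.
move=> GP G0 sG /scalarE[f0 fD fZ] sf; have [Glin GL] := GP.
pose H := [set h : E * C^o -> C | exists2 g, G g & exists a, h = (fun e => g e.1 + a * e.2)].
pose S := [set e : E * C^o | e.2 = f e.1].
pose t := (fun e : E * C^o => e.2 : C) :: [seq (fun e : E * C^o => g e.1) | g <- s].
have HP : functional_space H.
  split=> [_ [g Gg [a ->]] b x y|b _ _ [g Gg [a ->]] [h Gh [c ->]]].
    by have [_ gD gZ] := scalarE (Glin _ Gg); rewrite /= gD gZ /GRing.scale/=; ring.
  exists (fun e => b * g e + h e); first exact: GL.
  by exists (b * a + c); apply/funext => e; ring.
have [||||h [[g Gg [a ->]] hS ha]] := @separation_finite _ H t S (0, 1) HP.
- by split=> [|b x y Sx Sy]; rewrite /S/= ?f0// fD fZ -Sx -Sy.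
- by exists (fun=> 0) => //; exists 0; apply/funext => e; rewrite mul0r addr0.
- move=> h [<-|].
    by exists (fun=> 0) => //; exists 1; apply/funext => e; rewrite mul1r add0r.
  elim: s sG {sf t} => //= g s IH sG [<-|]; last by apply: IH => k ks; apply: sG; right.
  exists g; first by apply: sG; left.
  by exists 0; apply/funext => e; rewrite mul0r addr0.
- move=> [[y c] Sy yt]; have /= c1 := yt _ (or_introl erefl).
  have /= cf : c = f y by exact: Sy.
  suff : f y = 0 by rewrite -cf c1 => /eqP; rewrite oner_eq0.
  apply: sf => g gs.
  have [g0 _ _] := scalarE (Glin _ (sG _ gs)).
  rewrite -g0; apply: (yt (fun e => g e.1)); right.
  elim: (s) gs => //= k r IH [->|/IH]; first by left.
  by right.
have [g0 _ _] := scalarE (Glin _ Gg); rewrite /= g0 add0r mulr1 in ha.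
have -> : f = (fun e => (- a^-1) * g e + 0).
  apply/funext => y; have /eqP := hS (y, f y) erefl.
  rewrite /= addrC addr_eq0 => /eqP ay; by rewrite addr0 mulNr -mulrN -ay mulrA mulVf// mul1r.
exact: GL.
Qed.

End Separation.

Section WeakTopology.
Variables (R : realType) (T E : choiceType) (ev : E -> T -> R[i]).
Local Notation C := R[i].
Local Notation W := (initial_topology (ev : E -> {ptws T -> C^o})).

Lemma weak_ev_continuous t : continuous (fun e : W => ev e t : C^o).
Proof.
move=> e; apply: (@cvg_comp _ _ _ (ev : W -> {ptws T -> C^o}) (fun h => h t)).
  exact: initial_continuous.
exact: (@proj_continuous T (fun=> C^o) t).
Qed.

Lemma weak_cvg (F : set_system E) (e : W) : Filter F ->
  (forall t, (fun e' => ev e' t : C^o) @ F --> (ev e t : C^o)) -> F --> e.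
Proof.
move=> FF Ft U; rewrite nbhsE => -[_ [[A Aop <-] Ae] /filterS]; apply.
have : (fun e' : W => ev e' : {ptws T -> C^o}) @ F --> (ev e : {ptws T -> C^o}).
  apply/cvg_sup => t V; rewrite nbhsE => -[_ [[B Bop <-] Be]] BV.
  by apply: (filterS BV); apply: (Ft t); exact: open_nbhs_nbhs.
by apply; exact: open_nbhs_nbhs.
Qed.

End WeakTopology.

Section WeakNeighbourhoods.
Variables (R : realType) (T E : choiceType) (ev : E -> T -> R[i]).
Local Notation C := R[i].
Local Notation W := (initial_topology (ev : E -> {ptws T -> C^o})).

(** The topology is defined as an initial one, without a basis. The sets containing a neighbourhood
    of [e] given by finitely many coordinates form a filter, which converges to [e] by [weak_cvg]
    and hence contains all neighbourhoods. *)
Lemma weak_nbhs (e : W) (U : set W) : nbhs e U ->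
  exists (s : seq T) (r : C), 0 < r /\
    forall e', (forall t, List.In t s -> `|ev e t - ev e' t| < r) -> U e'.
Proof.
pose F : set_system E := [set V | exists (s : seq T) (r : C), 0 < r /\
  forall e', (forall t, List.In t s -> `|ev e t - ev e' t| < r) -> V e'].
have FF : Filter F.
  split=> [|A B [s [r [r0 sA]]] [t [q [q0 tB]]]|A B AB [s [r [r0 sA]]]].
  - by exists [::], 1.
  - have rq : r >=< q by rewrite real_comparable// gtr0_real.
    exists (s ++ t), (Num.min r q); split; first by rewrite comparable_lt_min// r0.
    move=> e' e'st; split; [apply: sA|apply: tB] => x xs.
      have := e'st x (List.in_or_app _ _ _ (or_introl xs)).
      by rewrite comparable_lt_min// => /andP[].
    have := e'st x (List.in_or_app _ _ _ (or_intror xs)).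
    by rewrite comparable_lt_min// => /andP[].
  - by exists s, r; split=> // e' e's; apply: AB; apply: sA.
suff Fe : F --> e by move=> eU; apply: (Fe U).
apply: weak_cvg => t; apply/cvgrPdist_lt => r r0.
by exists [:: t], r; split=> // e' /(_ t); apply; left.
Qed.

(** [E] is only a type: its points are embedded as functions on [T], where the linear structure
    lives. This form applies to [linf], which has no vector space structure. *)
Lemma weak_separation (S : set E) (mu : E) (G : set ((T -> C) -> C)) :
  functional_space G -> subspace (ev @` S) -> G (fun=> 0) -> (forall t, G (fun y => y t)) ->
  ~ closure (S : set W) mu ->
  exists g, [/\ G g, forall e, S e -> g (ev e) = 0 & g (ev mu) != 0].
Proof.
move=> GP SP G0 Gt /existsNP[U /not_implyP[muU nSU]].
have [s [r [r0 sU]]] := weak_nbhs muU.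
have [||g [Gg gS gmu]] := @separation_finite _ _ G [seq (fun y => y t) | t <- s] _ (ev mu) GP SP G0.
- by elim: (s) => //= t l IH g [<-|/IH].
- move=> [_ [e Se <-] es]; apply: nSU; exists e; split=> //.
  apply: sU => t ts; suff -> : ev e t = ev mu t by rewrite subrr normr0.
  apply: (es (fun y => y t)).
  by elim: (s) ts => //= x l IH [->|/IH]; [left|right].
- by exists g; split=> // e Se; apply: gS; exists e.
Qed.

End WeakNeighbourhoods.

(** Continuity at 0 gives |f| < 1 on the common kernel of finitely many evaluations. That kernel is
    a subspace, so [f] vanishes on it and is a combination of those evaluations. *)
Lemma weak_continuous_functional (R : realType) (T : choiceType) (E : lmodType R[i])
    (ev : E -> T -> R[i]) (G : set (E -> R[i])) (f : E -> R[i]) :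
  (forall t, G (ev^~ t)) -> functional_space G -> G (fun=> 0) -> scalar f ->
  continuous (f : initial_topology (ev : E -> {ptws T -> R[i]^o}) -> R[i]^o) -> G f.
Proof.
move=> Gt GP G0 fL fcont; have [f0 _ fZ] := scalarE fL.
have [s [r [r0 sf]]] : exists (s : seq T) (r : R[i]), 0 < r /\
    forall e', (forall t, List.In t s -> `|ev 0 t - ev e' t| < r) -> `|f e'| < 1.
  apply: (weak_nbhs (U := [set e' | `|f e'| < 1])).
  have /cvgrPdist_lt/(_ 1 ltr01) := fcont 0; rewrite f0.
  by apply: filterS => e' /=; rewrite sub0r normrN.
apply: (kernel_functional (s := [seq ev^~ t | t <- s]) GP G0 _ fL).
  by elim: (s) => //= t l IH g [<-|/IH].
move=> y ys; apply/eqP/negPn/negP => fy.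
suff : `|f ((f y)^-1 *: y)| < 1 by rewrite fZ mulVf// normr1 ltxx.
apply: sf => t ts; have [ev0 _ evZ] := scalarE (GP.1 _ (Gt t)).
rewrite ev0 evZ (_ : ev y t = 0) ?mulr0 ?subrr ?normr0//.
apply: (ys (ev^~ t)).
by elim: (s) ts => //= x l IH [->|/IH]; [left|right].
Qed.

(** * Completeness and summable families *)

Section FastCauchy.

Definition pow2 (K : numFieldType) k : K := 2 ^- k.

(** Completeness in terms of the norm alone, so that it can be proved for a function space before
    the complete structure is declared on it. *)
Definition fast_complete (K : numFieldType) (V : normedZmodType K) : Prop :=
  forall u : nat -> V, (forall k, `|u k.+1 - u k| <= pow2 K k) ->
    exists l, forall e, 0 < e -> exists N, forall k, (N <= k)%N -> `|u k - l| <= e.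

Lemma pow2_gt0 (K : numFieldType) k : 0 < pow2 K k.
Proof. by rewrite /pow2 invr_gt0 exprn_gt0. Qed.

Lemma pow2_ge0 (K : numFieldType) k : 0 <= pow2 K k.
Proof. by rewrite ltW// pow2_gt0. Qed.

Lemma pow2S (K : numFieldType) k : pow2 K k.+1 = pow2 K k / 2.
Proof. by rewrite /pow2 exprS invfM mulrC. Qed.

Lemma fast_cauchy_le (K : numFieldType) (V : normedZmodType K) (u : nat -> V) :
  (forall k, `|u k.+1 - u k| <= pow2 K k) ->
  forall m k, `|u (m + k)%N - u m| <= 2 * pow2 K m - 2 * pow2 K (m + k).
Proof.
move=> uP m; elim=> [|k IH]; first by rewrite addn0 !subrr normr0.
rewrite addnS -(subrKA (u (m + k)%N)) (le_trans (ler_normD _ _))//.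
rewrite (le_trans (lerD (uP _) IH))// pow2S.
rewrite [X in _ <= _ - X](_ : _ = pow2 K (m + k)); last first.
  by rewrite mulrCA mulfV ?mulr1.
suff -> : pow2 K (m + k) + (2 * pow2 K m - 2 * pow2 K (m + k)) =
  2 * pow2 K m - pow2 K (m + k) by [].
by ring.
Qed.

Lemma fast_cauchy_le2 (K : numFieldType) (V : normedZmodType K) (u : nat -> V) :
  (forall k, `|u k.+1 - u k| <= pow2 K k) ->
  forall m k, (m <= k)%N -> `|u k - u m| <= 2 * pow2 K m.
Proof.
move=> uP m k mk; rewrite -(subnKC mk) (le_trans (fast_cauchy_le uP _ _))//.
by rewrite gerBl mulr_ge0// ltW// pow2_gt0.
Qed.

Lemma pow2_small (R : realType) (e : R[i]) : 0 < e -> exists N, pow2 _ N < e.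
Proof.
move=> e0; have eE := ReK (ltW e0).
have Re0 : 0 < complex.Re e by rewrite -ltcR eE.
exists (Num.bound (complex.Re e)^-1).
set n := Num.bound _.
have en : (complex.Re e)^-1 < 2 ^+ n.
  apply: (@lt_le_trans _ _ n%:R); last by rewrite -natrX ler_nat ltnW// ltn_expl.
  by apply: archi_boundP; rewrite invr_ge0 ltW.
rewrite /pow2 invf_plt ?posrE ?exprn_gt0// -eE -fmorphV.
by rewrite (_ : 2 ^+ n = (2 ^+ n : R)%:C) ?ltcR// rmorphXn/= rmorphMn rmorph1.
Qed.

Lemma fast_complete_cvg (K : numFieldType) (V : completeNormedModType K) :
  (forall e : K, 0 < e -> exists N, pow2 K N < e) -> fast_complete V.
Proof.
move=> small u uP.
have small2 e : 0 < e -> exists N, forall k, (N <= k)%N -> `|u k - u N| < e.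
  move=> e0; have [N Ne] := small _ (divr_gt0 e0 (ltr0n K 2)).
  exists N => k Nk; apply: le_lt_trans (fast_cauchy_le2 uP Nk) _.
  by rewrite mulrC -ltr_pdivlMr.
have : cauchy (u @ \oo).
  apply/cauchyP => e e0; have [N NP] := small2 _ e0.
  exists (u N); exists N => // k /= /NP; rewrite -ball_normE/=.
  by rewrite distrC.
move=> /cauchy_cvg/cvg_ex[l /cvgrPdist_le ul]; exists l => e e0.
have [N _ NP] := ul e e0; exists N => k Nk; rewrite distrC; exact: NP.
Qed.

Lemma cauchy_cvg_fast (R : realType) (V : normedModType R[i]) (F : set_system V) :
  fast_complete V -> ProperFilter F -> cauchy F -> cvg F.
Proof.
move=> FC FF /cauchyP Fc.
(* The radius is 2^-(k+1) because two balls of the filter meet: successive centres are then at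
   distance at most 2^-(k+1) + 2^-(k+2), which is below 2^-k. *)
have /choice[x xP] : forall k, exists x, F (ball x (pow2 R[i] k.+1)).
  by move=> k; apply: Fc; exact: pow2_gt0.
have xx m k : `|x m - x k| < pow2 R[i] m.+1 + pow2 R[i] k.+1.
  have [y []] := filter_ex (filterI (xP m) (xP k)).
  rewrite -!ball_normE/= => my ky.
  by rewrite -(subrKA y) (le_lt_trans (ler_normD _ _))// ltrD// distrC.
have [k|l lP] := FC x.
  apply/ltW/(lt_le_trans (xx _ _)); rewrite !pow2S.
  have := pow2_gt0 R[i] k; set r := pow2 _ _ => r0.
  rewrite [leRHS]splitr lerD2r ler_piMr ?invf_le1 ?ler1n//.
  by rewrite ltW// divr_gt0.
apply/cvg_ex; exists l; apply/cvgrPdist_le => e e0.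
have [N1 N1P] := lP _ (divr_gt0 e0 (ltr0n _ 2)).
have [N2 N2P] := pow2_small (divr_gt0 e0 (ltr0n _ 2)).
pose N := maxn N1 N2.
apply: filterS (xP N) => y; rewrite -ball_normE/= => xy.
rewrite -(subrKA (x N)) (le_trans (ler_normD _ _))// [e]splitr lerD//.
  by rewrite distrC N1P// leq_maxl.
rewrite (le_trans (ltW xy))// (le_trans _ (ltW N2P))//.
rewrite /pow2 lef_pV2 ?posrE ?exprn_gt0// ler_weXn2l ?ler1n//.
by rewrite (leq_trans (leq_maxr N1 N2)).
Qed.

Lemma complex_fast_complete (R : realType) : fast_complete (R[i] : normedZmodType R[i]).
Proof.
move=> u uP.
have part (f : R[i] -> R) : (forall x y, f (x - y) = f x - f y) ->
    (forall x, `|f x|%:C <= `|x|) ->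
    exists l, forall e, 0 < e -> exists N, forall k, (N <= k)%N -> `|f (u k) - l| <= e.
  move=> fB fle; apply: (@fast_complete_cvg R R^o _ (f \o u)) => [e e0|k].
    have [|N NP] := @pow2_small R e%:C; first by rewrite ltcR.
    exists N; rewrite -ltcR; apply: le_lt_trans NP.
    by rewrite /pow2 rmorphV/= ?rmorphXn ?rmorphMn ?rmorph1// unitfE expf_neq0.
  rewrite /= -fB -lecR (le_trans (fle _))// (le_trans (uP k))//.
  by rewrite /pow2 fmorphV/= rmorphXn rmorphMn rmorph1.
have [||a aP] := part (@complex.Re R); [by case=> ? ? [] | exact: normc_ge_Re |].
have [||b bP] := part (@complex.Im R); [by case=> ? ? [] | |].
  move=> x; have := normc_ge_Re (x * 'i%C).
  rewrite ReiNIm normrN normrM [X in _ * X](_ : _ = 1) ?mulr1//.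
  by rewrite normc_def/= expr0n expr1n add0r sqrtr1.
exists (a +i* b) => e e0; have eE := ReK (ltW e0).
have e20 : 0 < complex.Re e / 2 by rewrite divr_gt0// -ltcR eE.
have [N1 N1P] := aP _ e20; have [N2 N2P] := bP _ e20.
exists (maxn N1 N2) => k; rewrite geq_max => /andP[/N1P ka /N2P kb].
have -> : u k - (a +i* b) = (complex.Re (u k) - a)%:C + 'i%C * (complex.Im (u k) - b)%:C.
  by case: (u k) => x y; rewrite [LHS]complexE.
rewrite (le_trans (ler_normD _ _))// normrM [X in X * _](_ : _ = 1) ?mul1r; last first.
  by rewrite normc_def/= expr0n expr1n add0r sqrtr1.
have nR (x : R) : `|x%:C| = `|x|%:C by rewrite normc_def/= expr0n/= addr0 sqrtr_sqr.
by rewrite !nR -rmorphD/= -eE lecR [complex.Re e]splitr lerD.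
Qed.

End FastCauchy.

Section HasSum.
Variables (R : realType) (I : choiceType).
Local Notation C := R[i].

(** Unconditional convergence along the net of finite subsets; [has_sum_sum] links it with [sum]. *)
Definition has_sum (V : normedZmodType C) (x : I -> V) (l : V) : Prop :=
  forall e : C, 0 < e -> exists D0 : {fset I}, forall D : {fset I}, (D0 `<=` D)%fset ->
    `|partial_sum x D - l| <= e.

Lemma partial_sumE (V : zmodType) (x : I -> V) (D : {fset I}) :
  partial_sum x D = \sum_(i <- D) x i.
Proof. by rewrite big_seq_fsetE. Qed.

Lemma partial_sum_fsetU (V : zmodType) (x : I -> V) (A B : {fset I}) :
  [disjoint A & B]%fset -> partial_sum x (A `|` B)%fset = partial_sum x A + partial_sum x B.
Proof.
move=> AB; rewrite !partial_sumE -big_cat; apply: perm_big.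
apply: uniq_perm; rewrite ?fset_uniq ?cat_uniq ?fset_uniq ?andbT//=.
  by apply/hasPn => i iB; apply: contraL iB => iA; move/fdisjointP: AB; apply.
by move=> i; rewrite mem_cat in_fsetU.
Qed.

Lemma partial_sumD (V : zmodType) (x : I -> V) (A B : {fset I}) : (A `<=` B)%fset ->
  partial_sum x B = partial_sum x A + partial_sum x (B `\` A)%fset.
Proof.
move=> AB; rewrite -partial_sum_fsetU; last first.
  by apply/fdisjointP => i iA; rewrite in_fsetD iA.
by congr partial_sum; rewrite fsetUDl fsetDv fsetD0; apply/esym/fsetUidPr.
Qed.

Lemma partial_sum_norm_ge0 (V : normedZmodType C) (x : I -> V) (D : {fset I}) :
  0 <= partial_sum (fun i => `|x i|) D.
Proof. by rewrite sumr_ge0. Qed.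

Lemma norm_partial_sum (V : normedZmodType C) (x : I -> V) (D : {fset I}) :
  `|partial_sum x D| <= partial_sum (fun i => `|x i|) D.
Proof. exact: ler_norm_sum. Qed.

(** [D0] is chosen so that its partial sum is within [e] of the supremum of all partial sums; a
    disjoint set cannot add more than [e]. *)
Lemma abs_summable_tail (V : normedZmodType C) (x : I -> V) (M : C) :
  (forall D, partial_sum (fun i => `|x i|) D <= M) ->
  forall e, 0 < e -> exists D0, forall D, [disjoint D0 & D]%fset ->
    partial_sum (fun i => `|x i|) D <= e.
Proof.
move=> xM e e0; pose p D := partial_sum (fun i => `|x i|) D.
pose S := csup [set p D | D in setT].
have pS D : p D <= S.
  apply: (@csup_ub _ _ M); last by exists D.
  by move=> _ [D' _ <-]; rewrite partial_sum_norm_ge0 xM.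
have pr D : p D \is Num.real by rewrite ger0_real// partial_sum_norm_ge0.
have Sr : S \is Num.real by rewrite ger0_real// (le_trans _ (pS fset0%fset))// partial_sum_norm_ge0.
have [D0 D0P] : exists D0, S - e <= p D0.
  apply: contrapT => /forallNP nD.
  have lt D : p D <= S - e.
    have /negP := nD D; rewrite -real_ltNge ?rpredB ?(gtr0_real e0)//; exact: ltW.
  have : S <= S - e.
    apply: csup_le => [|_ [D _ <-]]; last exact: lt.
    by rewrite (le_trans _ (lt fset0%fset))// partial_sum_norm_ge0.
  by rewrite lerBrDr gerDl => /(lt_le_trans e0); rewrite ltxx.
exists D0 => D D0D; have := pS (D0 `|` D)%fset.
rewrite /p partial_sum_fsetU// => h.
have := le_trans (lerD D0P (lexx (p D))) h.
by rewrite addrAC -addrA gerDl subr_le0.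
Qed.

(** The index set is arbitrary. Increasing finite sets whose tails are at most 2^-k replace the net
    by a fast Cauchy sequence, and its limit is also that of the net. *)
Lemma abs_summable_has_sum (V : normedZmodType C) (x : I -> V) (M : C) :
  fast_complete V -> (forall D, partial_sum (fun i => `|x i|) D <= M) ->
  exists l, has_sum x l.
Proof.
move=> FC xM; have tail := abs_summable_tail xM.
have /choice[d dP] : forall k, exists D0 : {fset I}, forall D, [disjoint D0 & D]%fset ->
    partial_sum (fun i => `|x i|) D <= pow2 _ k by move=> k; apply: tail; exact: pow2_gt0.
pose D := fix D k := if k is k'.+1 then (D k' `|` d k)%fset else d 0%N.
have dD k : (d k `<=` D k)%fset by case: k => //= k; exact: fsubsetUr.
have near k (B : {fset I}) : (D k `<=` B)%fset -> `|partial_sum x B - partial_sum x (D k)| <= pow2 _ k.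
  move=> DB; rewrite (partial_sumD _ DB) addrAC subrr add0r.
  apply: (le_trans (norm_partial_sum _ _)); apply: dP.
  apply/fdisjointP => i /(fsubsetP (dD k)) iD; by rewrite in_fsetD iD.
have [k|l lP] := FC (fun k => partial_sum x (D k)).
  by apply: near => /=; exact: fsubsetUl.
exists l => e e0; have e2 := divr_gt0 e0 (ltr0n C 2).
have [N1 N1P] := lP _ e2; have [N2 N2P] := pow2_small e2.
exists (D (maxn N1 N2)) => B DB; rewrite -(subrKA (partial_sum x (D (maxn N1 N2)))).
rewrite (le_trans (ler_normD _ _))// [e]splitr lerD//; last by rewrite N1P// leq_maxl.
rewrite (le_trans (near _ _ DB))// (le_trans _ (ltW N2P))//.
by rewrite /pow2 lef_pV2 ?posrE ?exprn_gt0// ler_weXn2l ?ler1n// leq_maxr.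
Qed.

Lemma has_sum_approx (V : normedZmodType C) (x y : I -> V) (l m : V) e :
  has_sum x l -> has_sum y m -> 0 < e ->
  exists D, `|partial_sum x D - l| <= e /\ `|partial_sum y D - m| <= e.
Proof.
move=> xl ym e0; have [A AP] := xl _ e0; have [B BP] := ym _ e0.
by exists (A `|` B)%fset; split; [apply: AP|apply: BP]; rewrite ?fsubsetUl ?fsubsetUr.
Qed.

Lemma le_eps (x y : C) : x \is Num.real -> y \is Num.real ->
  (forall e, 0 < e -> x <= y + e) -> x <= y.
Proof.
move=> xr yr xy; rewrite real_leNgt//; apply/negP => yx.
have d0 : 0 < (x - y) / 2 by rewrite divr_gt0// subr_gt0.
have := xy _ d0; rewrite -lerBlDl [leLHS]splitr gerDr.
by move/(lt_le_trans d0); rewrite ltxx.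
Qed.

Lemma has_sum_unique (V : normedZmodType C) (x : I -> V) (l m : V) :
  has_sum x l -> has_sum x m -> l = m.
Proof.
move=> xl xm; apply/eqP; rewrite -subr_eq0 -normr_le0; apply: le_eps => // e e0.
have [D [Dl Dm]] := has_sum_approx xl xm (divr_gt0 e0 (ltr0n C 2)).
rewrite add0r -(subrKA (partial_sum x D)) (le_trans (ler_normD _ _))// [e]splitr lerD//.
by rewrite distrC.
Qed.

Lemma partial_sum_linear (K : pzRingType) (V : lmodType K) (x y : I -> V) a D :
  partial_sum (fun i => a *: x i + y i) D = a *: partial_sum x D + partial_sum y D.
Proof. by rewrite /partial_sum scaler_sumr -big_split. Qed.

(** The divisor c + 1 instead of c covers c = 0; errors of the form e / (c + 1) are absorbed this
    way throughout. *)
Lemma mul_div_succ_le (c e : C) : 0 <= c -> 0 <= e -> c * (e / (c + 1)) <= e.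
Proof.
move=> c0 e0; have c1 : 0 < c + 1 by rewrite ltr_wpDl.
by rewrite mulrCA ler_piMr// ler_pdivrMr// mul1r lerDl.
Qed.

Lemma has_sum_linear (V : normedModType C) (x y : I -> V) (l m : V) a :
  has_sum x l -> has_sum y m -> has_sum (fun i => a *: x i + y i) (a *: l + m).
Proof.
move=> xl ym e e0; have e2 := divr_gt0 e0 (ltr0n C 2).
have a0 : 0 < `|a| + 1 by rewrite ltr_wpDl.
have [A AP] := xl _ (divr_gt0 e2 a0); have [B BP] := ym _ e2.
exists (A `|` B)%fset => D; rewrite fsubUset => /andP[AD BD].
rewrite partial_sum_linear opprD addrACA -scalerBr (le_trans (ler_normD _ _))//.
rewrite [e]splitr lerD ?BP// normrZ.
rewrite (le_trans (ler_wpM2l (normr_ge0 a) (AP _ AD)))//.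
by rewrite mul_div_succ_le// ltW.
Qed.

Lemma has_sum_single (V : normedZmodType C) (x : I -> V) i :
  (forall j, j != i -> x j = 0) -> has_sum x (x i).
Proof.
move=> xi e e0; exists [fset i]%fset => D; rewrite fsub1set => iD.
rewrite partial_sumE (big_fsetD1 i)//= big1_seq ?addr0 ?subrr ?normr0 ?ltW// => j /=.
by rewrite in_fsetD1 => /andP[ji _]; apply: xi.
Qed.

Lemma has_sum_bounded (V W : normedZmodType C) (f : V -> W) (c : C) (x : I -> V) l :
  0 <= c -> (forall v w, f (v - w) = f v - f w) -> (forall v, `|f v| <= c * `|v|) ->
  has_sum x l -> has_sum (f \o x) (f l).
Proof.
move=> c0 fB fc xl e e0; have c1 : 0 < c + 1 by rewrite ltr_wpDl.
have [A AP] := xl _ (divr_gt0 e0 c1); exists A => D AD.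
have f0 : f 0 = 0 by rewrite -(subrr 0) fB subrr.
have fD v w : f (v + w) = f v + f w.
  by rewrite -{1}[w]opprK fB -[- w]sub0r fB f0 sub0r opprK.
have -> : partial_sum (f \o x) D = f (partial_sum x D).
  by rewrite /partial_sum (big_morph f fD f0).
rewrite -fB (le_trans (fc _))// (le_trans (ler_wpM2l c0 (AP _ AD)))//.
by rewrite mul_div_succ_le// ltW.
Qed.

Lemma has_sum_sum (x : I -> C) (l : C) :
  has_sum x l -> sum (fun i => x i : C^o) = l :> C.
Proof.
move=> xl; have FF : ProperFilter (@totally I) := totally_filter.
apply: (@cvg_lim C^o); first exact: norm_hausdorff.
apply/cvgrPdist_le => e e0; have [D DP] := xl _ e0.
by exists D => // B /= DB; rewrite distrC; apply: DP.
Qed.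

End HasSum.

(** * Matrix norms in both settings *)

Section EntryNorm.
Variable R : realType.
Local Notation C := R[i].

Definition entnorm (V : normedZmodType C) n (x : 'M[V]_n) : C :=
  csup [set z | exists i j, z = `|x i j|].

Lemma entnorm_ub (V : normedZmodType C) n (x : 'M[V]_n) i j : `|x i j| <= entnorm x.
Proof.
apply: (@csup_ub _ _ (\sum_i \sum_j `|x i j|)); last by exists i, j.
move=> _ [k [l ->]]; rewrite normr_ge0/= (bigD1 k)//= (bigD1 l)//= -addrA lerDl.
by rewrite addr_ge0 ?sumr_ge0// => *; rewrite sumr_ge0.
Qed.

Lemma entnorm_le (V : normedZmodType C) n (x : 'M[V]_n) (c : C) : 0 <= c ->
  entnorm x <= c <-> forall i j, `|x i j| <= c.
Proof.
move=> c0; split=> [xc i j|xc]; first exact: le_trans (entnorm_ub _ _ _) xc.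
by apply: csup_le => // _ [i [j ->]].
Qed.

Lemma entnorm_ge0 (V : normedZmodType C) n (x : 'M[V]_n) : 0 <= entnorm x.
Proof. by apply: csup_ge0 => _ [i [j ->]]. Qed.

Lemma entnorm11 (V : normedZmodType C) (x : 'M[V]_1) : entnorm x = `|x 0 0|.
Proof.
apply/eqP; rewrite eq_le entnorm_ub andbT; apply/entnorm_le => // i j.
by rewrite !ord1.
Qed.

Lemma entnormD (V : normedZmodType C) n (x y : 'M[V]_n) :
  entnorm (x + y) <= entnorm x + entnorm y.
Proof.
apply/entnorm_le => [|i j]; first by rewrite addr_ge0 ?entnorm_ge0.
by rewrite mxE (le_trans (ler_normD _ _))// lerD ?entnorm_ub.
Qed.

Lemma entnorm_scale (V : normedZmodType C) n (x y : 'M[V]_n) (c : C) :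
  (forall i j, `|y i j| = `|c| * `|x i j|) -> entnorm y = `|c| * entnorm x.
Proof.
move=> yx; have le : entnorm y <= `|c| * entnorm x.
  apply/entnorm_le => [|i j]; first by rewrite mulr_ge0 ?entnorm_ge0.
  by rewrite yx ler_wpM2l ?entnorm_ub.
have [c0|c0] := eqVneq c 0.
  by apply/eqP; rewrite eq_le le c0 normr0 mul0r entnorm_ge0.
have c_gt0 : 0 < `|c| by rewrite normr_gt0.
apply/eqP; rewrite eq_le le/= mulrC -ler_pdivlMr//.
apply/entnorm_le => [|i j]; first by rewrite divr_ge0 ?entnorm_ge0.
by rewrite ler_pdivlMr// mulrC -yx entnorm_ub.
Qed.

End EntryNorm.

Section ScalarNorm.
Variables (R : realType) (s : setting).
Local Notation C := R[i].

Definition snorm n (a : 'M[C]_n) : C :=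
  match s with Banach => entnorm a | Operator => opnorm a end.

Lemma snorm_ge0 n (a : 'M[C]_n) : 0 <= snorm a.
Proof. by rewrite /snorm; case: s; [exact: entnorm_ge0|exact: opnorm_ge0]. Qed.

Lemma snormD n (a b : 'M[C]_n) : snorm (a + b) <= snorm a + snorm b.
Proof. by rewrite /snorm; case: s; [exact: entnormD|exact: opnormD]. Qed.

Lemma snormZ n (c : C) (a : 'M[C]_n) : snorm (c *: a) = `|c| * snorm a.
Proof.
rewrite /snorm; case: s; last exact: opnormZ.
by apply: entnorm_scale => i j; rewrite mxE normrM.
Qed.

Lemma snorm11 (a : 'M[C]_1) : snorm a = `|a 0 0|.
Proof. by rewrite /snorm; case: s; [exact: entnorm11|exact: opnorm11]. Qed.

Lemma snorm_entry n (a : 'M[C]_n) i j : `|a i j| <= snorm a.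
Proof. by rewrite /snorm; case: s; [exact: entnorm_ub|exact: opnorm_entry]. Qed.

Lemma snorm_map_inj m n (a : 'M[C]_m) (b : 'M[C]_n) f :
  injective f -> (forall i j, b i j = a (f i) (f j)) -> snorm b <= snorm a.
Proof.
move=> f_inj ba; rewrite /snorm; case: s; last exact: (opnorm_map_inj f_inj f_inj).
by apply/entnorm_le => [|i j]; rewrite ?entnorm_ge0// ba entnorm_ub.
Qed.

Lemma snorm0 n : snorm (0 : 'M[C]_n) = 0.
Proof. by rewrite -(scale0r 0) snormZ normr0 mul0r. Qed.

Lemma snorm_sum n I (r : seq I) (P : pred I) (F : I -> 'M[C]_n) :
  snorm (\sum_(i <- r | P i) F i) <= \sum_(i <- r | P i) snorm (F i).
Proof.
elim/big_ind2: _ => [|x a y b xa yb|//]; first by rewrite snorm0.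
by apply: (le_trans (snormD _ _)); rewrite lerD.
Qed.

End ScalarNorm.

Lemma amplifyE (X Y Z : Type) (m : X -> Y -> Z) r t (x : 'M[X]_r) (y : 'M[Y]_t) i j k l :
  amplify m x y (mxtens_index (i, k)) (mxtens_index (j, l)) = m (x i j) (y k l).
Proof. by rewrite mxE !mxtens_indexK. Qed.

(* In the [Banach] setting every statement about matrices reduces to one about
   entries when M_n is given the maximum of the norms of the entries, which
   makes the two settings uniform. *)
Section MatrixNorm.
Variables (R : realType) (s : setting).
Local Notation C := R[i].
Implicit Types X Y Z : space R s.

Definition mnorm X n (x : 'M[X]_n) : C :=
  match s with Banach => entnorm x | Operator => mxnorm x end.

Lemma mnormD X n (x y : 'M[X]_n) : mnorm (x + y) <= mnorm x + mnorm y.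
Proof.
rewrite /mnorm; case: s X x y => X x y; first exact: entnormD.
by have [+ _ _ _ _ _] := @mxnormP R Operator X erefl; apply.
Qed.

Lemma mnormZ X n (c : C) (x : 'M[X]_n) : mnorm (map_mx ( *:%R c) x) = `|c| * mnorm x.
Proof.
rewrite /mnorm; case: s X x => X x.
  by apply: entnorm_scale => i j; rewrite mxE normrZ.
by have [_ + _ _ _ _] := @mxnormP R Operator X erefl; apply.
Qed.

Lemma mnorm11 X (x : 'M[X]_1) : mnorm x = `|x 0 0|.
Proof.
rewrite /mnorm; case: s X x => X x; first exact: entnorm11.
by have [_ _ _ + _ _] := @mxnormP R Operator X erefl; apply.
Qed.

Lemma mnorm0 X n : mnorm (0 : 'M[X]_n) = 0.
Proof.
have := mnormZ 0 (0 : 'M[X]_n); rewrite normr0 mul0r => <-; congr mnorm.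
by apply/matrixP => i j; rewrite !mxE scale0r.
Qed.

Lemma mnorm_ge0 X n (x : 'M[X]_n) : 0 <= mnorm x.
Proof.
have := mnormD x (map_mx ( *:%R (-1)) x); rewrite mnormZ normrN1 mul1r.
rewrite (_ : x + _ = 0) ?mnorm0; last first.
  by apply/matrixP => i j; rewrite !mxE scaleN1r subrr.
by rewrite -mulr2n pmulrn_lge0.
Qed.

Lemma mnorm_entry X n (x : 'M[X]_n) i j : `|x i j| <= mnorm x.
Proof.
have := mnorm_ge0 x; rewrite /mnorm; case: s X x => X x x0; first exact: entnorm_ub.
have [_ _ _ l1 _ bm] := @mxnormP R Operator X erefl.
(* The entry is the 1 by 1 compression of [x] by a coordinate row and a coordinate column, both of
   norm at most 1. *)
have := bm _ _ (delta_mx 0 i : 'M[C]_(1, n)) x (delta_mx j 0 : 'M[C]_(n, 1)).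
rewrite l1 mxE (bigD1 i)//= [X in _ + X]big1 ?addr0; last first.
  move=> k /negPf ki; rewrite big1// => l _.
  by rewrite !mxE ki andbF mul0r scale0r.
rewrite (bigD1 j)//= [X in _ + X]big1 ?addr0; last first.
  by move=> k /negPf kj; rewrite !mxE kj mulr0 scale0r.
rewrite !mxE !eqxx mulr1 scale1r => /le_trans; apply.
by rewrite -[leRHS]mulr1 ler_pM ?mulr_ge0 ?opnorm_ge0// ?opnorm_delta// ler_piMl ?opnorm_delta.
Qed.

Lemma mnorm_eq0 X n (x : 'M[X]_n) : mnorm x = 0 -> x = 0.
Proof.
move=> x0; apply/matrixP => i j; rewrite mxE; apply/eqP; rewrite -normr_le0 -x0.
exact: mnorm_entry.
Qed.

Lemma contractiveP X Y (f : X -> Y) :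
  contractive f <-> forall n (x : 'M[X]_n), mnorm (map_mx f x) <= mnorm x.
Proof.
rewrite /contractive /mnorm; case: s X Y f => X Y f //; split=> [fc n x|fc x].
  apply/entnorm_le => [|i j]; first exact: entnorm_ge0.
  by rewrite mxE (le_trans (fc _))// entnorm_ub.
by have := fc _ (\matrix_(_ < 1, _ < 1) x); rewrite !entnorm11 !mxE.
Qed.

Lemma isometricP X Y (f : X -> Y) :
  isometric f <-> forall n (x : 'M[X]_n), mnorm (map_mx f x) = mnorm x.
Proof.
rewrite /isometric /mnorm; case: s X Y f => X Y f //; split=> [fc n x|fc x].
  apply/eqP; rewrite eq_le; apply/andP; split; apply/entnorm_le => [|i j];
    rewrite ?entnorm_ge0//; have := entnorm_ub (map_mx f x) i j;
    have := entnorm_ub x i j; rewrite !mxE fc => //.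
by have := fc _ (\matrix_(_ < 1, _ < 1) x); rewrite !entnorm11 !mxE.
Qed.

Lemma contractive2P X Y Z (m : X -> Y -> Z) :
  contractive2 m <->
  forall r t (x : 'M[X]_r) (y : 'M[Y]_t), mnorm (amplify m x y) <= mnorm x * mnorm y.
Proof.
rewrite /contractive2 /mnorm; case: s X Y Z m => X Y Z m //; split=> [mc r t x y|mc x y].
  apply/entnorm_le => [|p q]; first by rewrite mulr_ge0 ?entnorm_ge0.
  by rewrite mxE (le_trans (mc _ _))// ler_pM// entnorm_ub.
have := mc _ _ (\matrix_(_ < 1, _ < 1) x) (\matrix_(_ < 1, _ < 1) y).
by rewrite !entnorm11 !mxE.
Qed.

Lemma is_dual_normP X Y (b : X -> Y -> C) :
  (match s with
  | Banach => forall (y : Y) (c : C), 0 <= c ->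
      `|y| <= c <-> forall x, `|b x y| <= c * `|x|
  | Operator => forall n (y : 'M[Y]_n) (c : C), 0 <= c ->
      mxnorm y <= c <-> forall m (x : 'M[X]_m), opnorm (amplify b x y) <= c * mxnorm x
  end) <->
  forall n (y : 'M[Y]_n) (c : C), 0 <= c ->
    mnorm y <= c <-> forall m (x : 'M[X]_m), snorm s (amplify b x y) <= c * mnorm x.
Proof.
rewrite /mnorm /snorm; case: s X Y b => X Y b //; split=> [bP n y c c0|bP y c c0].
  split=> [yc m x|yb].
    apply/entnorm_le => [|p q]; first by rewrite mulr_ge0 ?entnorm_ge0.
    set i := (mxtens_unindex p).2; set j := (mxtens_unindex q).2.
    rewrite mxE (le_trans ((bP (y i j) c c0).1 _ _)) ?ler_wpM2l ?entnorm_ub//.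
    exact: le_trans (entnorm_ub _ _ _) yc.
  apply/entnorm_le => // i j; apply/bP => // x.
  have := yb _ (\matrix_(_ < 1, _ < 1) x); rewrite entnorm11 mxE; apply: le_trans.
  have := entnorm_ub (amplify b (\matrix_(_ < 1, _ < 1) x) y)
    (mxtens_index (0, i)) (mxtens_index (0, j)).
  by rewrite amplifyE mxE.
have := bP _ (\matrix_(_ < 1, _ < 1) y) c c0; rewrite entnorm11 mxE => ->.
split=> [yc x|yc m x].
  have := yc _ (\matrix_(_ < 1, _ < 1) x); rewrite entnorm11 mxE; apply: le_trans.
  have := entnorm_ub (amplify b (\matrix_(_ < 1, _ < 1) x) (\matrix_(_ < 1, _ < 1) y))
    (mxtens_index (0, 0)) (mxtens_index (0, 0)).
  by rewrite amplifyE !mxE.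
apply/entnorm_le => [|p q]; first by rewrite mulr_ge0 ?entnorm_ge0.
by rewrite !mxE (le_trans (yc _))// ler_wpM2l// entnorm_ub.
Qed.

End MatrixNorm.

(** * Matrix bounds for scalar functionals and pairings *)

Section Smith.
Variables (R : realType) (s : setting).
Local Notation C := R[i].

Lemma snorm_delta n (i j : 'I_n) : snorm s (delta_mx i j : 'M[C]_n) <= 1.
Proof.
rewrite /snorm; case: s; last exact: opnorm_delta.
apply/entnorm_le => // k l; rewrite mxE; case: andP => _; rewrite ?normr1 ?normr0 ?ler01//.
Qed.

Lemma snorm_le_entries n (a : 'M[C]_n) : snorm s a <= \sum_i \sum_j `|a i j|.
Proof.
rewrite {1}[a]matrix_sum_delta (le_trans (snorm_sum _ _ _ _))//.
apply: ler_sum => i _; rewrite (le_trans (snorm_sum _ _ _ _))//.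
by apply: ler_sum => j _; rewrite snormZ ler_piMr ?snorm_delta.
Qed.

(** Expansion along the matrix units of [x]. The bound is crude, and serves to make the supremum in
    [fnorm] finite. *)
Lemma snorm_amplify_le (E F : Type) (ev : E -> F -> C) m n (y : 'M[E]_m) (x : 'M[F]_n) :
  snorm s (amplify ev y x) <= \sum_i \sum_j snorm s (map_mx (ev^~ (x i j)) y).
Proof.
have -> : amplify ev y x =
    \sum_i \sum_j tensmx (map_mx (ev^~ (x i j)) y) (delta_mx i j).
  apply/matrixP => p q; case: (mxtens_indexP p) => k i; case: (mxtens_indexP q) => l j.
  rewrite amplifyE summxE (bigD1 i)//= [X in _ + X]big1 ?addr0; last first.
    move=> i' /negPf i'i; rewrite summxE big1// => j' _.
    by rewrite tensmxE [in X in _ * X]mxE eq_sym i'i mulr0.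
  rewrite summxE (bigD1 j)//= [X in _ + X]big1 ?addr0; last first.
    by move=> j' /negPf j'j; rewrite tensmxE [in X in _ * X]mxE (eq_sym j) j'j andbF mulr0.
  by rewrite tensmxE !mxE !eqxx mulr1.
rewrite (le_trans (snorm_sum _ _ _ _))//; apply: ler_sum => i _.
rewrite (le_trans (snorm_sum _ _ _ _))//; apply: ler_sum => j _.
rewrite /snorm; case: s.
  apply/entnorm_le => [|p q]; first exact: entnorm_ge0.
  case: (mxtens_indexP p) => k i'; case: (mxtens_indexP q) => l j'.
  rewrite tensmxE normrM [X in _ * `|X|]mxE.
  case: andP => _; rewrite ?normr1 ?normr0 ?mulr1 ?mulr0 ?entnorm_ge0//.
  exact: entnorm_ub.
rewrite (le_trans (opnorm_tensmx _ _))// ler_piMr ?opnorm_ge0//.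
exact: opnorm_delta.
Qed.

(* A bounded functional is completely bounded with the same norm: if u = f(y) v
   then |u|^2 = u* f(y) v = f(u* y v). *)
Lemma functional_matrix_bound (Y : space R s) (f : Y -> C) (M : C) :
  scalar f -> 0 <= M -> (forall y, `|f y| <= M * `|y|) ->
  forall n (y : 'M[Y]_n), snorm s (map_mx f y) <= M * mnorm y.
Proof.
move=> fL M0 fM n y; have [f0 fD fZ] := scalarE fL.
move: (mnorm_ge0 y) fL f0 fD fZ fM; rewrite /snorm /mnorm; case: s Y f y => Y f y y0 fL f0 fD fZ fM.
  apply/entnorm_le => [|i j]; first by rewrite mulr_ge0.
  by rewrite mxE (le_trans (fM _))// ler_wpM2l// entnorm_ub.
apply: opnorm_le => [|v]; first by rewrite mulr_ge0.
set a := map_mx f y; set u := a *m v.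
have [u0|u0] := eqVneq (l2norm u) 0.
  by rewrite u0 !mulr_ge0// l2norm_ge0.
have u_gt0 : 0 < l2norm u by rewrite lt_def u0 l2norm_ge0.
pose w : 'rV[C]_n := \row_i (u i 0)^*%R.
have [_ _ _ l1 _ bm] := @mxnormP R Operator Y erefl.
have colE : opnorm v <= l2norm v.
  apply: opnorm_le => [|t]; first exact: l2norm_ge0.
  have -> : v *m t = t 0 0 *: v.
    by apply/matrixP => i j; rewrite !mxE big_ord1 (ord1 j) mulrC.
  by rewrite l2normZ mulrC /l2norm big_ord1 sqrCK.
have rowE : opnorm w <= l2norm u.
  apply: opnorm_le => [|t]; first exact: l2norm_ge0.
  rewrite {1}/l2norm big_ord1 sqrCK// mxE (le_trans (ler_norm_sum _ _ _))//.
  apply: le_trans (l2norm_cauchy u t).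
  by apply: ler_sum => i _; rewrite mxE normrM norm_conjC.
have fsum I (r : seq I) (F : I -> Y) : f (\sum_(i <- r) F i) = \sum_(i <- r) f (F i).
  exact: (big_morph f fD f0).
have uu : l2norm u ^+ 2 = f (mxbimodule w y v 0 0).
  rewrite l2normE mxE fsum; apply: eq_bigr => k _; rewrite fsum.
  rewrite normCK {1}mxE mulr_suml; apply: eq_bigr => l _.
  by rewrite fZ !mxE; ring.
have : l2norm u ^+ 2 <= M * (l2norm u * mxnorm y * l2norm v).
  have -> : l2norm u ^+ 2 = `|l2norm u ^+ 2| by rewrite ger0_norm// exprn_ge0// l2norm_ge0.
  rewrite uu (le_trans (fM _))// ler_wpM2l// -l1 (le_trans (bm _ _ _ _ _))//.
  by rewrite !ler_pM ?mulr_ge0 ?opnorm_ge0.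
rewrite (_ : M * _ = l2norm u * (M * mxnorm y * l2norm v)); last by ring.
by rewrite expr2 ler_pM2l.
Qed.

End Smith.

(** * Spaces of functions *)

(* A space of functions on E, with the matrix norms obtained by testing against
   the matrices over E in a given family of balls. *)
Record fundata (R : realType) (s : setting) := FunData {
  fd_dom : Type;
  fd_ball : forall n, set 'M[fd_dom]_n;
  fd_set : set (fd_dom -> R[i]);
  fd_subspace : subspace fd_set;
  fd_bounded : forall f, fd_set f -> exists2 M, 0 <= M &
    forall n (y : 'M[fd_dom]_n), fd_ball y -> snorm s (map_mx f y) <= M;
  fd_separated : forall f, fd_set f ->
    (forall n (y : 'M[fd_dom]_n) i j, fd_ball y -> f (y i j) = 0) -> f = 0 }.

Definition funsp (R : realType) (s : setting) (D : fundata R s) :=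
  {f : fd_dom D -> R[i] | fd_set f}.

Section FunSpace.
Variables (R : realType) (s : setting) (D : fundata R s).
Local Notation C := R[i].
Local Notation E := (fd_dom D).
Local Notation T := (funsp D).

Lemma funsp_inj (f g : T) : sval f = sval g -> f = g.
Proof. by case: f g => [f Pf] [g Pg] /= fg; subst g; congr exist; exact: Prop_irrelevance. Qed.

Lemma funspP (f g : T) : (forall e, sval f e = sval g e) -> f = g.
Proof. by move=> fg; apply: funsp_inj; apply/funext. Qed.

Definition funsp0 : T := exist _ 0 (fd_subspace D).1.

Definition funspZD (a : C) (f g : T) : T :=
  exist _ (a *: sval f + sval g) ((fd_subspace D).2 _ _ _ (svalP f) (svalP g)).

Definition funspD (f g : T) := funspZD 1 f g.
Definition funspZ a (f : T) := funspZD a f funsp0.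
Definition funspN (f : T) := funspZ (-1) f.

Lemma funspDA : associative funspD.
Proof. by move=> f g h; apply: funsp_inj; rewrite /= !scale1r addrA. Qed.
Lemma funspDC : commutative funspD.
Proof. by move=> f g; apply: funsp_inj; rewrite /= !scale1r addrC. Qed.
Lemma funsp0D : left_id funsp0 funspD.
Proof. by move=> f; apply: funsp_inj; rewrite /= !scale1r add0r. Qed.
Lemma funspND : left_inverse funsp0 funspN funspD.
Proof. by move=> f; apply: funsp_inj; rewrite /= !scale1r scaleN1r addr0 addNr. Qed.

HB.instance Definition _ := gen_eqMixin T.
HB.instance Definition _ := gen_choiceMixin T.
HB.instance Definition _ := GRing.isZmodule.Build T funspDA funspDC funsp0D funspND.

Lemma funspZA a b (f : T) : funspZ a (funspZ b f) = funspZ (a * b) f.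
Proof. by apply: funsp_inj; rewrite /= !addr0 scalerA. Qed.
Lemma funspZ1 : left_id 1 funspZ.
Proof. by move=> f; apply: funsp_inj; rewrite /= addr0 scale1r. Qed.
Lemma funspZDr : right_distributive funspZ +%R.
Proof. by move=> a f g; apply: funsp_inj; rewrite /= !scale1r !addr0 scalerDr. Qed.
Lemma funspZDl (f : T) : {morph funspZ^~ f : a b / a + b}.
Proof. by move=> a b; apply: funsp_inj; rewrite /= !scale1r !addr0 scalerDl. Qed.

HB.instance Definition _ := GRing.Zmodule_isLmodule.Build C T funspZA funspZ1 funspZDr funspZDl.

Lemma sval_funspD (f g : T) e : sval (f + g) e = sval f e + sval g e.
Proof. by rewrite /= -[in RHS](scale1r (sval f)). Qed.
Lemma sval_funspZ a (f : T) e : sval (a *: f) e = a * sval f e.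
Proof. by rewrite /= -[RHS]addr0. Qed.
Lemma sval_funsp0 e : sval (0 : T) e = 0.
Proof. by []. Qed.
Lemma sval_funspN (f : T) e : sval (- f) e = - sval f e.
Proof. by rewrite -scaleN1r sval_funspZ mulN1r. Qed.
Lemma sval_funspB (f g : T) e : sval (f - g) e = sval f e - sval g e.
Proof. by rewrite sval_funspD sval_funspN. Qed.
Lemma sval_funsp_sum (J : Type) (r : seq J) (P : pred J) (F : J -> T) e :
  sval (\sum_(j <- r | P j) F j) e = \sum_(j <- r | P j) sval (F j) e.
Proof.
apply: (big_morph (fun f : T => sval f e)) => [f g|]; last exact: sval_funsp0.
exact: sval_funspD.
Qed.

Definition funev (e : E) (f : T) : C := sval f e.

Definition fnorm n (x : 'M[T]_n) : C :=
  csup [set z | exists m (y : 'M[E]_m), fd_ball y /\ z = snorm s (amplify funev y x)].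

Lemma fnorm_ub m n (y : 'M[E]_m) (x : 'M[T]_n) :
  fd_ball y -> snorm s (amplify funev y x) <= fnorm x.
Proof.
move=> yB; have bnd := fun i j => fd_bounded (svalP (x i j)).
have /choice[M0 M0P] : forall i : 'I_n, exists M : 'I_n -> C, forall j,
    0 <= M j /\ forall m (y : 'M[E]_m), fd_ball y -> snorm s (map_mx (sval (x i j)) y) <= M j.
  move=> i; have [|M MP] := @choice _ _ (fun j M => 0 <= M /\ forall m (y : 'M[E]_m),
    fd_ball y -> snorm s (map_mx (sval (x i j)) y) <= M); last by exists M.
  by move=> j; have [M M0 MP] := bnd i j; exists M.
apply: (@csup_ub _ _ (\sum_i \sum_j M0 i j)); last by exists m, y.
move=> _ [k [z [zB ->]]]; rewrite snorm_ge0/= (le_trans (snorm_amplify_le _ _ _ _))//.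
by apply: ler_sum => i _; apply: ler_sum => j _; have [_] := M0P i j; apply.
Qed.

Lemma fnorm_le n (x : 'M[T]_n) (c : C) : 0 <= c ->
  fnorm x <= c <-> forall m (y : 'M[E]_m), fd_ball y -> snorm s (amplify funev y x) <= c.
Proof.
move=> c0; split=> [xc m y yB|xc]; first exact: le_trans (fnorm_ub _ yB) xc.
by apply: csup_le => // _ [m [y [yB ->]]]; apply: xc.
Qed.

Lemma fnorm_ge0 n (x : 'M[T]_n) : 0 <= fnorm x.
Proof. by apply: csup_ge0 => _ [m [y [_ ->]]]; exact: snorm_ge0. Qed.

Lemma fnormD n (x y : 'M[T]_n) : fnorm (x + y) <= fnorm x + fnorm y.
Proof.
apply/fnorm_le => [|m z zB]; first by rewrite addr_ge0 ?fnorm_ge0.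
have -> : amplify funev z (x + y) = amplify funev z x + amplify funev z y.
  by apply/matrixP => p q; rewrite !mxE /funev sval_funspD.
by rewrite (le_trans (snormD _ _ _))// lerD// fnorm_ub.
Qed.

Lemma fnormZ n (c : C) (x : 'M[T]_n) : fnorm (map_mx ( *:%R c) x) = `|c| * fnorm x.
Proof.
have ampZ m (z : 'M[E]_m) a (w : 'M[T]_n) :
    amplify funev z (map_mx ( *:%R a) w) = a *: amplify funev z w.
  by apply/matrixP => p q; rewrite !mxE /funev sval_funspZ.
have le a (w : 'M[T]_n) : fnorm (map_mx ( *:%R a) w) <= `|a| * fnorm w.
  apply/fnorm_le => [|m z zB]; first by rewrite mulr_ge0 ?fnorm_ge0.
  by rewrite ampZ snormZ ler_wpM2l// fnorm_ub.
have [c0|c0] := eqVneq c 0.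
  by apply/eqP; rewrite eq_le le c0 normr0 mul0r fnorm_ge0.
apply/eqP; rewrite eq_le le/=.
have := le c^-1 (map_mx ( *:%R c) x).
have -> : map_mx ( *:%R c^-1) (map_mx ( *:%R c) x) = x.
  by apply/matrixP => i j; rewrite !mxE scalerA mulVf// scale1r.
move=> h; apply: (le_trans (ler_wpM2l (normr_ge0 c) h)).
by rewrite mulrA -normrM mulfV// normr1 mul1r.
Qed.

Lemma fnorm_definite n (x : 'M[T]_n) : fnorm x = 0 -> x = 0.
Proof.
move=> x0; apply/matrixP => i j; rewrite mxE; apply: funsp_inj.
apply: (fd_separated (svalP _)) => m y k l yB; apply/eqP; rewrite -normr_le0 -x0.
apply: le_trans (fnorm_ub x yB).
have := snorm_entry s (amplify funev y x) (mxtens_index (k, i)) (mxtens_index (l, j)).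
by rewrite amplifyE.
Qed.

Definition fnorm1 (f : T) : C := fnorm (\matrix_(_ < 1, _ < 1) f).

Lemma fnorm1_le (f : T) (c : C) : 0 <= c ->
  fnorm1 f <= c <-> forall m (y : 'M[E]_m), fd_ball y -> snorm s (map_mx (sval f) y) <= c.
Proof.
move=> c0.
have amp1 m (y : 'M[E]_m) : snorm s (amplify funev y (\matrix_(_ < 1, _ < 1) f)) =
    snorm s (map_mx (sval f) y).
  apply/eqP; rewrite eq_le; apply/andP; split.
    apply: (@snorm_map_inj _ _ _ _ _ _ (fun p => (mxtens_unindex p).1)) => [p q|p q].
      case: (mxtens_indexP p) => i i'; case: (mxtens_indexP q) => j j'.
      by rewrite !mxtens_indexK/= => ->; rewrite (ord1 i') (ord1 j').
    by rewrite !mxE.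
  apply: (@snorm_map_inj _ _ _ _ _ _ (fun i => mxtens_index (i, 0))) => [i j|i j].
    by move=> /(congr1 (@mxtens_unindex _ _)); rewrite !mxtens_indexK => -[].
  by rewrite amplifyE !mxE.
split=> [fc m y yB|fc]; first by rewrite -amp1; apply: le_trans (fnorm_ub _ yB) fc.
by apply/fnorm_le => // m y yB; rewrite amp1 fc.
Qed.

Lemma fnorm1D (f g : T) : fnorm1 (f + g) <= fnorm1 f + fnorm1 g.
Proof.
rewrite /fnorm1; apply: le_trans (fnormD _ _); rewrite le_eqVlt; apply/orP; left.
by apply/eqP; congr fnorm; apply/matrixP => i j; rewrite !mxE.
Qed.

Lemma fnorm1Z (c : C) (f : T) : fnorm1 (c *: f) = `|c| * fnorm1 f.
Proof. by rewrite /fnorm1 -fnormZ; congr fnorm; apply/matrixP => i j; rewrite !mxE. Qed.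

Lemma fnorm1_definite (f : T) : fnorm1 f = 0 -> f = 0.
Proof. by move=> /fnorm_definite/matrixP/(_ 0 0); rewrite !mxE. Qed.

HB.instance Definition _ :=
  @Lmodule_isNormed.Build C T fnorm1 fnorm1D fnorm1Z fnorm1_definite.

Lemma normr_funsp (f : T) : `|f| = fnorm1 f.
Proof. by []. Qed.

Lemma fnorm11 (x : 'M[T]_1) : fnorm x = `|x 0 0|.
Proof.
rewrite normr_funsp /fnorm1; congr fnorm; apply/matrixP => i j.
by rewrite mxE !ord1.
Qed.

Lemma opnorm_amplify_dsum k m n (z : 'M[E]_k) (x : 'M[T]_m) (y : 'M[T]_n) :
  opnorm (amplify funev z (block_mx x 0 0 y)) =
  Num.max (opnorm (amplify funev z x)) (opnorm (amplify funev z y)).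
Proof.
pose f (p : 'I_(k * m)) : 'I_(k * (m + n)) :=
  mxtens_index ((mxtens_unindex p).1, lshift n (mxtens_unindex p).2).
pose g (p : 'I_(k * n)) : 'I_(k * (m + n)) :=
  mxtens_index ((mxtens_unindex p).1, rshift m (mxtens_unindex p).2).
apply: (@opnorm_cover _ _ _ _ _ _ _ f g).
- move=> p q; case: (mxtens_indexP p) => i i'; case: (mxtens_indexP q) => j j'.
  rewrite /f !mxtens_indexK/= => /(congr1 (@mxtens_unindex _ _)).
  by rewrite !mxtens_indexK => -[-> /val_inj ->].
- move=> p q; case: (mxtens_indexP p) => i i'; case: (mxtens_indexP q) => j j'.
  rewrite /g !mxtens_indexK/= => /(congr1 (@mxtens_unindex _ _)).
  by rewrite !mxtens_indexK => -[-> /addnI/val_inj ->].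
- move=> p q; apply/eqP => /(congr1 (fun r => (mxtens_unindex r).2)).
  by rewrite /f /g !mxtens_indexK => /eqP; rewrite eq_lrshift.
- move=> p; case: (mxtens_indexP p) => i i'; case: (split_ordP i') => j ->.
    by left; exists (mxtens_index (i, j)); rewrite /f mxtens_indexK.
  by right; exists (mxtens_index (i, j)); rewrite /g mxtens_indexK.
- by move=> p q; rewrite /f amplifyE block_mxEul mxE.
- by move=> p q; rewrite /g amplifyE block_mxEdr mxE.
- by move=> p q; rewrite /f /g amplifyE block_mxEur mxE.
- by move=> p q; rewrite /f /g amplifyE block_mxEdl mxE.
Qed.

(** Scalar matrices act on an amplification through 1 ⊗ a and 1 ⊗ b, so Ruan's bimodule axiom is
    inherited from the submultiplicativity of [opnorm]. *)
Lemma amplify_bimodule k m n (z : 'M[E]_k) (a : 'M[C]_(m, n)) (x : 'M[T]_n) (b : 'M[C]_(n, m)) :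
  amplify funev z (mxbimodule a x b) =
  tensmx (1%:M : 'M[C]_k) a *m amplify funev z x *m tensmx (1%:M : 'M[C]_k) b.
Proof.
apply/matrixP => p q; case: (mxtens_indexP p) => i i'; case: (mxtens_indexP q) => j j'.
rewrite amplifyE /funev mxE sval_funsp_sum.
under eq_bigr do rewrite sval_funsp_sum.
under eq_bigr do under eq_bigr do rewrite sval_funspZ.
rewrite mxE big_mxtens (bigD1 j)// [X in _ = _ + X]big1 ?addr0; last first.
  move=> l /negPf lj; rewrite big1// => l' _.
  by rewrite tensmxE [in X in _ * X]mxE lj mul0r mulr0.
rewrite exchange_big/=; apply: eq_bigr => l _.
rewrite tensmxE [in X in _ = _ * (X * _)]mxE eqxx mul1r mxE big_mxtens mulr_suml.
rewrite (bigD1 i)//= [X in _ = _ + X]big1 ?addr0; last first.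
  move=> r /negPf ri; rewrite big1 ?mul0r// => r' _.
  by rewrite tensmxE [in X in X * _ * _]mxE eq_sym ri !mul0r.
rewrite mulr_suml; apply: eq_bigr => r _.
by rewrite tensmxE amplifyE [in X in _ = X * _ * _ * _]mxE eqxx mul1r /funev; ring.
Qed.

Lemma funsp_operator_space : s = Operator -> @operator_space R T fnorm.
Proof.
move=> sO; have snormE n (a : 'M[C]_n) : snorm s a = opnorm a by rewrite sO.
split.
- exact: fnormD.
- exact: fnormZ.
- exact: fnorm_definite.
- exact: fnorm11.
- move=> m n x y; have cmp (a b : C) : 0 <= a -> 0 <= b -> a >=< b.
    by move=> a0 b0; rewrite real_comparable ?ger0_real.
  have cN := cmp _ _ (fnorm_ge0 x) (fnorm_ge0 y).
  apply/eqP; rewrite eq_le; apply/andP; split.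
    apply/fnorm_le => [|k z zB]; first by rewrite comparable_le_max// fnorm_ge0.
    rewrite snormE opnorm_amplify_dsum comparable_ge_max ?cmp ?opnorm_ge0//.
    by rewrite !comparable_le_max// -!snormE !fnorm_ub// orbT.
  rewrite comparable_ge_max//; apply/andP; split; apply/fnorm_le; rewrite ?fnorm_ge0// => k z zB;
    apply: le_trans (fnorm_ub _ zB); rewrite !snormE opnorm_amplify_dsum;
    by rewrite comparable_le_max ?cmp ?opnorm_ge0// lexx ?orbT.
- move=> m n a x b; apply/fnorm_le => [|k z zB].
    by rewrite !mulr_ge0 ?opnorm_ge0 ?fnorm_ge0.
  rewrite snormE amplify_bimodule; apply: opnorm_mul3_le.
  - exact: opnorm_tens1mx.
  - by rewrite -snormE fnorm_ub.
  - exact: opnorm_tens1mx.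
Qed.

Section Complete.
Hypothesis T_complete : fast_complete T.

(** An alias indexed by the proof of completeness, so that the complete structure can be declared
    canonically although it depends on that proof. *)
Definition complete_funsp of fast_complete T : Type := T.
Local Notation U := (complete_funsp T_complete).

HB.instance Definition _ := NormedModule.on U.
Lemma complete_funsp_cvg (G : set_system U) : ProperFilter G -> cauchy G -> cvg G.
Proof. by move=> GF; apply: cauchy_cvg_fast; exact: T_complete. Qed.

HB.instance Definition _ := Uniform_isComplete.Build U complete_funsp_cvg.

Definition funspace : space R s :=
  @Space R s U fnorm funsp_operator_space.

End Complete.

End FunSpace.

(** * Duality *)

Section Duality.
Variables (R : realType) (s : setting) (X Y : space R s) (b : X -> Y -> R[i]).
Local Notation C := R[i].
Hypothesis bP : is_dual b.

Lemma dual_scalarl y : scalar (b^~ y).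
Proof. by have [bl _ _ _] := bP; exact: (bl y). Qed.

Lemma dual_scalarr x : scalar (b x).
Proof. by have [_ br _ _] := bP; exact: (br x). Qed.

Lemma dual_mnormP n (y : 'M[Y]_n) (c : C) : 0 <= c ->
  mnorm y <= c <-> forall m (x : 'M[X]_m), snorm s (amplify b x y) <= c * mnorm x.
Proof. by have [_ _ /is_dual_normP bn _] := bP; exact: bn. Qed.

Lemma dual_mnorm m n (x : 'M[X]_m) (y : 'M[Y]_n) :
  snorm s (amplify b x y) <= mnorm y * mnorm x.
Proof. by have := (dual_mnormP y (mnorm_ge0 y)).1 (lexx _) m x. Qed.

Lemma dual_norm x y : `|b x y| <= `|x| * `|y|.
Proof.
have := dual_mnorm (\matrix_(_ < 1, _ < 1) x) (\matrix_(_ < 1, _ < 1) y).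
rewrite !mnorm11 !mxE mulrC; apply: le_trans.
have := snorm_entry s (amplify b (\matrix_(_ < 1, _ < 1) x) (\matrix_(_ < 1, _ < 1) y))
  (mxtens_index (0, 0)) (mxtens_index (0, 0)).
by rewrite amplifyE !mxE.
Qed.

Lemma dual_inj y y' : (forall x, b x y = b x y') -> y = y'.
Proof.
move=> byy'; apply/eqP; rewrite -subr_eq0; apply/eqP.
have := @dual_mnormP 1 (\matrix_(_ < 1, _ < 1) (y - y')) 0 (lexx _).
rewrite mnorm11 mxE normr_le0 => -[_ h]; apply/eqP/h => m x.
rewrite mul0r (_ : amplify _ _ _ = 0) ?snorm0//.
apply/matrixP => p q; rewrite !mxE.
have [_ bD bZ] := scalarE (dual_scalarr (x (mxtens_unindex p).1 (mxtens_unindex q).1)).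
by rewrite bD -scaleN1r bZ byy' mulN1r subrr.
Qed.

Lemma bounded_functional_continuous (Z : normedModType C) (f : Z -> C) (M : C) :
  scalar f -> 0 <= M -> (forall z, `|f z| <= M * `|z|) -> continuous (f : Z -> C^o).
Proof.
move=> fL M0 fM z; have [_ fD fZ] := scalarE fL.
apply/cvgrPdist_lt => e e0; have M1 : 0 < M + 1 by rewrite ltr_wpDl.
near=> w; have -> : f z - f w = f (z - w) by rewrite fD -(scaleN1r w) fZ mulN1r.
apply: le_lt_trans (fM _) _; apply: (@le_lt_trans _ _ ((M + 1) * `|z - w|)).
  by rewrite ler_wpM2r// lerDl.
rewrite mulrC -ltr_pdivlMr//; near: w.
by apply: (@cvgr_dist_lt _ _ _ (nbhs z) _ id z cvg_id); rewrite divr_gt0.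
Unshelve. all: by end_near. Qed.

Lemma dual_rep (f : X -> C) (M : C) : scalar f -> 0 <= M ->
  (forall x, `|f x| <= M * `|x|) -> exists y, forall x, f x = b x y.
Proof.
move=> fL M0 fM; have [_ _ _] := bP; apply; first exact: fL.
exact: (bounded_functional_continuous fL M0 fM).
Qed.

(** In the [Operator] setting the dual norm is tested on matrices; the scalar bound still suffices,
    since for functionals the norm and the completely bounded norm coincide. *)
Lemma dual_rep_norm (f : X -> C) (M : C) : scalar f -> 0 <= M ->
  (forall x, `|f x| <= M * `|x|) -> exists2 y, `|y| <= M & forall x, f x = b x y.
Proof.
move=> fL M0 fM; have [y fy] := dual_rep fL M0 fM; exists y => //.
have := @dual_mnormP 1 (\matrix_(_ < 1, _ < 1) y) M M0; rewrite mnorm11 mxE => ->.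
move=> m x; apply: le_trans (functional_matrix_bound fL M0 fM x).
apply: (@snorm_map_inj _ _ _ _ _ _ (fun p => (mxtens_unindex p).1)) => [p q|p q].
  case: (mxtens_indexP p) => i i'; case: (mxtens_indexP q) => j j'.
  by rewrite !mxtens_indexK/= => ->; rewrite (ord1 i') (ord1 j').
by rewrite !mxE fy.
Qed.

Lemma norm_hahn_banach (x : X) : exists2 f : X -> C, scalar f /\ (forall z, `|f z| <= `|z|)
  & f x = `|x|.
Proof.
have RK (z : X) : (complex.Re `|z|)%:C = `|z| by rewrite ReK.
have [z w|c z|f [fL fp fx]] := @hahn_banach R X (fun z => complex.Re `|z|) _ _ x.
- by rewrite -lecR rmorphD/= !RK ler_normD.
- by rewrite !RK normrZ.
- exists f; last by rewrite fx RK.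
  by split=> // z; rewrite -[leRHS]RK.
Qed.

Lemma predual_norm_le (x : X) (c : C) : 0 <= c ->
  (forall y, `|b x y| <= c * `|y|) -> `|x| <= c.
Proof.
move=> c0 bc; have [f [fL fp] fx] := norm_hahn_banach x.
have [|y y1 fy] := dual_rep_norm fL ler01; first by move=> z; rewrite mul1r.
by rewrite -(normr_id x) -fx fy (le_trans (bc y))// ler_piMr.
Qed.

Lemma predual_inj x x' : (forall y, b x y = b x' y) -> x = x'.
Proof.
move=> bxx'; apply/eqP; rewrite -subr_eq0 -normr_le0; apply: predual_norm_le => // y.
have [_ bD bZ] := scalarE (dual_scalarl y).
by rewrite bD -scaleN1r bZ bxx' mulN1r subrr normr0 mul0r.
Qed.

Lemma weakstar_functional (f : Y -> C) : scalar f ->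
  continuous (f : weakstar b -> C^o) -> exists x, f = b x.
Proof.
move=> fL fc; pose G : set (Y -> C) := range b.
suff [x _ fx] : G f by exists x.
apply: (@weak_continuous_functional R X Y (fun y x => b x y) G f) => //.
- by move=> x; exists x.
- split=> [_ [x _ <-]|a _ _ [x _ <-] [z _ <-]]; first exact: dual_scalarr.
  exists (a *: x + z) => //; apply/funext => y.
  by have [_ bD bZ] := scalarE (dual_scalarl y); rewrite bD bZ.
- exists 0 => //; apply/funext => y.
  by have [b0 _ _] := scalarE (dual_scalarl y).
Qed.

End Duality.

Lemma weakstar_continuousP (R : realType) (s : setting) (X Y : space R s)
    (b : X -> Y -> R[i]) (Z : topologicalType) (f : Z -> Y) :
  (forall x, continuous (fun z => b x (f z) : R[i]^o)) <->
  continuous (f : Z -> weakstar b).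
Proof.
split=> fc => [z|x z].
  exact: (@weak_cvg R X Y (fun y x => b x y) _ (f z)) (fun x => fc x z).
apply: (@cvg_comp _ _ _ (f : Z -> weakstar b) (b x)); first exact: fc.
exact: (@weak_ev_continuous R X Y (fun y x => b x y)).
Qed.

Lemma weakstar_preadjoint (R : realType) (s : setting) (X1 Y1 X2 Y2 : space R s)
    (b1 : X1 -> Y1 -> R[i]) (b2 : X2 -> Y2 -> R[i]) (Phi : Y1 -> Y2) (M : R[i]) :
  is_dual b1 -> is_dual b2 -> linear Phi -> continuous (Phi : weakstar b1 -> weakstar b2) ->
  0 <= M -> (forall y, `|Phi y| <= M * `|y|) ->
  exists2 T : X2 -> X1, forall x y, b1 (T x) y = b2 x (Phi y) &
    forall x, `|T x| <= M * `|x|.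
Proof.
move=> b1P b2P PhiL Phic M0 PhiM.
have /choice[T TP] : forall x, exists z, forall y, b1 z y = b2 x (Phi y).
  move=> x; have [||z zE] := @weakstar_functional _ _ _ _ _ b1P (fun y => b2 x (Phi y)).
  - by move=> a y y'; rewrite PhiL; exact: (dual_scalarr b2P).
  - exact: ((weakstar_continuousP _ _).2 Phic x).
  - by exists z => y; rewrite -zE.
exists T => // x; apply: (predual_norm_le b1P); first by rewrite mulr_ge0.
move=> y; rewrite TP (le_trans (dual_norm b2P _ _))//.
by rewrite [M * _]mulrC -mulrA ler_wpM2l.
Qed.

Section FunSpaceNorm.
Variables (R : realType) (s : setting) (D : fundata R s).
Hypothesis T_complete : fast_complete (funsp D).

(** Definitional for [Operator]. For [Banach], both sides are suprema of the same numbers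
    |x_ij(y_kl)|, taken in different orders. *)
Lemma funspace_mnorm n (x : 'M[funspace T_complete]_n) : mnorm x = fnorm (x : 'M[funsp D]_n).
Proof.
rewrite /mnorm; case: s D T_complete x => // D' Tc x.
apply/eqP; rewrite eq_le; apply/andP; split.
  apply/entnorm_le => [|i j]; first exact: fnorm_ge0.
  apply/fnorm1_le => [|m y yB]; first exact: fnorm_ge0.
  apply: le_trans (fnorm_ub (x : 'M[funsp D']_n) yB).
  apply/entnorm_le => [|k l]; first exact: entnorm_ge0.
  have := entnorm_ub (amplify (@funev _ _ D') y x) (mxtens_index (k, i)) (mxtens_index (l, j)).
  by rewrite amplifyE mxE.
apply/fnorm_le => [|m y yB]; first exact: entnorm_ge0.
apply/entnorm_le => [|p q]; first exact: entnorm_ge0.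
case: (mxtens_indexP p) => k i; case: (mxtens_indexP q) => l j; rewrite amplifyE.
apply: le_trans (entnorm_ub x i j).
have := (fnorm1_le (x i j) (fnorm_ge0 _)).1 (lexx _) _ _ yB.
by apply: le_trans; have := entnorm_ub (map_mx (sval (x i j)) y) k l; rewrite mxE.
Qed.

End FunSpaceNorm.

Lemma snorm_amplify_swap (R : realType) (s : setting) (E F : Type) (b : E -> F -> R[i])
    m n (x : 'M[E]_m) (y : 'M[F]_n) :
  snorm s (amplify (fun f e => b e f) y x) = snorm s (amplify b x y).
Proof.
have le (E' F' : Type) (c : E' -> F' -> R[i]) k l (u : 'M[E']_k) (v : 'M[F']_l) :
    snorm s (amplify (fun f e => c e f) v u) <= snorm s (amplify c u v).
  apply: (@snorm_map_inj _ _ _ _ _ _ (@tens_swap l k)) => [|p q].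
    exact: can_inj (@tens_swapK _ _).
  by rewrite !mxE /tens_swap !mxtens_indexK.
by apply/eqP; rewrite eq_le le; have := le _ _ (fun f e => b e f) _ _ y x.
Qed.

(** * The dual of a space *)

Section DualSpace.
Variables (R : realType) (s : setting) (Y : space R s).
Local Notation C := R[i].

Definition unit_ball n : set 'M[Y]_n := [set y | mnorm y <= 1].

Definition bounded_functionals : set (Y -> C) :=
  [set f | scalar f /\ exists2 M, 0 <= M & forall y, `|f y| <= M * `|y|].

Lemma bounded_functionals_subspace : subspace bounded_functionals.
Proof.
split=> [|a f g [fL [M M0 fM]] [gL [N N0 gN]]].
  split=> [c x y|]; first by rewrite /= mulr0 addr0.
  by exists 0 => // y; rewrite normr0 mul0r.
split=> [c x y|].
  by rewrite /= !fctE fL gL /GRing.scale/=; ring.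
exists (`|a| * M + N) => [|y]; first by rewrite addr_ge0// mulr_ge0.
rewrite /= (le_trans (ler_normD _ _))// mulrDl lerD// normrM -mulrA.
by rewrite ler_wpM2l.
Qed.

Lemma bounded_functionals_bounded f : bounded_functionals f -> exists2 M, 0 <= M &
  forall n (y : 'M[Y]_n), unit_ball y -> snorm s (map_mx f y) <= M.
Proof.
move=> [fL [M M0 fM]]; exists M => // n y y1.
by rewrite (le_trans (functional_matrix_bound fL M0 fM _))// ler_piMr.
Qed.

Lemma mnorm_const1 (y : Y) : mnorm (\matrix_(_ < 1, _ < 1) y) = `|y|.
Proof. by rewrite mnorm11 mxE. Qed.

Lemma bounded_functionals_separated f : bounded_functionals f ->
  (forall n (y : 'M[Y]_n) i j, unit_ball y -> f (y i j) = 0) -> f = 0.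
Proof.
move=> [/scalarE[f0 _ fZ] _] fB; apply/funext => y.
have [->//|y0] := eqVneq y 0.
have ny : `|y| != 0 by rewrite normr_eq0.
have := fB 1 (\matrix_(_ < 1, _ < 1) (`|y|^-1 *: y)) 0 0.
rewrite mxE fZ /unit_ball/= mnorm_const1 normrZ normfV normr_id mulVf// => /(_ (lexx _))/eqP.
by rewrite mulf_eq0 invr_eq0 (negPf ny)/= => /eqP.
Qed.

Definition dual_data : fundata R s :=
  FunData bounded_functionals_subspace bounded_functionals_bounded bounded_functionals_separated.

Lemma dual_data_mnorm m n (y : 'M[Y]_m) (f : 'M[funsp dual_data]_n) :
  snorm s (amplify (@funev _ _ dual_data) y f) <= fnorm f * mnorm y.
Proof.
have [y0|y0] := eqVneq (mnorm y) 0.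
  rewrite y0 mulr0 (mnorm_eq0 y0) (_ : amplify _ _ _ = 0) ?snorm0//.
  apply/matrixP => p q; rewrite !mxE /funev.
  by have [/scalarE[]] := svalP (f (mxtens_unindex p).2 (mxtens_unindex q).2).
have y_gt0 : 0 < mnorm y by rewrite lt_def y0 mnorm_ge0.
have := @fnorm_ub _ _ dual_data _ _ (map_mx ( *:%R (mnorm y)^-1) y) f.
rewrite /fd_ball/= /unit_ball/= mnormZ normfV (ger0_norm (mnorm_ge0 y)) mulVf// => /(_ (lexx _)).
have -> : amplify (@funev _ _ dual_data) (map_mx ( *:%R (mnorm y)^-1) y) f =
    (mnorm y)^-1 *: amplify (@funev _ _ dual_data) y f.
  apply/matrixP => p q; rewrite !mxE /funev.
  by have [/scalarE[_ _ ->]] := svalP (f (mxtens_unindex p).2 (mxtens_unindex q).2).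
by rewrite snormZ normfV (ger0_norm (mnorm_ge0 y)) mulrC ler_pdivrMr.
Qed.

Lemma dual_data_norm (f : funsp dual_data) (y : Y) : `|sval f y| <= `|f| * `|y|.
Proof.
have := dual_data_mnorm (\matrix_(_ < 1, _ < 1) y) (\matrix_(_ < 1, _ < 1) f).
rewrite mnorm_const1 fnorm11 mxE; apply: le_trans.
have := snorm_entry s (amplify (@funev _ _ dual_data) (\matrix_(_ < 1, _ < 1) y)
  (\matrix_(_ < 1, _ < 1) f)) (mxtens_index (0, 0)) (mxtens_index (0, 0)).
by rewrite amplifyE !mxE.
Qed.

Lemma dual_data_norm_le (f : funsp dual_data) (M : C) : 0 <= M ->
  (forall y, `|sval f y| <= M * `|y|) -> `|f| <= M.
Proof.
move=> M0 fM; apply/(fnorm1_le f M0) => m y y1.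
have [fL _] := svalP f.
by rewrite (le_trans (functional_matrix_bound fL M0 fM y))// ler_piMr.
Qed.

Lemma dual_data_complete : fast_complete (funsp dual_data).
Proof.
move=> u uP.
have ptP y k : `|sval (u k.+1) y - sval (u k) y| <= pow2 C k * `|y|.
  by rewrite -sval_funspB (le_trans (dual_data_norm _ _))// ler_wpM2r.
have /choice[f fP] : forall y, exists l, forall e, 0 < e ->
    exists N, forall k, (N <= k)%N -> `|sval (u k) y - l| <= e.
  move=> y; have y1 : 0 < `|y| + 1 by rewrite ltr_wpDl.
  (* The steps at [y] are bounded by 2^-k |y|; dividing by |y| + 1 makes the scalar sequence fast
     Cauchy, for [y] = 0 as well. *)
  have [k|l lP] := @complex_fast_complete R (fun k => sval (u k) y / (`|y| + 1)).
    rewrite -mulrBl normrM normfV (gtr0_norm y1) ler_pdivrMr// (le_trans (ptP _ _))//.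
    by rewrite ler_wpM2l ?lerDl// pow2_ge0.
  exists (l * (`|y| + 1)) => e e0; have [N NP] := lP _ (divr_gt0 e0 y1).
  exists N => k /NP; rewrite ler_pdivlMr// -[X in _ * X](gtr0_norm y1) -normrM mulrBl.
  by rewrite mulfVK// gt_eqF.
have lim_unique y l : (forall e, 0 < e -> exists N, forall k, (N <= k)%N ->
    `|sval (u k) y - l| <= e) -> f y = l.
  move=> lP; apply/eqP; rewrite -subr_eq0 -normr_le0; apply: le_eps => // e e0.
  have [N1 N1P] := fP y _ (divr_gt0 e0 (ltr0n _ 2)).
  have [N2 N2P] := lP _ (divr_gt0 e0 (ltr0n _ 2)).
  rewrite add0r -(subrKA (sval (u (maxn N1 N2)) y)) (le_trans (ler_normD _ _))// [e]splitr lerD//.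
    by rewrite distrC N1P// leq_maxl.
  by rewrite N2P// leq_maxr.
have uL k : scalar (sval (u k)) by have [] := svalP (u k).
have fL : scalar f.
  move=> a x y; apply: lim_unique => e e0; have e2 := divr_gt0 e0 (ltr0n C 2).
  have a1 : 0 < `|a| + 1 by rewrite ltr_wpDl.
  have [N1 N1P] := fP x _ (divr_gt0 e2 a1); have [N2 N2P] := fP y _ e2.
  exists (maxn N1 N2) => k; rewrite geq_max => /andP[/N1P h1 /N2P h2].
  rewrite uL opprD addrACA -mulrBr (le_trans (ler_normD _ _))// [e]splitr lerD// normrM.
  by rewrite (le_trans (ler_wpM2l (normr_ge0 a) h1))// mul_div_succ_le// ltW.
have fu k y : `|sval (u k) y - f y| <= 2 * pow2 C k * `|y|.
  apply: le_eps => [||e e0]; rewrite ?ger0_real ?mulr_ge0 ?pow2_ge0//.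
  have [N NP] := fP y _ e0; set m := maxn k N.
  rewrite -(subrKA (sval (u m) y)) (le_trans (ler_normD _ _))// lerD//; last first.
    by rewrite NP// leq_maxr.
  rewrite -sval_funspB (le_trans (dual_data_norm _ _))// ler_wpM2r// distrC.
  by rewrite fast_cauchy_le2// leq_maxl.
have fB : bounded_functionals f.
  split=> //; exists (`|u 0%N| + 2) => [|y]; first by rewrite addr_ge0.
  rewrite -(subrK (sval (u 0%N) y) (f y)) addrC (le_trans (ler_normD _ _))// mulrDl lerD//.
    exact: dual_data_norm.
  by rewrite distrC (le_trans (fu _ _))// /pow2 expr0 invr1 mulr1.
exists (exist _ f fB) => e e0; have [N NP] := pow2_small (divr_gt0 e0 (ltr0n C 2)).
exists N => k Nk; apply: dual_data_norm_le => [|y]; first exact: ltW.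
rewrite sval_funspB (le_trans (fu _ _))// ler_wpM2r//.
rewrite mulrC -ler_pdivlMr// (le_trans _ (ltW NP))//.
by rewrite /pow2 lef_pV2 ?posrE ?exprn_gt0// ler_weXn2l ?ler1n.
Qed.

Definition dual_space : space R s := funspace dual_data_complete.

Definition dual_pairing (y : Y) (f : dual_space) : C := sval (f : funsp dual_data) y.

Lemma dual_spaceP : is_dual dual_pairing.
Proof.
split.
- by move=> f; have [fL _] := svalP (f : funsp dual_data); exact: fL.
- by move=> y a f g; rewrite /dual_pairing sval_funspD sval_funspZ.
- apply/is_dual_normP => n f c c0; rewrite funspace_mnorm; split=> [fc m y|fc].
    by rewrite (le_trans (dual_data_mnorm _ _))// ler_wpM2r// mnorm_ge0.
  apply/fnorm_le => // m y y1; rewrite (le_trans (fc _ _))//.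
  by rewrite ler_piMr.
- move=> f fL fc; suff fB : bounded_functionals f by exists (exist _ f fB).
  split; first exact: fL.
  have [f0 _ fZ] := scalarE fL.
  have := fc 0 => /cvgrPdist_lt/(_ 1 ltr01).
  move=> /nbhs_ballP[d /= d0 dP]; exists (2 / d) => [|y]; first by rewrite ltW// divr_gt0.
  have [->|y0] := eqVneq y 0; first by rewrite f0 !normr0 mulr0.
  have ny : 0 < `|y| by rewrite normr_gt0.
  (* This scales [y] to norm d/2, strictly inside the ball of radius d on which |f| < 1; the bound
     2/d results. *)
  pose c : C := d / 2 / `|y|; have c0 : 0 < c by rewrite !divr_gt0.
  have := dP (c *: y); rewrite f0 sub0r normrN fZ normrM (gtr0_norm c0) => h.
  have : c * `|f y| < 1.
    apply: h; rewrite -ball_normE/= sub0r normrN normrZ (gtr0_norm c0) /c mulfVK ?gt_eqF//.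
    by rewrite ltr_pdivrMr// ltr_pMr// ltr1n.
  rewrite mulrC -ltr_pdivlMr// => /ltW; rewrite mul1r /c !invfM !invrK.
  by rewrite [_ * 2]mulrC.
Qed.

End DualSpace.

(** * Dual Banach algebras with an introverted predual; the second dual *)

Lemma range_subspace (R : realType) (V W : lmodType R[i]) (f : V -> W) :
  linear f -> subspace (range f).
Proof.
move=> fL; split=> [|c _ _ [a _ <-] [a' _ <-]].
  by exists 0 => //; have := fL (-1) 0 0; rewrite scaler0 add0r scaleN1r addNr.
by exists (c *: a + a') => //; rewrite fL.
Qed.

Lemma weakstar_separation (R : realType) (s : setting) (X Y : space R s)
    (b : X -> Y -> R[i]) (S : set Y) (v : Y) : is_dual b -> subspace S ->
  ~ closure (S : set (weakstar b)) v ->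
  exists x, (forall y, S y -> b x y = 0) /\ b x v != 0.
Proof.
move=> bP [S0 SL] nv.
pose G : set ((X -> R[i]) -> R[i]) :=
  [set g | scalar g /\ exists x, forall y, g (fun x => b x y) = b x y].
have [|||x|g [[gL [x gx]] gS gv]] := @weak_separation R X Y (fun y x => b x y) S v G _ _ _ _ nv.
- split=> [g []//|a g k [gL [x gx]] [kL [z kz]]]; split.
    by move=> c u w; rewrite gL kL /GRing.scale/=; ring.
  exists (a *: x + z) => y; rewrite gx kz.
  by have [_ -> ->] := scalarE (dual_scalarl bP y).
- split; first by exists 0 => //; apply/funext => x; have [] := scalarE (dual_scalarr bP x).
  move=> a _ _ [y Sy <-] [z Sz <-]; exists (a *: y + z); first exact: SL.
  by apply/funext => x; have [_ -> ->] := scalarE (dual_scalarr bP x).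
- split=> [c u w|]; first by rewrite /= mulr0 addr0.
  by exists 0 => y; have [-> _ _] := scalarE (dual_scalarl bP y).
- by split=> [c u w|]; [|exists x].
- by exists x; split=> [y Sy|]; rewrite -gx//; exact: gS.
Qed.

Section Introverted.
Variables (R : realType) (s : setting) (A : balgebra R s) (X Y : space R s).
Variables (b : X -> Y -> R[i]) (h : A -> Y).
Variables (rdot : X -> A -> X) (L : Y -> X -> X) (m : Y -> Y -> Y).
Local Notation C := R[i].
Hypothesis bP : is_dual b.
Hypothesis h_linear : linear h.
Hypothesis h_contractive : contractive h.
Hypothesis h_total : forall x, (forall a, b x (h a) = 0) -> x = 0.
Hypothesis rdotE : forall x a a', b (rdot x a) (h a') = b x (h (mul a a')).
Hypothesis LE : forall nu x a, b (L nu x) (h a) = b (rdot x a) nu.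
Hypothesis mE : forall mu nu x, b x (m mu nu) = b (L nu x) mu.
Hypothesis m_contractive : contractive2 m.

Let bl y : [/\ b 0 y = 0, forall x x', b (x + x') y = b x y + b x' y
  & forall a x, b (a *: x) y = a * b x y].
Proof. exact: scalarE (dual_scalarl bP y). Qed.

Let br x : [/\ b x 0 = 0, forall y y', b x (y + y') = b x y + b x y'
  & forall a y, b x (a *: y) = a * b x y].
Proof. exact: scalarE (dual_scalarr bP x). Qed.

Let h_sep x x' : (forall a, b x (h a) = b x' (h a)) -> x = x'.
Proof.
move=> xx'; apply/eqP; rewrite -subr_eq0; apply/eqP/h_total => a.
have [_ D Z] := bl (h a).
by rewrite D -scaleN1r Z mulN1r xx' subrr.
Qed.

Let LDl c nu nu' x : L (c *: nu + nu') x = c *: L nu x + L nu' x.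
Proof.
apply: h_sep => a; have [_ D Z] := bl (h a); have [_ D' Z'] := br (rdot x a).
by rewrite D Z !LE D' Z'.
Qed.

Lemma introverted_linearl nu : linear (fun mu => m mu nu).
Proof.
move=> c mu mu'; apply: (dual_inj bP) => x.
have [_ D Z] := br x; have [_ D' Z'] := br (L nu x).
by rewrite D Z !mE D' Z'.
Qed.

Lemma introverted_linearr mu : linear (m mu).
Proof.
move=> c nu nu'; apply: (dual_inj bP) => x.
have [_ D Z] := br x; have [_ D' Z'] := bl mu.
by rewrite D Z !mE LDl D' Z'.
Qed.

(** Associativity climbs from [A] to the dual: [rdot] is an action of [A], so it commutes with each
    [L nu], so composing [L nu] with [L rho] gives [L (m nu rho)]. The first three identities are
    tested on [h a], which separates the predual. *)
Lemma introverted_mulA : associative m.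
Proof.
have rdotA x a a' : rdot (rdot x a) a' = rdot x (mul a a').
  by apply: h_sep => c; rewrite !rdotE mulA.
have rdotL nu x a : rdot (L nu x) a = L nu (rdot x a).
  by apply: h_sep => c; rewrite rdotE !LE rdotA.
have LL nu rho x : L nu (L rho x) = L (m nu rho) x.
  by apply: h_sep => a; rewrite !LE mE -rdotL.
by move=> mu nu rho; apply: (dual_inj bP) => x; rewrite !mE LL.
Qed.

Definition introverted_balgebra : balgebra R s :=
  @BAlgebra R s Y m introverted_linearl introverted_linearr introverted_mulA m_contractive.

Let b_continuous x : continuous (b x : weakstar b -> C^o).
Proof. exact: (@weak_ev_continuous R X Y (fun y x => b x y) x). Qed.

Lemma introverted_mul_weakstar (nu : introverted_balgebra) :
  continuous ((fun mu : introverted_balgebra => mul mu nu) : weakstar b -> weakstar b).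
Proof.
apply/(weakstar_continuousP b (fun mu : weakstar b => m mu nu)) => x.
rewrite (_ : (fun mu => _) = b (L nu x)); first exact: b_continuous.
by apply/funext => mu; rewrite mE.
Qed.

Lemma introverted_hom : algebra_hom (h : A -> introverted_balgebra).
Proof.
split; first exact: h_linear.
by move=> a a'; apply: (dual_inj bP) => x; rewrite /= mE LE rdotE.
Qed.

Lemma introverted_dense : closure (range h : set (weakstar b)) = setT.
Proof.
rewrite -subTset => v _; apply: contrapT => nv.
have [x [xh /eqP]] := weakstar_separation bP (range_subspace h_linear) nv.
have -> : x = 0 by apply: h_total => a; apply: xh; exists a.
by have [-> _ _] := bl v.
Qed.

(** Left multiplication by [h a] has the preadjoint [rdot] by [a], just as right multiplication by
    [nu] has the preadjoint [L nu]. *)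
Lemma introverted_centre : range h `<=` @Zt R s X introverted_balgebra b.
Proof.
move=> _ [a _ <-]; rewrite /Zt/=.
apply/(weakstar_continuousP b (fun nu : weakstar b => m (h a) nu)) => x.
rewrite (_ : (fun nu => _) = b (rdot x a)); first exact: b_continuous.
by apply/funext => nu; rewrite mE LE.
Qed.

Definition introverted_hldba : hldba A :=
  @HLDBA R s A introverted_balgebra X b bP h introverted_mul_weakstar
    introverted_hom h_contractive introverted_dense introverted_centre.

End Introverted.

(* The identity <x, yz> = <zx, y> holds at each of the three steps defining the
   first Arens product. *)
Lemma amplify_rotate (R : realType) (s : setting) (E1 E2 E3 F G : Type)
    (b1 : E1 -> F -> R[i]) (m1 : E2 -> E3 -> F) (b2 : G -> E2 -> R[i]) (m2 : E3 -> E1 -> G)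
    p q r (x : 'M[E1]_p) (y : 'M[E2]_q) (z : 'M[E3]_r) :
  (forall x y z, b1 x (m1 y z) = b2 (m2 z x) y) ->
  snorm s (amplify b1 x (amplify m1 y z)) <= snorm s (amplify b2 (amplify m2 z x) y).
Proof.
move=> mE; pose f (u : 'I_(p * (q * r))) : 'I_(r * p * q) :=
  let jk := mxtens_unindex (mxtens_unindex u).2 in
  mxtens_index (mxtens_index (jk.2, (mxtens_unindex u).1), jk.1).
apply: (@snorm_map_inj _ _ _ _ _ _ f) => u v.
  case: (mxtens_indexP u) => i jk; case: (mxtens_indexP jk) => j k.
  case: (mxtens_indexP v) => i' jk'; case: (mxtens_indexP jk') => j' k'.
  rewrite /f !mxtens_indexK => /(can_inj (@mxtens_indexK _ _))/pair_equal_spec[].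
  by move=> /(can_inj (@mxtens_indexK _ _))/pair_equal_spec[/= -> ->] /= ->.
case: (mxtens_indexP u) => i jk; case: (mxtens_indexP jk) => j k.
case: (mxtens_indexP v) => i' jk'; case: (mxtens_indexP jk') => j' k'.
by rewrite /f !mxtens_indexK !amplifyE mE.
Qed.

(** The norm of a matrix of products [m1 y z] is the least bound of its pairings with [x], and each
    of these is a pairing of [m2 z x] with [y]; so contractivity passes from an action to its dual
    action. *)
Lemma mnorm_rotate (R : realType) (s : setting) (X Y Y1 Y2 Z2 : space R s)
    (b1 : X -> Y -> R[i]) (b2 : Z2 -> Y1 -> R[i])
    (m1 : Y1 -> Y2 -> Y) (m2 : Y2 -> X -> Z2) :
  is_dual b1 -> is_dual b2 ->
  (forall x y z, b1 x (m1 y z) = b2 (m2 z x) y) -> contractive2 m2 -> contractive2 m1.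
Proof.
move=> b1P b2P mE /contractive2P m2C; apply/contractive2P => q r y z.
apply/(dual_mnormP b1P) => [|p x]; first by rewrite mulr_ge0 ?mnorm_ge0.
rewrite (le_trans (amplify_rotate _ _ _ _ mE))// (le_trans (dual_mnorm b2P _ _))//.
by rewrite -mulrA ler_wpM2l ?mnorm_ge0.
Qed.

Lemma norm_contractive2 (R : realType) (s : setting) (X Y Z : space R s) (m : X -> Y -> Z) x y :
  contractive2 m -> `|m x y| <= `|x| * `|y|.
Proof.
move=> /contractive2P/(_ _ _ (\matrix_(_ < 1, _ < 1) x) (\matrix_(_ < 1, _ < 1) y)).
rewrite !mnorm_const1; apply: le_trans.
have := mnorm_entry (amplify m (\matrix_(_ < 1, _ < 1) x) (\matrix_(_ < 1, _ < 1) y))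
  (mxtens_index (0, 0)) (mxtens_index (0, 0)).
by rewrite amplifyE !mxE.
Qed.

Lemma contractive_norm (R : realType) (s : setting) (X Y : space R s) (f : X -> Y) x :
  contractive f -> `|f x| <= `|x|.
Proof.
move=> /contractiveP/(_ _ (\matrix_(_ < 1, _ < 1) x)).
by rewrite !mnorm11 !mxE.
Qed.

(** The actions [rdot], [L] and the product each arise by representing bounded functionals. The
    contractivity of each one is proved before the next is built, since it supplies the bound for
    the functionals defining the next. *)
Lemma bidual_exists (R : realType) (s : setting) (A : balgebra R s) :
  exists V : hldba A, is_bidual V.
Proof.
pose X := dual_space A; pose Y := dual_space X.
pose ev : A -> X -> R[i] := @dual_pairing R s A.
pose b : X -> Y -> R[i] := @dual_pairing R s X.
have evP : is_dual ev := dual_spaceP A; have bP : is_dual b := dual_spaceP X.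
have mulC := @mul_contractive R s A.
have /choice[h hE] : forall a, exists y, forall phi, b phi y = ev a phi.
  move=> a; have [phi|y yE] := dual_rep bP (dual_scalarr evP a) (normr_ge0 a).
    exact: dual_norm.
  by exists y.
have /choice[rdot rdotE] : forall phi, exists r : A -> X, forall a a', ev a' (r a) = ev (mul a a') phi.
  move=> phi.
  have [|r rE] := @choice _ _ (fun a r => forall a', ev a' r = ev (mul a a') phi); last by exists r.
  move=> a; have [||a'|r rE] := @dual_rep _ _ _ _ _ evP (fun a' => ev (mul a a') phi) (`|a| * `|phi|).
  - by move=> c x y; rewrite mul_linearr; exact: (dual_scalarl evP phi).
  - by rewrite mulr_ge0.
  - rewrite (le_trans (dual_norm evP _ _))// mulrAC ler_wpM2r//.
    exact: norm_contractive2.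
  - by exists r => a'; rewrite -rE.
have rdotC : contractive2 rdot.
  by apply: (mnorm_rotate evP evP _ mulC) => a phi a'; exact: rdotE.
have rdot_linear phi : linear (rdot phi).
  move=> c a a'; apply: (dual_inj evP) => x.
  have [_ D Z] := scalarE (dual_scalarr evP x).
  rewrite D Z !rdotE mul_linearl.
  by have [_ -> ->] := scalarE (dual_scalarl evP phi).
have /choice[L LE] : forall nu, exists l : X -> X, forall phi a, ev a (l phi) = b (rdot phi a) nu.
  move=> nu.
  have [|l lE] := @choice _ _ (fun phi l => forall a, ev a l = b (rdot phi a) nu); last by exists l.
  move=> phi; have [||a|l lE] := @dual_rep _ _ _ _ _ evP (fun a => b (rdot phi a) nu) (`|nu| * `|phi|).
  - by move=> c x y; rewrite rdot_linear; exact: (dual_scalarl bP nu).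
  - by rewrite mulr_ge0.
  - rewrite (le_trans (dual_norm bP _ _))// mulrC -mulrA ler_wpM2l//.
    exact: norm_contractive2.
  - by exists l => a; rewrite -lE.
have LC : contractive2 L.
  by apply: (mnorm_rotate evP bP _ rdotC) => a nu phi; exact: LE.
have L_linear nu : linear (L nu).
  move=> c phi phi'; apply: (dual_inj evP) => x.
  have [_ D Z] := scalarE (dual_scalarr evP x).
  rewrite D Z !LE; have [_ D' Z'] := scalarE (dual_scalarl bP nu).
  rewrite -Z' -D'; congr b; apply: (dual_inj evP) => a.
  have [_ D'' Z''] := scalarE (dual_scalarr evP a).
  by rewrite D'' Z'' !rdotE; have [_ -> ->] := scalarE (dual_scalarr evP (mul x a)).
have /choice[m mE] : forall mu, exists l : Y -> Y, forall nu phi, b phi (l nu) = b (L nu phi) mu.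
  move=> mu.
  have [|l lE] := @choice _ _ (fun nu l => forall phi, b phi l = b (L nu phi) mu); last by exists l.
  move=> nu; have [||phi|l lE] := @dual_rep _ _ _ _ _ bP (fun phi => b (L nu phi) mu) (`|mu| * `|nu|).
  - by move=> c x y; rewrite L_linear; exact: (dual_scalarl bP mu).
  - by rewrite mulr_ge0.
  - rewrite (le_trans (dual_norm bP _ _))// mulrC -mulrA ler_wpM2l//.
    exact: norm_contractive2.
  - by exists l => phi; rewrite -lE.
have mC : contractive2 m.
  by apply: (mnorm_rotate bP bP _ LC) => phi mu nu; exact: mE.
have h_linear : linear h.
  move=> c a a'; apply: (dual_inj bP) => phi.
  have [_ -> ->] := scalarE (dual_scalarr bP phi); rewrite !hE.
  by have [_ -> ->] := scalarE (dual_scalarl evP phi).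
have hC : contractive h.
  apply/contractiveP => n a; apply/(dual_mnormP bP) => [|k phi]; first exact: mnorm_ge0.
  have -> : amplify b phi (map_mx h a) = amplify (fun phi a => ev a phi) phi a.
    by apply/matrixP => p q; rewrite !mxE hE.
  by rewrite snorm_amplify_swap mulrC dual_mnorm.
have h_total phi : (forall a, b phi (h a) = 0) -> phi = 0.
  move=> p0; apply: (dual_inj evP) => a; rewrite -hE p0.
  by have [-> _ _] := scalarE (dual_scalarr evP a).
have rdotE' phi a a' : b (rdot phi a) (h a') = b phi (h (mul a a')).
  by rewrite !hE rdotE.
have LE' nu phi a : b (L nu phi) (h a) = b (rdot phi a) nu by rewrite hE LE.
exists (introverted_hldba bP h_linear hC h_total rdotE' LE' (fun mu nu phi => mE mu nu phi) mC).
exists ev, rdot, L; split=> //.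
Qed.

Lemma adjoint_map (R : realType) (s : setting) (X1 Y1 X2 Y2 : space R s)
    (b1 : X1 -> Y1 -> R[i]) (b2 : X2 -> Y2 -> R[i]) (T : X2 -> X1) :
  is_dual b1 -> is_dual b2 -> linear T -> contractive T ->
  exists Phi : Y1 -> Y2, [/\ forall x y, b2 x (Phi y) = b1 (T x) y, linear Phi,
    contractive Phi & continuous (Phi : weakstar b1 -> weakstar b2)].
Proof.
move=> b1P b2P TL TC.
have /choice[Phi PhiE] : forall y, exists z, forall x, b2 x z = b1 (T x) y.
  move=> y; have [||x|z zE] := @dual_rep _ _ _ _ _ b2P (fun x => b1 (T x) y) `|y|.
  - by move=> c x x'; rewrite TL; exact: (dual_scalarl b1P y).
  - by [].
  - rewrite (le_trans (dual_norm b1P _ _))// mulrC ler_wpM2l//.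
    exact: contractive_norm.
  - by exists z => x; rewrite -zE.
exists Phi; split.
- by move=> x y; exact: PhiE.
- move=> c y y'; apply: (dual_inj b2P) => x.
  have [_ -> ->] := scalarE (dual_scalarr b2P x); rewrite !PhiE.
  by have [_ -> ->] := scalarE (dual_scalarr b1P (T x)).
- apply/contractiveP => n y; apply/(dual_mnormP b2P) => [|k x]; first exact: mnorm_ge0.
  have -> : amplify b2 x (map_mx Phi y) = amplify b1 (map_mx T x) y.
    by apply/matrixP => p q; rewrite !mxE PhiE.
  rewrite (le_trans (dual_mnorm b1P _ _))// ler_wpM2l ?mnorm_ge0//.
  by move/contractiveP: TC; apply.
- apply/(weakstar_continuousP b2 (Phi : weakstar b1 -> Y2)) => x.
  rewrite (_ : (fun y => _) = b1 (T x)); last by apply/funext => y; rewrite PhiE.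
  exact: (@weak_ev_continuous R X1 Y1 (fun y x => b1 x y) (T x)).
Qed.

Lemma bidual_largest (R : realType) (s : setting) (A : balgebra R s) (V W : hldba A) :
  is_bidual V -> hldba_le W V.
Proof.
move=> [ev [rdot [arens [evP etaE _ _ _]]]].
have WP := pairing_dual W; have VP := pairing_dual V.
have etaL : linear (eta W) by case: (eta_hom W).
have /choice[T TE] : forall phi, exists z, forall a, ev a z = pairing W phi (eta W a).
  move=> phi; have [||a|z zE] := @dual_rep _ _ _ _ _ evP (fun a => pairing W phi (eta W a)) `|phi|.
  - by move=> c x x'; rewrite etaL; exact: (dual_scalarr WP phi).
  - by [].
  - rewrite (le_trans (dual_norm WP _ _))// ler_wpM2l//.
    by apply: contractive_norm; exact: eta_contractive.
  - by exists z => x; rewrite -zE.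
have TL : linear T.
  move=> c x x'; apply: (dual_inj evP) => a.
  have [_ -> ->] := scalarE (dual_scalarr evP a); rewrite !TE.
  by have [_ -> ->] := scalarE (dual_scalarl WP (eta W a)).
have TC : contractive T.
  apply/contractiveP => n phi; apply/(dual_mnormP evP) => [|k a]; first exact: mnorm_ge0.
  have -> : amplify ev a (map_mx T phi) =
      amplify (fun v phi => pairing W phi v) (map_mx (eta W) a) phi.
    by apply/matrixP => p q; rewrite !mxE TE.
  rewrite snorm_amplify_swap (le_trans (dual_mnorm WP _ _))// mulrC ler_wpM2l ?mnorm_ge0//.
  by move/contractiveP: (@eta_contractive _ _ _ W); apply.
have [Phi [PhiE PhiL PhiC Phic]] := adjoint_map VP WP TL TC.
exists Phi; split=> // a; apply: (dual_inj WP) => phi.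
by rewrite PhiE etaE TE.
Qed.

(** * The order *)

(* [Q x r] stands for: r is an admissible bound of a seminorm at x. *)
Lemma gauge_hahn_banach (R : realType) (X : lmodType R[i]) (Q : X -> R -> Prop) (x0 : X) :
  (forall x, exists r, Q x r) -> (forall x r, Q x r -> 0 <= r) ->
  (forall x y r t, Q x r -> Q y t -> Q (x + y) (r + t)) ->
  (forall c x r, Q x r -> Q (c *: x) (complex.Re `|c| * r)) ->
  exists f : X -> R[i], [/\ scalar f, forall x r, Q x r -> `|f x| <= r%:C &
    forall m, (forall r, Q x0 r -> m <= r) -> m%:C <= `|f x0|].
Proof.
move=> Qex Q0 QD QZ; pose p x := inf [set r | Q x r].
have Qinf x : has_inf [set r | Q x r].
  by split; [exact: Qex|exists 0 => r /Q0].
have ple x r : Q x r -> p x <= r by move=> Qxr; apply: ge_inf => //; exists 0 => t /Q0.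
have lep x m : (forall r, Q x r -> m <= r) -> m <= p x.
  by move=> mQ; apply: lb_le_inf => //; exact: Qex.
have p0 x : 0 <= p x by apply: (lep) => r /Q0.
have ReM (c : R[i]) : (complex.Re `|c|)%:C = `|c| by rewrite ReK.
have Re0 (c : R[i]) : 0 <= complex.Re `|c| by rewrite -ler0c ReM.
have pZle c x : p (c *: x) <= complex.Re `|c| * p x.
  have [c0|c0] := eqVneq (complex.Re `|c|) 0.
    by have [r Qr] := Qex x; have := ple _ _ (QZ c _ _ Qr); rewrite c0 !mul0r.
  have c_gt0 : 0 < complex.Re `|c| by rewrite lt_def c0 Re0.
  rewrite mulrC -ler_pdivrMr//; apply: (lep) => r Qr.
  by rewrite ler_pdivrMr// mulrC; apply/ple/QZ.
have [x y|c x|f [fL fp fx]] := @hahn_banach R X p _ _ x0.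
- rewrite -lerBlDr; apply: (lep) => r Qr; rewrite lerBlDr -lerBlDl.
  by apply: (lep) => t Qt; rewrite lerBlDl; apply/ple/QD.
- rewrite -ReM -rmorphM; congr _%:C; apply/eqP; rewrite eq_le; apply/andP; split.
    exact: pZle.
  have [->|c0] := eqVneq c 0.
    by rewrite normr0 (_ : complex.Re 0 = 0)// mul0r.
  have c_gt0 : 0 < complex.Re `|c| by rewrite -ltcR ReM normr_gt0.
  rewrite mulrC -ler_pdivlMr//; have := pZle c^-1 (c *: x).
  rewrite scalerA mulVf// scale1r mulrC => /le_trans; apply.
  rewrite ler_wpM2l// (_ : complex.Re `|c^-1| = (complex.Re `|c|)^-1)//.
  by apply: complexI; rewrite ReM fmorphV/= ReM normfV.
- exists f; split=> // [x r /ple xr|m /lep mp].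
    by rewrite (le_trans (fp x))// lecR.
  by rewrite fx ger0_norm ?ler0c// lecR.
Qed.

Lemma linearE (R : realType) (V W : lmodType R[i]) (f : V -> W) : linear f ->
  [/\ f 0 = 0, forall x y, f (x + y) = f x + f y & forall a x, f (a *: x) = a *: f x].
Proof.
move=> fL; have f0 : f 0 = 0.
  by have := fL (-1) 0 0; rewrite scaler0 add0r scaleN1r addNr.
split=> // [x y|a x]; first by have := fL 1 x y; rewrite !scale1r.
by have := fL a x 0; rewrite !addr0 f0 addr0.
Qed.

Section OrderTheory.
Variables (R : realType) (s : setting) (A : balgebra R s).
Local Notation C := R[i].
Implicit Types V W U : hldba A.

Lemma contractive_comp (X Y Z : space R s) (f : X -> Y) (g : Y -> Z) :
  contractive f -> contractive g -> contractive (g \o f).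
Proof.
move=> /contractiveP fC /contractiveP gC; apply/contractiveP => n x.
by rewrite map_mx_comp (le_trans (gC _ _))// fC.
Qed.

Lemma eta_total V (phi : predual V) :
  (forall a, pairing V phi (eta V a) = 0) -> phi = 0.
Proof.
move=> phi0; have VP := pairing_dual V.
apply: (predual_inj VP) => v; have [-> _ _] := scalarE (dual_scalarl VP v).
apply/eqP/negPn/negP => nz.
have : closure (range (eta V) : set (wstar V)) v by rewrite /wstar eta_dense.
have fc := @weak_ev_continuous R (predual V) V (fun v phi => pairing V phi v) phi.
have n0 : 0 < `|pairing V phi v| by rewrite normr_gt0.
have /cvgrPdist_lt/(_ _ n0) nb := fc v.
by move=> /(_ _ nb)[_ [[a _ <-] /=]]; rewrite phi0 subr0 ltxx.
Qed.

(** Composed with a predual element, both maps become weak*-continuous functionals on [V], that is,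
    elements of its predual; these are determined on [A]. *)
Lemma weakstar_dense_ext V (X Y : space R s) (b : X -> Y -> C) (f g : V -> Y) :
  is_dual b -> linear f -> linear g -> continuous (f : wstar V -> weakstar b) ->
  continuous (g : wstar V -> weakstar b) -> (forall a, f (eta V a) = g (eta V a)) ->
  forall v, f v = g v.
Proof.
move=> bP fL gL fc gc fg v; apply: (dual_inj bP) => x; have VP := pairing_dual V.
have rep k : linear k -> continuous (k : wstar V -> weakstar b) ->
    exists phi, (fun v => b x (k v)) = pairing V phi.
  move=> kL kc; apply: (weakstar_functional VP).
    by move=> c u w; rewrite kL; exact: (dual_scalarr bP x).
  exact: ((weakstar_continuousP b (k : wstar V -> Y)).2 kc x).
have [phi fE] := rep f fL fc; have [psi gE] := rep g gL gc.
suff E : phi = psi by have := congr1 (@^~ v) fE; have := congr1 (@^~ v) gE; rewrite /= E => -> ->.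
apply/eqP; rewrite -subr_eq0; apply/eqP/eta_total => a.
have [_ D Z] := scalarE (dual_scalarl VP (eta V a)).
by rewrite D -scaleN1r Z mulN1r -fE -gE fg subrr.
Qed.

Lemma hldba_le_refl V : hldba_le V V.
Proof.
exists id; split=> //; last by move=> ?.
by apply/contractiveP => n x; rewrite map_mx_id.
Qed.

Lemma hldba_map_comp V W U (Phi : V -> W) (Psi : W -> U) :
  hldba_map Phi -> hldba_map Psi -> hldba_map (Psi \o Phi).
Proof.
move=> [FL FC Fc FE] [GL GC Gc GE]; split.
- by move=> a x y; rewrite /= FL GL.
- exact: contractive_comp.
- by move=> v; apply: (@continuous_comp (wstar V) (wstar W) (wstar U) Phi Psi); [exact: Fc|exact: Gc].
- by move=> a; rewrite /= FE.
Qed.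

Lemma hldba_le_trans V W U : hldba_le V W -> hldba_le W U -> hldba_le V U.
Proof. by move=> [Phi FP] [Psi GP]; exists (Phi \o Psi); exact: hldba_map_comp. Qed.

(** Multiplicativity is no part of [hldba_map] but follows by two extensions. With left factor from
    [A], the centre gives weak*-continuity in the right factor; then, for a fixed right factor,
    continuity in the left factor extends from [A] to everything. *)
Lemma hldba_map_hom V W (Phi : V -> W) : hldba_map Phi -> {morph Phi : u v / mul u v}.
Proof.
move=> [FL FC Fc FE]; have WP := pairing_dual W.
have eta_left (U : hldba A) a : continuous ((fun v => mul (eta U a) v) : wstar U -> wstar U).
  by have := @eta_centre _ _ _ U; apply; exists a.
have eq1 a v : Phi (mul (eta V a) v) = mul (eta W a) (Phi v).
  apply: (weakstar_dense_ext (f := fun v => Phi (mul (eta V a) v))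
    (g := fun v => mul (eta W a) (Phi v)) WP) => [c x y|c x y|||c].
  - by rewrite mul_linearr FL.
  - by rewrite FL mul_linearr.
  - move=> x; apply: (@continuous_comp (wstar V) (wstar V) (wstar W) (mul (eta V a)) Phi);
      by [exact: eta_left|exact: Fc].
  - move=> x; apply: (@continuous_comp (wstar V) (wstar W) (wstar W) Phi (mul (eta W a)));
      by [exact: Fc|exact: eta_left].
  - by have [_ VM] := eta_hom V; have [_ WM] := eta_hom W; rewrite -VM !FE WM.
move=> u v; apply: (weakstar_dense_ext (f := fun u => Phi (mul u v))
    (g := fun u => mul (Phi u) (Phi v)) WP) => [c x y|c x y|||c].
- by rewrite mul_linearl FL.
- by rewrite FL mul_linearl.
- move=> x; apply: (@continuous_comp (wstar V) (wstar V) (wstar W) (fun u => mul u v) Phi);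
    by [exact: mul_weakstar|exact: Fc].
- move=> x; apply: (@continuous_comp (wstar V) (wstar W) (wstar W) Phi (fun u => mul u (Phi v)));
    by [exact: Fc|exact: mul_weakstar].
- by rewrite eq1 FE.
Qed.

Lemma hldba_le_anti V W : hldba_le W V -> hldba_le V W -> hldba_equiv V W.
Proof.
move=> [Phi FP] [Psi GP]; exists Phi; case: (FP) (GP) => [FL FC Fc FE] [GL GC Gc GE].
have comp (V' W' : hldba A) (F : V' -> W') (G : W' -> V') : hldba_map F -> hldba_map G ->
    forall v, G (F v) = v.
  move=> Fm Gm; have [GFL _ GFc GFE] := hldba_map_comp Fm Gm.
  apply: (weakstar_dense_ext (g := id) (pairing_dual V') GFL);
    by [|exact: GFc|move=> x; exact: cvg_id|exact: GFE].
split=> //.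
- apply/isometricP => n x; apply/eqP; rewrite eq_le; apply/andP; split.
    by move/contractiveP: FC; apply.
  move/contractiveP: GC => /(_ _ (map_mx Phi x)); apply: le_trans.
  rewrite -map_mx_comp (_ : map_mx _ x = x)//.
  by apply/matrixP => i j; rewrite mxE /= (comp _ _ _ _ FP GP).
- by apply/seteqP; split=> // w _; exists (Psi w) => //; exact: comp GP FP w.
- by split=> //; exact: hldba_map_hom.
Qed.

(* The preadjoint of the given isometry is an isometry whose range is dense,
   since a functional vanishing on it is given by an element of the kernel. *)
Lemma hldba_equiv_le V W : hldba_equiv V W -> hldba_le V W.
Proof.
move=> [Phi [[FL FC Fc FE] Fiso Fsurj [_ FM]]].
have VP := pairing_dual V; have WP := pairing_dual W.
have nPhi v : `|Phi v| = `|v|.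
  by have /isometricP/(_ _ (\matrix_(_ < 1, _ < 1) v)) := Fiso; rewrite !mnorm11 !mxE.
have [|T TE TM] := weakstar_preadjoint VP WP FL Fc ler01.
  by move=> v; rewrite mul1r nPhi.
have [F0 FD FZ] := linearE FL.
have Phi_inj v v' : Phi v = Phi v' -> v = v'.
  move=> e; apply/eqP; by rewrite -subr_eq0 -normr_le0 -nPhi FD -scaleN1r FZ e scaleN1r subrr normr0.
have TL : linear T.
  move=> c x x'; apply: (predual_inj VP) => v.
  have [_ -> ->] := scalarE (dual_scalarl VP v); rewrite !TE.
  by have [_ -> ->] := scalarE (dual_scalarl WP (Phi v)).
have nT phi : `|phi| <= `|T phi|.
  apply: (predual_norm_le WP) => // w; have [v _ <-] : range Phi w by rewrite Fsurj.
  by rewrite -TE nPhi dual_norm.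
have TB phi phi' : T phi - T phi' = T (phi - phi').
  by have [_ -> TZ] := linearE TL; rewrite -(scaleN1r phi') TZ scaleN1r.
have dense psi (e : C) : 0 < e -> exists phi, `|psi - T phi| <= e.
  move=> e0; apply: contrapT => /forallNP ne.
  have [T0 TD TZ] := linearE TL; have eE := ReK (ltW e0).
  (* The admissible bounds encode the distance to the range of [T]; a functional below this seminorm
     vanishes on that range and is contractive. *)
  have [x|x r [phi xr]|x y r t [phi xr] [phi' yt]|c x r [phi xr]|f [fL fQ fpsi]] :=
      @gauge_hahn_banach R _ (fun x r => exists phi, `|x - T phi| <= r%:C) psi.
  - by exists (complex.Re `|x|), 0; rewrite T0 subr0 ReK.
  - by rewrite -ler0c (le_trans _ xr).
  - exists (phi + phi'); rewrite TD opprD addrACA rmorphD.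
    by rewrite (le_trans (ler_normD _ _))// lerD.
  - exists (c *: phi); rewrite TZ -scalerBr normrZ rmorphM.
    by rewrite [X in _ <= X * _]ReK// ler_wpM2l.
  have f1 x : `|f x| <= 1 * `|x|.
    by rewrite mul1r -(ReK (normr_ge0 x)); apply: fQ; exists 0; rewrite T0 subr0 ReK.
  have [v fE] := dual_rep VP fL ler01 f1.
  have v0 : v = 0.
    apply: Phi_inj; apply: (dual_inj WP) => phi; rewrite F0.
    have [-> _ _] := scalarE (dual_scalarr WP phi); rewrite -TE -fE.
    apply/eqP; rewrite -normr_le0; apply: (fQ _ 0); exists phi.
    by rewrite subrr normr0.
  have : e <= `|f psi|.
    rewrite -eE; apply: fpsi => r [phi psir]; rewrite -lecR eE (le_trans _ psir)//.
    have /negP := ne phi; rewrite -real_ltNge ?(gtr0_real e0) ?normr_real//; exact: ltW.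
  rewrite fE v0; have [-> _ _] := scalarE (dual_scalarr VP psi).
  by rewrite normr0 => /(lt_le_trans e0); rewrite ltxx.
have small (e : C) : 0 < e -> exists N, pow2 C N < e by exact: pow2_small.
have Tsurj psi : exists phi, T phi = psi.
  (* The precision 2^-(k+1) makes successive images differ by at most 2^-k. As [T] does not shrink
     norms, [u] is itself fast Cauchy. *)
  have /choice[u uP] : forall k, exists phi, `|psi - T phi| <= pow2 C k.+1.
    by move=> k; apply: dense; exact: pow2_gt0.
  have [k|l lP] := @fast_complete_cvg _ (predual W) small u.
    rewrite (le_trans (nT _))// -TB -(subrKA psi) (le_trans (ler_normD _ _))//.
    have := lerD (uP k.+1) (uP k); rewrite [in X in X -> _]distrC => /le_trans; apply.
    rewrite !pow2S [leRHS]splitr lerD2r ler_piMr ?invf_le1 ?ler1n//.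
    by rewrite divr_ge0 ?pow2_ge0.
  exists l; apply/esym/eqP; rewrite -subr_eq0 -normr_le0; apply: le_eps => // e e0.
  have e2 := divr_gt0 e0 (ltr0n C 2).
  have [N1 N1P] := lP _ e2; have [N2 N2P] := small _ e2; set N := maxn N1 N2.
  rewrite add0r -(subrKA (T (u N))) (le_trans (ler_normD _ _))// [e]splitr lerD//.
    rewrite (le_trans (uP N))// (le_trans _ (ltW N2P))//.
    rewrite /pow2 lef_pV2 ?posrE ?exprn_gt0// ler_weXn2l ?ler1n//.
    by rewrite (leq_trans (leq_maxr N1 N2)).
  by rewrite TB (le_trans (TM _))// mul1r N1P// leq_maxl.
have /choice[Psi PsiE] : forall w, exists v, Phi v = w.
  move=> w; have [v _ <-] : range Phi w by rewrite Fsurj.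
  by exists v.
exists Psi; split.
- by move=> c x y; apply: Phi_inj; rewrite FL !PsiE.
- apply/contractiveP => n x; have /isometricP/(_ _ (map_mx Psi x)) := Fiso.
  rewrite -map_mx_comp (_ : map_mx _ x = x) => [->//|].
  by apply/matrixP => i j; rewrite mxE /= PsiE.
- apply/(weakstar_continuousP (pairing V) (Psi : wstar W -> V)) => psi.
  have [phi <-] := Tsurj psi.
  rewrite (_ : (fun w => _) = pairing W phi); last first.
    by apply/funext => w; rewrite TE PsiE.
  exact: (@weak_ev_continuous R (predual W) W (fun y x => pairing W x y) phi).
- by move=> a; apply: Phi_inj; rewrite PsiE FE.
Qed.

Lemma hldba_equivP V W : hldba_equiv V W <-> hldba_le V W /\ hldba_le W V.
Proof.
split=> [VW|[VW WV]]; last exact: hldba_le_anti.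
by split; [exact: hldba_equiv_le|case: VW => Phi [FP _ _ _]; exists Phi].
Qed.

Lemma hld_classP V W : hld_class V = hld_class W <-> hldba_equiv V W.
Proof.
split=> [/(congr1 sval)/= ->|].
  by apply/hldba_equivP; split; exact: hldba_le_refl.
move=> /hldba_equivP[VW WV].
have E : hldba_equiv V = hldba_equiv W.
  apply/funext => U; apply/propext; rewrite !hldba_equivP; split=> -[? ?]; split;
    by [exact: hldba_le_trans VW _|exact: hldba_le_trans WV _
       |exact: hldba_le_trans _ WV|exact: hldba_le_trans _ VW].
rewrite /hld_class; move: (ex_intro _ V _) (ex_intro _ W _); rewrite E => p q.
by congr exist; exact: Prop_irrelevance.
Qed.

Lemma hld_classE (p : HLD A) : exists V, p = hld_class V.
Proof.
case: p => P [V PV]; exists V; subst P; rewrite /hld_class.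
by congr exist; exact: Prop_irrelevance.
Qed.

Lemma hld_le_class V W : hld_le (hld_class V) (hld_class W) <-> hldba_le V W.
Proof.
split=> [[V' [W' [/= /hldba_equivP[VV' V'V] /hldba_equivP[WW' W'W] le]]]|le].
  exact: hldba_le_trans VV' (hldba_le_trans le W'W).
by exists V, W; split=> //=; apply/hldba_equivP; split; exact: hldba_le_refl.
Qed.

Lemma hld_partial_order : partial_order (@hld_le R s A).
Proof.
split=> [p|p q|p q r].
- by have [V ->] := hld_classE p; apply/hld_le_class; exact: hldba_le_refl.
- have [V ->] := hld_classE p; have [W ->] := hld_classE q.
  move=> /hld_le_class VW /hld_le_class WV; apply/hld_classP/hldba_equivP.
  by split.
- have [V ->] := hld_classE p; have [W ->] := hld_classE q; have [U ->] := hld_classE r.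
  by move=> /hld_le_class VW /hld_le_class WU; apply/hld_le_class/(hldba_le_trans VW).
Qed.

(* The elements of V, as functionals on the restrictions to A of the predual:
   this encodes V, up to equivalence, in a type that does not depend on V. *)
Definition hldba_rel V (v : V) : (A -> C) -> C -> Prop :=
  fun f c => exists phi, (forall a, f a = pairing V phi (eta V a)) /\ c = pairing V phi v.

(** Besides the elements, the code records the norms of all matrices over [V], from which
    contractivity is read off; the product is recovered from [A] by [hldba_map_hom]. *)
Definition hldba_code V : forall n, 'M[(A -> C) -> C -> Prop]_n -> C -> Prop :=
  fun n M c => exists v : 'M[V]_n, M = map_mx (@hldba_rel V) v /\ c = mnorm v.

Lemma hldba_rel_pairing V (v : V) phi : hldba_rel v (fun a => pairing V phi (eta V a)) (pairing V phi v).
Proof. by exists phi. Qed.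

Lemma predual_eta_inj V (phi psi : predual V) :
  (forall a, pairing V phi (eta V a) = pairing V psi (eta V a)) -> phi = psi.
Proof.
move=> E; apply/eqP; rewrite -subr_eq0; apply/eqP/eta_total => a.
have [_ D Z] := scalarE (dual_scalarl (pairing_dual V) (eta V a)).
by rewrite D -scaleN1r Z mulN1r E subrr.
Qed.

(** Equal codes match elements of [W] with elements of [V] that define the same relation. The domain
    of such a relation is the set of restrictions of the predual to [A], so the preduals are matched
    too, which yields linearity and weak*-continuity. *)
Lemma hldba_code_le V W : hldba_code V = hldba_code W -> hldba_le V W.
Proof.
move=> VW; have VP := pairing_dual V; have WP := pairing_dual W.
have relP (w : W) : exists v : V, hldba_rel v = hldba_rel w.
  have : hldba_code W (\matrix_(_ < 1, _ < 1) hldba_rel w) `|w|.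
    exists (\matrix_(_ < 1, _ < 1) w); rewrite mnorm_const1; split=> //.
    by apply/matrixP => i j; rewrite !mxE.
  rewrite -VW => -[v [/matrixP/(_ 0 0) + _]]; rewrite !mxE => e.
  by exists (v 0 0).
have /choice[Phi PhiE] := relP.
have predualP psi : exists phi, forall a, pairing V psi (eta V a) = pairing W phi (eta W a).
  have := hldba_rel_pairing (Phi 0) psi; rewrite PhiE => -[phi [phiE _]].
  by exists phi.
have pairE psi phi w : (forall a, pairing V psi (eta V a) = pairing W phi (eta W a)) ->
    pairing V psi (Phi w) = pairing W phi w.
  move=> E; have := hldba_rel_pairing (Phi w) psi; rewrite PhiE => -[phi' [phi'E ->]].
  by congr (pairing W _ w); apply: predual_eta_inj => a; rewrite -phi'E E.
exists Phi; split.
- move=> c x y; apply: (dual_inj VP) => psi; have [phi E] := predualP psi.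
  have [_ -> ->] := scalarE (dual_scalarr VP psi); rewrite !(pairE _ _ _ E).
  by have [_ -> ->] := scalarE (dual_scalarr WP phi).
- apply/contractiveP => n w.
  have : hldba_code W (map_mx (@hldba_rel W) w) (mnorm w) by exists w.
  rewrite -VW => -[v [E ->]].
  rewrite (_ : map_mx Phi w = v)//; apply/matrixP => i j; rewrite mxE.
  move/matrixP/(_ i j): E; rewrite !mxE -PhiE => E.
  apply: (dual_inj VP) => psi; have := hldba_rel_pairing (Phi (w i j)) psi.
  rewrite E => -[psi' [psi'E ->]]; congr (pairing V _ _).
  by apply: predual_eta_inj => a; rewrite -psi'E.
- apply/(weakstar_continuousP (pairing V) (Phi : wstar W -> V)) => psi.
  have [phi E] := predualP psi.
  rewrite (_ : (fun w => _) = pairing W phi); last by apply/funext => w; exact: pairE.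
  exact: (@weak_ev_continuous R (predual W) W (fun y x => pairing W x y) phi).
- by move=> a; apply: (dual_inj VP) => psi; have [phi E] := predualP psi; rewrite (pairE _ _ _ E).
Qed.

Lemma trivial_least V W : is_trivial V -> hldba_le V W.
Proof.
move=> V0; exists (fun=> 0); split.
- by move=> c x y; rewrite scaler0 addr0.
- apply/contractiveP => n x; rewrite (_ : map_mx _ x = 0) ?mnorm0 ?mnorm_ge0//.
  by apply/matrixP => i j; rewrite !mxE.
- by apply: (@cst_continuous (wstar W) (wstar V)).
- by move=> a; rewrite (V0 (eta V a)).
Qed.

End OrderTheory.

(** * The subdirect product *)

Lemma has_sum_finite (R : realType) (I : choiceType) (V : normedZmodType R[i]) (x : I -> V)
    (D : {fset I}) : (forall i, i \notin D -> x i = 0) -> has_sum x (partial_sum x D).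
Proof.
move=> xD e e0; exists D => B DB; rewrite (partial_sumD _ DB) addrAC subrr add0r.
rewrite partial_sumE big1_seq ?normr0 ?ltW// => i /=.
by rewrite in_fsetD => /andP[/xD].
Qed.

(** One finite set of indices serves finitely many families at once, here the entries of a
    matrix. *)
Lemma has_sum_finite_approx (R : realType) (I : choiceType) (J : eqType)
    (x : J -> I -> R[i]) (l : J -> R[i]) (r : seq J) (e : R[i]) :
  0 < e -> (forall j, has_sum (x j) (l j)) ->
  exists D, forall j, j \in r -> `|partial_sum (x j) D - l j| <= e.
Proof.
move=> e0 xl.
suff [D0 D0P] : exists D0, forall D, (D0 `<=` D)%fset ->
    forall j, j \in r -> `|partial_sum (x j) D - l j| <= e.
  by exists D0; exact: D0P.
elim: r => [|j r [A AP]]; first by exists fset0%fset.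
have [B BP] := xl j _ e0; exists (A `|` B)%fset => D; rewrite fsubUset => /andP[AD BD] k.
by rewrite in_cons => /orP[/eqP ->|kr]; [exact: BP|exact: AP].
Qed.

(** * The pairing of the l^1- and l^oo-sums *)

Section Families.
Variables (R : realType) (s : setting) (A : balgebra R s) (I : choiceType) (F : I -> hldba A).
Local Notation C := R[i].
Local Notation X := (fun i => predual (F i)).
Local Notation b i := (pairing (F i)).

(** Upper bounds are carried along in place of norms on the sums. As [l1] and [linf] have no
    operations, linear combinations appear below as componentwise hypotheses. *)
Definition l1_le (phi : forall i, predual (F i)) (M : C) : Prop :=
  forall D : {fset I}, partial_sum (fun i => `|phi i|) D <= M.

Definition linf_le (mu : forall i, F i) (M : C) : Prop := forall i, `|mu i| <= M.

Lemma l1_bounded (phi : l1 F) : exists M, l1_le (\val phi) M.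
Proof. exact: set_mem (valP phi). Qed.

Lemma linf_bounded (mu : linf F) : exists M, linf_le (\val mu) M.
Proof. exact: set_mem (valP mu). Qed.

Definition mk_l1 (phi : forall i, predual (F i)) (M : C) (h : l1_le phi M) : l1 F :=
  exist _ phi (mem_set (ex_intro _ M h)).

Definition mk_linf (mu : forall i, F i) (M : C) (h : linf_le mu M) : linf F :=
  exist _ mu (mem_set (ex_intro _ M h)).

Lemma linf_ext (mu nu : linf F) : (forall i, \val mu i = \val nu i) -> mu = nu.
Proof.
move=> E; apply: val_inj; apply: functional_extensionality_dep => i; exact: E.
Qed.

Lemma l1_le_ge0 phi M : l1_le phi M -> 0 <= M.
Proof. by move=> /(_ fset0%fset); apply: le_trans; rewrite /partial_sum sumr_ge0. Qed.

Lemma l1_le_entry phi M i : l1_le phi M -> `|phi i| <= M.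
Proof. by move=> /(_ [fset i]%fset); rewrite partial_sumE big_seq_fset1. Qed.

Lemma le_partial_sum (x y : I -> C) (D : {fset I}) :
  (forall i, x i <= y i) -> partial_sum x D <= partial_sum y D.
Proof. by move=> xy; rewrite /partial_sum ler_sum. Qed.

Lemma partial_sumM (x : I -> C) c (D : {fset I}) :
  partial_sum (fun i => c * x i) D = c * partial_sum x D.
Proof. by rewrite /partial_sum mulr_sumr. Qed.

Lemma l1_le_dominated (phi psi : forall i, predual (F i)) M c : 0 <= c -> l1_le phi M ->
  (forall i, `|psi i| <= c * `|phi i|) -> l1_le psi (c * M).
Proof.
move=> c0 pM psiphi D; apply: (le_trans (le_partial_sum D psiphi)).
by rewrite partial_sumM ler_wpM2l.
Qed.

Lemma l1_le_linear (phi psi : forall i, predual (F i)) (c M N : C) : l1_le phi M -> l1_le psi N ->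
  l1_le (fun i => c *: phi i + psi i) (`|c| * M + N).
Proof.
move=> pM pN D.
apply: (@le_trans _ _ (partial_sum (fun i => `|c| * `|phi i| + `|psi i|) D)).
  by apply: le_partial_sum => i; rewrite (le_trans (ler_normD _ _))// normrZ.
rewrite (_ : partial_sum _ D = `|c| * partial_sum (fun i => `|phi i|) D
    + partial_sum (fun i => `|psi i|) D); last first.
  by rewrite /partial_sum mulr_sumr -big_split.
by rewrite lerD// ler_wpM2l.
Qed.

Lemma l1_linf_summable (phi : forall i, predual (F i)) (mu : forall i, F i) M c :
  0 <= c -> l1_le phi M -> linf_le mu c ->
  forall D, partial_sum (fun i => `|b i (phi i) (mu i)|) D <= c * M.
Proof.
move=> c0 pM mc D.
apply: (@le_trans _ _ (partial_sum (fun i => c * `|phi i|) D)).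
  apply: le_partial_sum => i; rewrite (le_trans (dual_norm (pairing_dual (F i)) _ _))//.
  by rewrite mulrC ler_wpM2r.
by rewrite partial_sumM ler_wpM2l.
Qed.

Lemma linf_bounded_ge0 (mu : linf F) : exists2 M, 0 <= M & linf_le (\val mu) M.
Proof.
(* Over an empty index set the given bound may be any complex number; otherwise it dominates a norm
   and is nonnegative. *)
have [M MP] := linf_bounded mu; have [i|nI] := pselect (exists i : I, True); last first.
  by exists 0 => // i; exfalso; apply: nI; exists i.
by case: i => i _; exists M => //; exact: le_trans (MP i).
Qed.

Lemma l1_linf_has_sum (phi : l1 F) (mu : linf F) :
  has_sum (fun i => b i (\val phi i) (\val mu i)) (l1_linf phi mu).
Proof.
have [M MP] := l1_bounded phi; have [c c0 cP] := linf_bounded_ge0 mu.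
have [l lP] := abs_summable_has_sum (@complex_fast_complete R) (l1_linf_summable c0 MP cP).
by rewrite /l1_linf (has_sum_sum lP).
Qed.

Lemma l1_linf_eq (phi : l1 F) (mu : linf F) l :
  has_sum (fun i => b i (\val phi i) (\val mu i)) l -> l1_linf phi mu = l.
Proof. by move=> h; apply: has_sum_unique h; exact: l1_linf_has_sum. Qed.

Lemma l1_linf_linearl (phi psi chi : l1 F) (mu : linf F) (c : C) :
  (forall i, \val chi i = c *: \val phi i + \val psi i) ->
  l1_linf chi mu = c * l1_linf phi mu + l1_linf psi mu.
Proof.
move=> chiE; apply: l1_linf_eq.
rewrite (_ : (fun i => _) =
  (fun i => c *: (b i (\val phi i) (\val mu i) : C^o) + (b i (\val psi i) (\val mu i)))); last first.
  apply/funext => i; rewrite chiE.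
  by have [_ -> ->] := scalarE (dual_scalarl (pairing_dual (F i)) (\val mu i)).
exact: (@has_sum_linear _ _ C^o _ _ _ _ c (l1_linf_has_sum phi mu) (l1_linf_has_sum psi mu)).
Qed.

Lemma l1_linf_linearr (phi : l1 F) (mu nu rho : linf F) (c : C) :
  (forall i, \val rho i = c *: \val mu i + \val nu i) ->
  l1_linf phi rho = c * l1_linf phi mu + l1_linf phi nu.
Proof.
move=> rhoE; apply: l1_linf_eq.
rewrite (_ : (fun i => _) =
  (fun i => c *: (b i (\val phi i) (\val mu i) : C^o) + (b i (\val phi i) (\val nu i)))); last first.
  apply/funext => i; rewrite rhoE.
  by have [_ -> ->] := scalarE (dual_scalarr (pairing_dual (F i)) (\val phi i)).
exact: (@has_sum_linear _ _ C^o _ _ _ _ c (l1_linf_has_sum phi mu) (l1_linf_has_sum phi nu)).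
Qed.

Lemma eta_vee_le a : linf_le (fun i => eta (F i) a) `|a|.
Proof. by move=> i; apply: contractive_norm; exact: eta_contractive. Qed.

Definition eta_vee a : linf F := mk_linf (eta_vee_le a).

Lemma eta_vee_rangeE : @eta_vee_range R s A I F = range eta_vee.
Proof.
apply/seteqP; split=> [mu [a muE]|_ [a _ <-]]; last by exists a.
by exists a => //; apply: linf_ext => i; rewrite muE.
Qed.

Lemma coordinate_l1_proof i (phi : predual (F i)) :
  l1_le (@dfwith I (fun i => predual (F i)) (fun=> 0) i phi) `|phi|.
Proof.
move=> D; have [iD|iD] := boolP (i \in D).
  rewrite partial_sumE (big_fsetD1 i)//= dfwithin big1_seq ?addr0// => j.
  by rewrite in_fsetD1 => /andP[_ /andP[ji _]]; rewrite dfwithout ?normr0// eq_sym.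
rewrite partial_sumE big1_seq// => j /= jD.
by rewrite dfwithout ?normr0//; apply: contraNneq iD => ->.
Qed.

Definition coordinate_l1 i (phi : predual (F i)) : l1 F := mk_l1 (coordinate_l1_proof phi).

Lemma l1_linf_coordinate i (phi : predual (F i)) (mu : linf F) :
  l1_linf (coordinate_l1 phi) mu = b i phi (\val mu i).
Proof.
apply: l1_linf_eq; rewrite -{2}(dfwithin (fun i => 0 : predual (F i)) phi).
apply: (has_sum_single (x := fun j => b j (\val (coordinate_l1 phi) j) (\val mu j))) => j ji.
rewrite /= dfwithout 1?eq_sym//.
by have [] := scalarE (dual_scalarl (pairing_dual (F j)) (\val mu j)).
Qed.

(** Each coordinate contributes at most the norm of [phi] there, a scalar functional keeping its
    bound on matrices. The series is cut to a finite sum with error e / (n^2 + 1) at each of the n^2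
    entries. *)
Lemma linf_matrix_bound (phi : l1 F) M n (v : 'M[linf F]_n) :
  l1_le (\val phi) M -> (forall i, mnorm (map_mx (fun mu : linf F => \val mu i) v) <= 1) ->
  snorm s (map_mx (l1_linf phi) v) <= M.
Proof.
move=> pM v1; have M0 := l1_le_ge0 pM.
apply: le_eps => [||e e0]; rewrite ?ger0_real ?snorm_ge0//.
have n1 : 0 < (n * n)%:R + 1 :> C by rewrite ltr_wpDl.
have [D DP] := @has_sum_finite_approx R I ('I_n * 'I_n)%type
  (fun p i => b i (\val phi i) (\val (v p.1 p.2) i)) (fun p => l1_linf phi (v p.1 p.2))
  (enum [set: 'I_n * 'I_n]%SET) _ (divr_gt0 e0 n1) (fun p => l1_linf_has_sum phi (v p.1 p.2)).
pose P : 'M[C]_n := \sum_(i : D) map_mx (b (val i) (\val phi (val i)))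
   (map_mx (fun mu : linf F => \val mu (val i)) v).
have -> : map_mx (l1_linf phi) v = P + (map_mx (l1_linf phi) v - P) by rewrite addrC subrK.
rewrite (le_trans (snormD _ _ _))// lerD//.
  rewrite (le_trans (snorm_sum _ _ _ _))//; apply: le_trans (pM D).
  apply: ler_sum => i _; apply: le_trans (functional_matrix_bound
    (dual_scalarr (pairing_dual (F (val i))) _) (normr_ge0 _) _ _) _ => [y|].
    exact: dual_norm (pairing_dual _) _ _.
  by rewrite ler_piMr.
rewrite (le_trans (snorm_le_entries _ _))//.
apply: (@le_trans _ _ (\sum_(k < n) \sum_(l < n) e / ((n * n)%:R + 1))).
  apply: ler_sum => k _; apply: ler_sum => l _.
  have := DP (k, l); rewrite mem_enum inE => /(_ isT) /=.
  rewrite distrC; congr (`|_| <= _); rewrite !mxE; congr (_ - _).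
  by rewrite /P summxE /partial_sum; apply: eq_bigr => i _; rewrite !mxE.
rewrite !sumr_const !card_ord -mulrnA -[leLHS]mulr_natl.
by rewrite mul_div_succ_le// ltW.
Qed.

(** The bipolar theorem for a subspace: the weak*-closure of the image of [A] is the annihilator of
    its preannihilator. *)
Lemma closure_eta_veeP (mu : linf F) :
  closure (@eta_vee_range R s A I F : set (wprod F)) mu <->
  forall phi, (forall a, l1_linf phi (eta_vee a) = 0) -> l1_linf phi mu = 0.
Proof.
rewrite eta_vee_rangeE; split=> [clmu phi phi0|muP].
  apply/eqP/negPn/negP => nz; have n0 : 0 < `|l1_linf phi mu| by rewrite normr_gt0.
  have fc := @weak_ev_continuous R (l1 F) (linf F) (fun mu phi => l1_linf phi mu) phi.
  have /cvgrPdist_lt/(_ _ n0) nb := fc mu.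
  by have [_ [[a _ <-] /=]] := clmu _ nb; rewrite phi0 subr0 ltxx.
apply: contrapT => nmu.
pose G : set ((l1 F -> C) -> C) :=
  [set g | scalar g /\ exists phi, forall nu, g (fun psi => l1_linf psi nu) = l1_linf phi nu].
have [|||phi|g [[gL [phi gphi]] gS /eqP]] :=
  @weak_separation R (l1 F) (linf F) (fun mu phi => l1_linf phi mu) (range eta_vee) mu G _ _ _ _ nmu.
- split=> [g []//|a g k [gL [x gx]] [kL [z kz]]]; split.
    by move=> c u w; rewrite gL kL /GRing.scale/=; ring.
  have [M MP] := l1_bounded x; have [N NP] := l1_bounded z.
  exists (mk_l1 (l1_le_linear a MP NP)) => nu.
  by rewrite gx kz; apply/esym/l1_linf_linearl => i.
- have etaD c a a' i : eta (F i) (c *: a + a') = c *: eta (F i) a + eta (F i) a'.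
    by have [-> _] := eta_hom (F i).
  split.
    exists (eta_vee 0); first by exists 0.
    apply/funext => phi; rewrite (@l1_linf_linearr phi (eta_vee 0) (eta_vee 0) _ (-1)).
      by rewrite mulN1r addNr.
    by move=> i; rewrite /= -etaD scaler0 addr0.
  move=> c _ _ [_ [a _ <-] <-] [_ [a' _ <-] <-].
  exists (eta_vee (c *: a + a')); first by exists (c *: a + a').
  apply/funext => phi.
  by rewrite (@l1_linf_linearr phi (eta_vee a) (eta_vee a') _ c)// => i; exact: etaD.
- split=> [c u w|]; first by rewrite /= mulr0 addr0.
  have Z0 : l1_le (fun=> 0) 0.
    by move=> D; rewrite partial_sumE big1// => i _; rewrite normr0.
  exists (mk_l1 Z0) => nu; apply/esym/l1_linf_eq.
  rewrite (_ : (fun i => _) = (fun=> 0)).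
    by move=> e e0; exists fset0%fset => D _; rewrite partial_sumE big1// subrr normr0 ltW.
  by apply/funext => i; have [] := scalarE (dual_scalarl (pairing_dual (F i)) (\val nu i)).
- by split=> [c u w|]; [|exists phi].
- rewrite gphi; apply; apply: muP => a; rewrite -gphi; apply: gS.
  by exists a.
Qed.

End Families.

(** * The predual of the subdirect product *)

Section SubdirectPredual.
Variables (R : realType) (s : setting) (A : balgebra R s) (I : choiceType) (F : I -> hldba A).
Local Notation C := R[i].

Definition vee_set : set (linf F) := closure (@eta_vee_range R s A I F : set (wprod F)).

Definition vee := {mu : linf F | vee_set mu}.

Definition vee_coord i (w : vee) : F i := \val (sval w) i.

Lemma vee_coordE i (w : vee) : vee_coord i w = \val (sval w) i.
Proof. by []. Qed.

(** The unit ball of the matrix norm inherited from the product. Norming the predual by it is what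
    makes the inherited norm the dual one in [vee_mnormP]. *)
Definition vee_ball n : set 'M[vee]_n := [set w | forall i, mnorm (map_mx (vee_coord i) w) <= 1].

(** This is the quotient of the l^1-sum by the preannihilator of the closure: elements of the sum
    are identified when they agree as functions on the closure. *)
Definition vee_functionals : set (vee -> C) :=
  [set f | exists phi : l1 F, f = fun w => l1_linf phi (sval w)].

Lemma zero_l1_le : l1_le (fun i => 0 : predual (F i)) 0.
Proof. by move=> D; rewrite partial_sumE big1// => i _; rewrite normr0. Qed.

Lemma l1_linf0 (mu : linf F) : l1_linf (mk_l1 zero_l1_le) mu = 0.
Proof.
rewrite (@l1_linf_linearl _ _ _ _ F (mk_l1 zero_l1_le) (mk_l1 zero_l1_le) _ mu (-1)).
  by rewrite mulN1r addNr.
by move=> i /=; rewrite scaler0 addr0.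
Qed.

Lemma l1_linear (c : C) (phi psi : l1 F) :
  exists chi : l1 F, forall i, \val chi i = c *: \val phi i + \val psi i.
Proof.
have [M MP] := l1_bounded phi; have [N NP] := l1_bounded psi.
by exists (mk_l1 (l1_le_linear c MP NP)).
Qed.

Lemma vee_functionals_subspace : subspace vee_functionals.
Proof.
split; first by exists (mk_l1 zero_l1_le); apply/funext => w; rewrite l1_linf0.
move=> c _ _ [phi ->] [psi ->]; have [chi chiE] := l1_linear c phi psi.
by exists chi; apply/funext => w; rewrite (l1_linf_linearl _ chiE).
Qed.

Lemma vee_matrix_bound (phi : l1 F) M n (w : 'M[vee]_n) : l1_le (\val phi) M ->
  vee_ball w -> snorm s (map_mx (fun w => l1_linf phi (sval w)) w) <= M.
Proof.
move=> pM w1; rewrite (_ : map_mx _ w = map_mx (l1_linf phi) (map_mx sval w)).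
  by apply: linf_matrix_bound => // i; rewrite -map_mx_comp.
by apply/matrixP => i j; rewrite !mxE.
Qed.

Lemma vee_functionals_bounded f : vee_functionals f -> exists2 M, 0 <= M &
  forall n (w : 'M[vee]_n), vee_ball w -> snorm s (map_mx f w) <= M.
Proof.
move=> [phi ->]; have [M MP] := l1_bounded phi.
by exists M; [exact: l1_le_ge0 MP|move=> n w; exact: vee_matrix_bound].
Qed.

(** [vee] has no operations; scaling is what normalizing an element into [vee_ball] requires. *)
Lemma vee_scale (w : vee) (c : C) :
  exists w' : vee, forall i, vee_coord i w' = c *: vee_coord i w.
Proof.
have [M MP] := linf_bounded (sval w).
have cM : linf_le (fun i => c *: vee_coord i w) (`|c| * M).
  by move=> i; rewrite normrZ ler_wpM2l//; exact: MP.
suff H : vee_set (mk_linf cM) by exists (exist _ (mk_linf cM) H).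
apply/closure_eta_veeP => phi phi0.
rewrite -[RHS](mulr0 c) -((closure_eta_veeP (sval w)).1 (svalP w) phi phi0).
have Z : linf_le (fun i => 0 : F i) 0 by move=> i; rewrite normr0.
rewrite (@l1_linf_linearr _ _ _ _ F phi (sval w) (mk_linf Z) _ c).
  rewrite (@l1_linf_linearr _ _ _ _ F phi (mk_linf Z) (mk_linf Z) (mk_linf Z) (-1)).
    by rewrite mulN1r addNr addr0.
  by move=> i /=; rewrite scaler0 addr0.
by move=> i /=; rewrite addr0.
Qed.

Lemma vee_unit (w : vee) (M : C) : 0 < M -> linf_le (\val (sval w)) M ->
  exists w' : vee, (forall i, vee_coord i w' = M^-1 *: vee_coord i w) /\
    vee_ball (\matrix_(_ < 1, _ < 1) w').
Proof.
move=> M0 wM; have [w' w'E] := vee_scale w M^-1; exists w'; split=> // i.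
rewrite mnorm11 !mxE w'E normrZ normfV (gtr0_norm M0) ler_pdivrMl// mulr1.
exact: wM.
Qed.

Lemma l1_linf_vee_scale (phi : l1 F) (w w' : vee) (c : C) :
  (forall i, vee_coord i w' = c *: vee_coord i w) ->
  l1_linf phi (sval w') = c * l1_linf phi (sval w).
Proof.
move=> w'E; apply: l1_linf_eq.
rewrite (_ : (fun i => _) = (fun z => c * z) \o
    (fun i => pairing (F i) (\val phi i) (\val (sval w) i))).
  apply: (has_sum_bounded (c := `|c|)) (l1_linf_has_sum phi (sval w)) => [//|u v|v].
    by rewrite mulrBr.
  by rewrite normrM.
apply/funext => i /=; rewrite -[X in pairing _ _ X]/(vee_coord i w') w'E.
by have [_ _ ->] := scalarE (dual_scalarr (pairing_dual (F i)) (\val phi i)).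
Qed.

Lemma vee_bound (w : vee) : exists2 M, 0 < M & linf_le (\val (sval w)) M.
Proof.
have [M M0 MP] := linf_bounded_ge0 (sval w).
exists (M + 1); first by rewrite ltr_wpDl.
by move=> i; rewrite (le_trans (MP i))// lerDl.
Qed.

Lemma vee_functionals_separated f : vee_functionals f ->
  (forall n (w : 'M[vee]_n) i j, vee_ball w -> f (w i j) = 0) -> f = 0.
Proof.
move=> [phi ->] fB; apply/funext => w; have [M M0 MP] := vee_bound w.
have [w' [w'E w'1]] := vee_unit M0 MP.
have := fB _ _ 0 0 w'1; rewrite mxE (l1_linf_vee_scale _ w'E) => /eqP.
by rewrite mulf_eq0 invr_eq0 gt_eqF//= => /eqP.
Qed.

Definition vee_data : fundata R s :=
  FunData vee_functionals_subspace vee_functionals_bounded vee_functionals_separated.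

Definition vee_q0 (phi : l1 F) : funsp vee_data :=
  exist _ (fun w => l1_linf phi (sval w)) (ex_intro _ phi erefl).

Lemma vee_q0_surj (x : funsp vee_data) : exists phi, x = vee_q0 phi.
Proof. by case: x => f [phi fE]; exists phi; apply: funsp_inj. Qed.

Lemma vee_q0_norm (phi : l1 F) M : l1_le (\val phi) M -> `|vee_q0 phi| <= M.
Proof.
move=> pM; apply/fnorm1_le => [|n w w1]; first exact: l1_le_ge0 pM.
exact: vee_matrix_bound.
Qed.

Lemma vee_q0_linear (phi psi chi : l1 F) c :
  (forall i, \val chi i = c *: \val phi i + \val psi i) ->
  vee_q0 chi = c *: vee_q0 phi + vee_q0 psi.
Proof.
move=> chiE; apply: funspP => w; rewrite sval_funspD sval_funspZ.
exact: l1_linf_linearl chiE.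
Qed.

Lemma vee_q0_ext (phi psi : l1 F) :
  (forall a, l1_linf phi (eta_vee F a) = l1_linf psi (eta_vee F a)) -> vee_q0 phi = vee_q0 psi.
Proof.
move=> E; have [chi chiE] := l1_linear (-1) psi phi.
have chi0 a : l1_linf chi (eta_vee F a) = 0.
  by rewrite (l1_linf_linearl _ chiE) E mulN1r addNr.
apply: funspP => w /=; have := (closure_eta_veeP (sval w)).1 (svalP w) _ chi0.
by rewrite (l1_linf_linearl _ chiE) mulN1r addrC => /eqP; rewrite subr_eq0 => /eqP.
Qed.

(** [phi] is cut into its restriction [chi] to a large finite set and a small remainder [psi]. The
    coefficient 1 gives the decomposition the shape that [vee_q0_linear] takes. *)
Lemma l1_tail (phi : l1 F) (e : C) : 0 < e -> exists D0 : {fset I}, forall D, (D0 `<=` D)%fset ->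
  exists chi psi : l1 F,
  [/\ l1_le (\val psi) e, forall i, \val phi i = 1 *: \val psi i + \val chi i,
    forall i, i \notin D -> \val chi i = 0 & forall i, i \in D -> \val chi i = \val phi i].
Proof.
move=> e0; have [M MP] := l1_bounded phi.
have [D|D0 D0P] := @abs_summable_tail _ _ C (fun i => `|\val phi i|) M _ e e0.
  apply: le_trans (MP D); apply: le_partial_sum => i.
  by rewrite normr_id.
exists D0 => D D0D.
pose chi i := if i \in D then \val phi i else 0.
pose psi i := if i \in D then 0 else \val phi i.
have chiM : l1_le chi (1 * M).
  apply: l1_le_dominated MP _ => // i; rewrite mul1r /chi.
  by case: ifP => _ //; rewrite normr0.
have psie : l1_le psi e.
  move=> B; have BD : (B `&` D `<=` B)%fset by exact: fsubsetIl.
  rewrite (partial_sumD _ BD) [X in X + _](_ : _ = 0) ?add0r; last first.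
    rewrite partial_sumE big1_seq// => i /=; rewrite in_fsetI /psi => /andP[_ ->].
    by rewrite normr0.
  rewrite (_ : partial_sum _ _ = partial_sum (fun i => `| `|\val phi i| |) (B `\` (B `&` D))%fset).
    apply: D0P; apply/fdisjointP => i /(fsubsetP D0D) iD.
    by rewrite in_fsetD in_fsetI iD andbT andNb.
  rewrite !partial_sumE; apply: eq_big_seq => i; rewrite in_fsetD in_fsetI /psi normr_id.
  by case: (i \in B); case: (i \in D).
exists (mk_l1 chiM), (mk_l1 psie); split=> //= i; rewrite /chi /psi.
- by case: ifP => _; rewrite scale1r ?add0r ?addr0.
- by move/negPf ->.
- by move ->.
Qed.

Lemma vee_q0_finite (phi : l1 F) (D : {fset I}) : (forall i, i \notin D -> \val phi i = 0) ->
  vee_q0 phi = \sum_(i : D) vee_q0 (coordinate_l1 (\val phi (val i))).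
Proof.
move=> phiD; apply: funspP => w; rewrite sval_funsp_sum; apply: l1_linf_eq.
have := @has_sum_finite R I C (fun i => pairing (F i) (\val phi i) (\val (sval w) i)) D.
rewrite /partial_sum => h.
rewrite (eq_bigr (fun i : D => pairing (F (val i)) (\val phi (val i)) (\val (sval w) (val i)))).
  apply: h => i /phiD ->.
  by have [] := scalarE (dual_scalarl (pairing_dual (F i)) (\val (sval w) i)).
by move=> i _; rewrite /= l1_linf_coordinate.
Qed.

(* A functional bounded for the quotient norm of the l^1-sum is an element of
   the closure: it annihilates the kernel of the quotient map. *)
Lemma vee_functional_rep (f : funsp vee_data -> C) (M : C) : 0 <= M -> scalar f ->
  (forall phi r, l1_le (\val phi) r -> `|f (vee_q0 phi)| <= M * r) ->
  exists w : vee, [/\ forall phi, f (vee_q0 phi) = l1_linf phi (sval w),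
    forall i, `|vee_coord i w| <= M &
    forall i phi, pairing (F i) phi (vee_coord i w) = f (vee_q0 (coordinate_l1 phi))].
Proof.
move=> M0 fL fM; have [f0 fD fZ] := scalarE fL.
have coordL i c phi psi : vee_q0 (coordinate_l1 (c *: phi + psi : predual (F i))) =
    c *: vee_q0 (coordinate_l1 phi) + vee_q0 (coordinate_l1 psi).
  apply: funspP => w; rewrite sval_funspD sval_funspZ /= !l1_linf_coordinate.
  by have [_ -> ->] := scalarE (dual_scalarl (pairing_dual (F i)) (\val (sval w) i)).
have : forall i, exists v : F i, `|v| <= M /\
    forall phi, f (vee_q0 (coordinate_l1 phi)) = pairing (F i) phi v.
  move=> i; have [||phi|v vM vE] := @dual_rep_norm _ _ _ _ _ (pairing_dual (F i))
     (fun phi => f (vee_q0 (coordinate_l1 phi))) M.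
  - by move=> c phi psi; rewrite coordL fL.
  - by [].
  - by apply: fM; exact: coordinate_l1_proof.
  - by exists v.
move=> H; pose mu i := sval (cid (H i)).
have muM : linf_le mu M by move=> i; have [] := svalP (cid (H i)).
have muE i phi : pairing (F i) phi (mu i) = f (vee_q0 (coordinate_l1 phi)).
  by have [_ ->] := svalP (cid (H i)).
pose m := mk_linf muM.
have fE phi : f (vee_q0 phi) = l1_linf phi m.
  (* The coordinates of [mu] determine [f] on finite sums only. Splitting off a finite part of [phi]
     leaves a tail of l^1-norm at most e / (M + 1), on which |f| is at most e. *)
  apply/esym/l1_linf_eq => e e0; have M1 : 0 < M + 1 by rewrite ltr_wpDl.
  have [D0 D0P] := l1_tail phi (divr_gt0 e0 M1).
  exists D0 => D /D0P[chi [psi [psie phiE chi0 chiE]]].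
  rewrite (vee_q0_linear phiE) fD fZ mul1r (vee_q0_finite chi0).
  rewrite (big_morph f fD f0) (_ : partial_sum _ D =
      \sum_(i : D) f (vee_q0 (coordinate_l1 (\val chi (val i))))).
    rewrite opprD addrCA subrr addr0 normrN (le_trans (fM _ _ psie))//.
    by rewrite mul_div_succ_le// ltW.
  by apply: eq_bigr => i _; rewrite -muE chiE//; exact: valP.
have mV : vee_set m.
  apply/closure_eta_veeP => phi phi0; rewrite -fE.
  rewrite (_ : vee_q0 phi = vee_q0 (mk_l1 zero_l1_le)).
    rewrite (_ : vee_q0 _ = 0) ?f0//; apply: funspP => w; exact: l1_linf0.
  by apply: vee_q0_ext => a; rewrite phi0 l1_linf0.
by exists (exist _ m mV); split=> // i phi; rewrite -muE.
Qed.

End SubdirectPredual.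

(** * Completeness of the predual *)

Section SubdirectComplete.
Variables (R : realType) (s : setting) (A : balgebra R s) (I : choiceType) (F : I -> hldba A).
Local Notation C := R[i].
Local Notation T := (funsp (vee_data F)).

(* The dual norm of the predual is the quotient norm of the l^1-sum. *)
Lemma vee_lift (x : T) (c : C) : `|x| < c -> exists2 phi, x = vee_q0 phi & l1_le (\val phi) c.
Proof.
move=> xc; apply: contrapT => nlift.
have c0 : 0 < c by exact: le_lt_trans xc.
have cE := ReK (ltW c0).
pose Q (y : T) (r : R) := exists2 phi, y = vee_q0 phi & l1_le (\val phi) r%:C.
have [y|y r [phi _ pr]|y z r t [phi -> pr] [psi -> pt]|a y r [phi -> pr]|f [fL fQ fx]] :=
  @gauge_hahn_banach R T Q x.
- have [phi ->] := vee_q0_surj y; have [M MP] := l1_bounded phi.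
  by exists (complex.Re M), phi => //; rewrite ReK//; exact: l1_le_ge0 MP.
- by rewrite -ler0c; exact: l1_le_ge0 pr.
- exists (mk_l1 (l1_le_linear 1 pr pt)).
    by rewrite -{1}[vee_q0 phi]scale1r; apply/esym/vee_q0_linear => i.
  rewrite (_ : (r + t)%:C = `|1| * r%:C + t%:C); first exact: l1_le_linear.
  by rewrite normr1 mul1r rmorphD.
- exists (mk_l1 (l1_le_linear a pr (@zero_l1_le _ _ _ _ F))).
    rewrite -[LHS]addr0 (_ : 0 = vee_q0 (mk_l1 (@zero_l1_le _ _ _ _ F))).
      by apply/esym/vee_q0_linear => i.
    by apply: funspP => w; apply/esym; exact: l1_linf0.
  rewrite (_ : (complex.Re `|a| * r)%:C = `|a| * r%:C + 0).
    by apply: l1_le_linear => //; exact: zero_l1_le.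
  by rewrite addr0 rmorphM [X in X * _]ReK.
have fM phi r : l1_le (\val phi) r -> `|f (vee_q0 phi)| <= 1 * r.
  move=> pr; have r0 := l1_le_ge0 pr; rewrite mul1r -(ReK r0); apply: fQ.
  by exists phi => //; rewrite ReK.
(* The functional is an element [w] of the coordinatewise unit ball, so |f x| <= |x| < c. Without a
   lift bounded by c, every admissible bound at [x] would be at least c, and so would |f x|. *)
have [w [fE w1 _]] := vee_functional_rep ler01 fL fM.
have cx : c <= `|f x|.
  rewrite -cE; apply: fx => r [phi xE pr]; rewrite -lecR cE.
  rewrite real_leNgt ?(gtr0_real c0) ?(ger0_real (l1_le_ge0 pr))//; apply/negP => rc.
  by apply: nlift; exists phi => // D; exact: le_trans (pr D) (ltW rc).
have [phi xE] := vee_q0_surj x.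
have wB : vee_ball (\matrix_(_ < 1, _ < 1) w) by move=> i; rewrite mnorm11 !mxE.
have := (fnorm1_le x (fnorm_ge0 _)).1 (lexx _) _ _ wB.
rewrite snorm11 !mxE xE /= -fE -xE => h.
by have := lt_le_trans (le_lt_trans h xc) cx; rewrite ltxx.
Qed.

(** Increments of the sequence are lifted to the l^1-sum with geometric bounds and summed there
    coordinatewise; the image of the sum is the limit. *)
Lemma vee_complete : fast_complete T.
Proof.
move=> u uP.
(* Starting at index 1 gains a factor 2: [vee_lift] needs a strict inequality, and the increments
   are at most 2^-(k+1) < 2^-k. *)
have [phi0 phi0E] := vee_q0_surj (u 1%N).
have /choice[d dP] : forall k, exists d : l1 F,
    u k.+2 - u k.+1 = vee_q0 d /\ l1_le (\val d) (pow2 C k).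
  move=> k; have [|d dE dle] := @vee_lift (u k.+2 - u k.+1) (pow2 C k); last by exists d.
  by rewrite (le_lt_trans (uP _))// pow2S ltr_pdivrMr// ltr_pMr ?pow2_gt0// ltr1n.
pose S := fix S k i : predual (F i) :=
  if k is k'.+1 then \val (d k') i + S k' i else \val phi0 i.
have SS k i : S k.+1 i - S k i = \val (d k) i by rewrite /= addrK.
have small (e : C) : 0 < e -> exists N, pow2 C N < e by exact: pow2_small.
have Sfast i k : `|S k.+1 i - S k i| <= pow2 C k.
  by rewrite SS; apply: l1_le_entry; have [] := dP k.
have limP i : exists l, forall e, 0 < e -> exists N, forall k, (N <= k)%N -> `|S k i - l| <= e.
  exact: (fast_complete_cvg small (Sfast i)).
pose psi i := sval (cid (limP i)).
have psiP i : forall e, 0 < e -> exists N, forall k, (N <= k)%N -> `|S k i - psi i| <= e.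
  by rewrite /psi; case: cid.
(* The bound is uniform over the finite sets [r], so it survives the coordinatewise limit in
   [psile]. *)
have seqle k m (r : {fset I}) :
    partial_sum (fun i => `|S (k + m)%N i - S k i|) r <= 2 * pow2 C k - 2 * pow2 C (k + m).
  elim: m => [|m IH].
    rewrite addn0 subrr partial_sumE big1// => i _.
    by rewrite subrr normr0.
  rewrite addnS; have [_ dle] := dP (k + m)%N.
  apply: (@le_trans _ _ (partial_sum (fun i => `|\val (d (k + m)%N) i|) r +
      partial_sum (fun i => `|S (k + m)%N i - S k i|) r)).
    rewrite /partial_sum -big_split/=; apply: ler_sum => i _.
    by rewrite -(subrKA (S (k + m)%N (val i))) (le_trans (ler_normD _ _))// SS.
  apply: (le_trans (lerD (dle r) IH)).
  suff -> : pow2 C (k + m) + (2 * pow2 C k - 2 * pow2 C (k + m)) =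
    2 * pow2 C k - 2 * pow2 C (k + m).+1 by [].
  rewrite pow2S; have n2 : (2 : C) != 0 by [].
  by field.
have finlim (r : seq I) e : 0 < e -> exists N, forall k, (N <= k)%N ->
    \sum_(i <- r) `|S k i - psi i| <= e.
  elim: r e => [|i r IH] e e0; first by exists 0%N => k _; rewrite big_nil ltW.
  have e2 := divr_gt0 e0 (ltr0n C 2).
  have [N NP] := IH _ e2; have [M MP] := psiP i _ e2.
  exists (maxn N M) => k; rewrite geq_max => /andP[/NP h1 /MP h2].
  by rewrite big_cons [e]splitr lerD.
have psile k : l1_le (fun i => psi i - S k i) (2 * pow2 C k).
  move=> D; apply: le_eps => [||e e0].
  - by rewrite ger0_real// /partial_sum sumr_ge0.
  - by rewrite ger0_real// mulr_ge0// pow2_ge0.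
  have [N NP] := finlim D e e0; set m := maxn N k.
  have km : (k <= m)%N by rewrite leq_maxr.
  apply: (@le_trans _ _ (partial_sum (fun i => `|S m i - S k i|) D +
      partial_sum (fun i => `|S m i - psi i|) D)).
    rewrite /partial_sum -big_split/=; apply: ler_sum => i _.
    rewrite addrC -(subrKA (S m (val i))) (le_trans (ler_normD _ _))// lerD2r.
    by rewrite distrC.
  rewrite lerD//; last by rewrite partial_sumE NP// leq_maxl.
  have := seqle k (m - k)%N D; rewrite subnKC// => /le_trans; apply.
  by rewrite gerBl mulr_ge0// pow2_ge0.
have [M0 M0P] := l1_bounded phi0.
have psiM : l1_le psi (`|1| * (2 * pow2 C 0) + M0).
  move=> D; have := l1_le_linear 1 (psile 0%N) M0P D; apply: le_trans.
  by apply: le_partial_sum => i; rewrite scale1r subrK.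
pose Psi := mk_l1 psiM.
have Sbound k : exists M, l1_le (S k) M.
  elim: k => [|k [M MP]]; first by exists M0.
  have [_ dle] := dP k; exists (`|1| * pow2 C k + M) => D.
  have := l1_le_linear 1 dle MP D; apply: le_trans.
  by apply: le_partial_sum => i; rewrite scale1r.
have Sq k : exists2 sk : l1 F, \val sk = S k & vee_q0 sk = u k.+1.
  elim: k => [|k [sk skE qk]]; first by exists phi0.
  have [M MP] := Sbound k.+1; exists (mk_l1 MP) => //.
  rewrite (@vee_q0_linear _ _ _ _ _ (d k) sk (mk_l1 MP) 1); last first.
    by move=> i; rewrite scale1r skE.
  by have [<- _] := dP k; rewrite scale1r qk subrK.
exists (vee_q0 Psi) => e e0; have [N NP] := small _ (divr_gt0 e0 (ltr0n C 2)).
exists N.+1 => -[//|k]; rewrite ltnS => Nk; have [sk skE <-] := Sq k.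
rewrite distrC; pose chi := mk_l1 (psile k).
have -> : vee_q0 Psi - vee_q0 sk = vee_q0 chi.
  rewrite (@vee_q0_linear _ _ _ _ _ sk Psi chi (-1)); first by rewrite scaleN1r addrC.
  by move=> i; rewrite scaleN1r addrC skE.
rewrite (le_trans (@vee_q0_norm _ _ _ _ _ chi _ (psile k)))// mulrC -ler_pdivlMr// (le_trans _ (ltW NP))//.
by rewrite /pow2 lef_pV2 ?posrE ?exprn_gt0// ler_weXn2l ?ler1n.
Qed.

End SubdirectComplete.

Lemma subdirect_normP (R : realType) (s : setting) (V : space R s) (I : Type)
    (W : I -> space R s) (g : forall i, V -> W i) :
  (match s with
  | Banach => forall (v : V) (c : R[i]), 0 <= c -> `|v| <= c <-> forall i, `|g i v| <= c
  | Operator => forall n (v : 'M[V]_n) (c : R[i]), 0 <= c ->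
      mxnorm v <= c <-> forall i, mxnorm (map_mx (g i) v) <= c
  end) <->
  forall n (v : 'M[V]_n) (c : R[i]), 0 <= c ->
    mnorm v <= c <-> forall i, mnorm (map_mx (g i) v) <= c.
Proof.
rewrite /mnorm; case: s V W g => V W g //; split=> [gP n v c c0|gP v c c0].
  split=> [/(entnorm_le v c0) vc i|vc].
    by apply/entnorm_le => // k l; rewrite mxE; exact: (gP _ _ c0).1 (vc k l) i.
  apply/entnorm_le => // k l; apply/gP => // i.
  by have /(entnorm_le _ c0)/(_ k l) := vc i; rewrite mxE.
have := gP _ (\matrix_(_ < 1, _ < 1) v) c c0; rewrite entnorm11 mxE => ->.
by split=> vc i; have := vc i; rewrite entnorm11 !mxE.
Qed.

Lemma mul_preadjointl (R : realType) (s : setting) (A : balgebra R s) (V : hldba A) (nu : V) :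
  exists2 T : predual V -> predual V, forall phi v, pairing V (T phi) v = pairing V phi (mul v nu) &
    forall phi, `|T phi| <= `|nu| * `|phi|.
Proof.
have VP := pairing_dual V.
have [||T TE TM] := @weakstar_preadjoint _ _ _ _ _ _ _ _ (fun mu => mul mu nu) `|nu| VP VP
    (@mul_linearl _ _ _ _) (@mul_weakstar _ _ _ V nu).
- by [].
- by move=> v; rewrite mulrC; apply: norm_contractive2; exact: mul_contractive.
- by exists T.
Qed.

(** Weak*-continuity of a left multiplication comes from the topological centre, whence the factor
    from [A]; in [mul_preadjointl] the factor is arbitrary. *)
Lemma mul_preadjointr (R : realType) (s : setting) (A : balgebra R s) (V : hldba A) (a : A) :
  exists2 T : predual V -> predual V,
    forall phi v, pairing V (T phi) v = pairing V phi (mul (eta V a) v) &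
    forall phi, `|T phi| <= `|a| * `|phi|.
Proof.
have VP := pairing_dual V.
have ac : continuous ((fun nu => mul (eta V a) nu) : weakstar (pairing V) -> weakstar (pairing V)).
  by have := @eta_centre _ _ _ V; apply; exists a.
have [||T TE TM] := @weakstar_preadjoint _ _ _ _ _ _ _ _ (fun nu => mul (eta V a) nu) `|a| VP VP
    (@mul_linearr _ _ _ _) ac.
- by [].
- move=> v; apply: (le_trans (norm_contractive2 _ _ (@mul_contractive _ _ _))).
  by rewrite ler_wpM2r// contractive_norm//; exact: eta_contractive.
- by exists T.
Qed.

(** * Duality and product on the subdirect product *)

Section SubdirectAlgebra.
Variables (R : realType) (s : setting) (A : balgebra R s) (I : choiceType) (F : I -> hldba A).
Local Notation C := R[i].

Definition vee_predual : space R s := funspace (@vee_complete _ _ _ _ F).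
Definition vee_dual : space R s := dual_space vee_predual.
Local Notation X := vee_predual.
Local Notation Y := vee_dual.
Local Notation b := (@dual_pairing R s vee_predual).

Definition vee_q (phi : l1 F) : X := vee_q0 phi.

Let bP : is_dual b := dual_spaceP X.

Lemma vee_q_surj (x : X) : exists phi, x = vee_q phi.
Proof. exact: vee_q0_surj x. Qed.

Lemma vee_injection_linear i : linear (fun phi : predual (F i) => vee_q (coordinate_l1 phi)).
Proof.
move=> c phi psi; apply: (@funspP _ _ (vee_data F)) => w.
rewrite (@sval_funspD _ _ (vee_data F)) (@sval_funspZ _ _ (vee_data F)) /= !l1_linf_coordinate.
by have [_ -> ->] := scalarE (dual_scalarl (pairing_dual (F i)) (\val (sval w) i)).
Qed.

Lemma vee_injection_contractive i :
  contractive (fun phi : predual (F i) => vee_q (coordinate_l1 phi)).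
Proof.
apply/contractiveP => n phi; rewrite funspace_mnorm.
apply/fnorm_le => [|m w w1]; first exact: mnorm_ge0.
rewrite (_ : amplify _ _ _ = amplify (fun v psi => pairing (F i) psi v)
    (map_mx (vee_coord i) w) phi); last first.
  by apply/matrixP => p q; rewrite !mxE /funev /= l1_linf_coordinate.
rewrite snorm_amplify_swap (le_trans (dual_mnorm (pairing_dual (F i)) _ _))//.
by rewrite ler_piMl ?mnorm_ge0//; exact: w1.
Qed.

(** The coordinate projection, obtained as the adjoint of the i-th injection of preduals; linearity
    and contractivity come with [adjoint_map]. *)
Definition vee_pi i : Y -> F i := sval (cid (adjoint_map bP (pairing_dual (F i))
  (@vee_injection_linear i) (@vee_injection_contractive i))).

Lemma vee_piE i y phi : pairing (F i) phi (vee_pi i y) = b (vee_q (coordinate_l1 phi)) y.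
Proof. by rewrite /vee_pi; case: cid => Phi [/= PhiE _ _ _]; rewrite PhiE. Qed.

Lemma vee_pi_linear i : linear (vee_pi i).
Proof. by rewrite /vee_pi; case: cid => Phi []. Qed.

Lemma vee_pi_contractive i : contractive (vee_pi i).
Proof. by rewrite /vee_pi; case: cid => Phi []. Qed.

Lemma vee_pi_le (y : Y) : linf_le (fun i => vee_pi i y) `|y|.
Proof. by move=> i; apply: contractive_norm; exact: vee_pi_contractive. Qed.

Definition vee_J (y : Y) : linf F := mk_linf (vee_pi_le y).

Lemma vee_J_rep (y : Y) : vee_set (vee_J y) /\
  forall phi, b (vee_q phi) y = l1_linf phi (vee_J y).
Proof.
have [|||w [wE _ w_pi]] := @vee_functional_rep _ _ _ _ F (fun x => b x y) `|y|.
- by [].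
- exact: (dual_scalarl bP y).
- move=> phi r pr; rewrite (le_trans (dual_norm bP _ _))// mulrC ler_wpM2l//.
  exact: vee_q0_norm.
- suff E : sval w = vee_J y by rewrite -E; split; [exact: svalP w|exact: wE].
  apply: linf_ext => i; apply: (dual_inj (pairing_dual (F i))) => phi.
  by rewrite -vee_coordE w_pi vee_piE.
Qed.

Lemma vee_pairing phi y : b (vee_q phi) y = l1_linf phi (vee_J y).
Proof. by have [] := vee_J_rep y. Qed.

Lemma vee_dual_ext (y z : Y) : (forall i, vee_pi i y = vee_pi i z) -> y = z.
Proof.
move=> E; apply: (dual_inj bP) => x; have [phi ->] := vee_q_surj x.
by rewrite !vee_pairing; congr l1_linf; exact: linf_ext.
Qed.

(** Evaluation at [w] is a bounded functional on the predual, because a positive multiple of [w]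
    lies in the ball on which the predual is normed. *)
Lemma vee_J_surj (w : vee F) : exists y : Y, forall i, vee_pi i y = vee_coord i w.
Proof.
have [M M0 MP] := vee_bound w; have [w' [w'E w'1]] := vee_unit M0 MP.
pose f (x : X) := sval (x : funsp (vee_data F)) w.
have fL : scalar f.
  move=> c x y; rewrite /f (@sval_funspD _ _ (vee_data F)).
  by rewrite (@sval_funspZ _ _ (vee_data F)).
have fM x : `|f x| <= M * `|x|.
  have [phi xE] := vee_q_surj x.
  have := (fnorm1_le (x : funsp (vee_data F)) (fnorm_ge0 _)).1 (lexx _) _ _ w'1.
  rewrite snorm11 !mxE /f xE /= (l1_linf_vee_scale _ w'E) normrM normfV (gtr0_norm M0).
  by rewrite mulrC ler_pdivrMr// mulrC.
have [y yE] := dual_rep bP fL (ltW M0) fM; exists y => i.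
apply: (dual_inj (pairing_dual (F i))) => phi.
by rewrite vee_piE -yE /f /= l1_linf_coordinate.
Qed.

(** If all coordinates have norm at most c, dividing by c + e gives a matrix over the closure lying
    in [vee_ball], where the norms of predual matrices are tested. The extra e keeps the divisor
    positive for c = 0. *)
Lemma vee_mnormP n (y : 'M[Y]_n) (c : C) : 0 <= c ->
  mnorm y <= c <-> forall i, mnorm (map_mx (vee_pi i) y) <= c.
Proof.
move=> c0; split=> [yc i|yc].
  apply: le_trans yc; have /contractiveP := @vee_pi_contractive i; exact.
apply: le_eps => [||e e0]; rewrite ?ger0_real ?mnorm_ge0//.
have d0 : 0 < c + e by rewrite ltr_wpDl.
apply/(dual_mnormP bP) => [|m x]; first exact: ltW.
have /choice[w wE] : forall y : Y, exists w : vee F, forall i,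
    vee_coord i w = (c + e)^-1 *: vee_pi i y.
  move=> z; have [zV _] := vee_J_rep z.
  by have [w wE] := vee_scale (exist _ (vee_J z) zV) (c + e)^-1; exists w.
have wB : vee_ball (map_mx w y).
  move=> i; rewrite (_ : map_mx _ _ = map_mx ( *:%R (c + e)^-1) (map_mx (vee_pi i) y)).
    rewrite mnormZ normfV (gtr0_norm d0) ler_pdivrMl// mulr1.
    by rewrite (le_trans (yc i))// lerDl ltW.
  by apply/matrixP => k l; rewrite !mxE wE.
have := @fnorm_ub _ _ (vee_data F) _ _ _ (x : 'M[funsp (vee_data F)]_m) wB.
rewrite -funspace_mnorm => xw.
rewrite -snorm_amplify_swap (_ : amplify _ _ _ =
    (c + e) *: amplify (@funev _ _ (vee_data F)) (map_mx w y) x).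
  by rewrite snormZ (gtr0_norm d0) ler_pM2l.
apply/matrixP => p q; rewrite !mxE.
set y' := y _ _; set x' := x _ _; have [phi ->] := vee_q_surj x'.
have [yV _] := vee_J_rep y'.
rewrite vee_pairing /funev /= (@l1_linf_vee_scale _ _ _ _ _ phi (exist _ (vee_J y') yV) (w y') _ (wE y')).
by rewrite mulrA mulfV ?gt_eqF// mul1r.
Qed.

Lemma vee_eta_exists : exists h : A -> Y, forall a i, vee_pi i (h a) = eta (F i) a.
Proof.
suff /choice[h hP] : forall a, exists y : Y, forall i, vee_pi i y = eta (F i) a by exists h.
move=> a; have aV : vee_set (eta_vee F a).
  by apply: subset_closure; exists a.
by have [y yE] := vee_J_surj (exist _ _ aV); exists y.
Qed.

Definition vee_eta : A -> Y := sval (cid vee_eta_exists).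

Lemma vee_pi_eta a i : vee_pi i (vee_eta a) = eta (F i) a.
Proof. by rewrite /vee_eta; case: cid. Qed.

Lemma vee_J_eta a : vee_J (vee_eta a) = eta_vee F a.
Proof. by apply: linf_ext => i; exact: vee_pi_eta. Qed.

Lemma vee_eta_linear : linear vee_eta.
Proof.
move=> c a a'; apply: vee_dual_ext => i; rewrite vee_pi_linear !vee_pi_eta.
by have [-> _] := eta_hom (F i).
Qed.

Lemma vee_eta_contractive : contractive vee_eta.
Proof.
apply/contractiveP => n a; apply/vee_mnormP => [|i]; first exact: mnorm_ge0.
rewrite -map_mx_comp (_ : map_mx _ a = map_mx (eta (F i)) a).
  by have /contractiveP := @eta_contractive _ _ _ (F i); exact.
by apply/matrixP => k l; rewrite !mxE /= vee_pi_eta.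
Qed.

Lemma vee_eta_sep x x' : (forall a, b x (vee_eta a) = b x' (vee_eta a)) -> x = x'.
Proof.
have [phi ->] := vee_q_surj x; have [psi ->] := vee_q_surj x' => E.
by apply: vee_q0_ext => a; rewrite -!vee_J_eta -!vee_pairing E.
Qed.

Lemma vee_prod_le (y z : Y) : linf_le (fun i => mul (vee_pi i y) (vee_pi i z)) (`|y| * `|z|).
Proof.
move=> i; apply: (le_trans (norm_contractive2 _ _ (@mul_contractive _ _ _))).
by rewrite ler_pM// vee_pi_le.
Qed.

Definition vee_prod (y z : Y) : linf F := mk_linf (vee_prod_le y z).

(** The preadjoints of the right multiplications by the coordinates of [nu] share the bound |nu|, so
    applied coordinatewise they preserve the l^1-sum. The explicit bound is needed to define the
    product. *)
Lemma vee_lmul_exists (nu : Y) (phi : l1 F) : exists psi : l1 F,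
  (forall y, b (vee_q psi) y = l1_linf phi (vee_prod y nu)) /\
  forall r, l1_le (\val phi) r -> l1_le (\val psi) (`|nu| * r).
Proof.
pose T i := sval (cid2 (mul_preadjointl (vee_pi i nu))).
have TE i psi v : pairing (F i) (T i psi) v = pairing (F i) psi (mul v (vee_pi i nu)).
  by rewrite /T; case: cid2 => /= T' ->.
have Tle r : l1_le (\val phi) r -> l1_le (fun i => T i (\val phi i)) (`|nu| * r).
  move=> pr; apply: l1_le_dominated pr _ => // i; rewrite /T; case: cid2 => /= T' _ T'M.
  by rewrite (le_trans (T'M _))// ler_wpM2r// vee_pi_le.
have [M MP] := l1_bounded phi; exists (mk_l1 (Tle _ MP)); split=> // y.
rewrite vee_pairing; apply: l1_linf_eq.
rewrite (_ : (fun i => _) = (fun i => pairing (F i) (\val phi i) (\val (vee_prod y nu) i))).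
  exact: l1_linf_has_sum.
by apply/funext => i; rewrite /= TE.
Qed.

Lemma vee_rmul_exists (a : A) (phi : l1 F) : exists psi : l1 F,
  forall y, b (vee_q psi) y = l1_linf phi (vee_prod (vee_eta a) y).
Proof.
pose T i := sval (cid2 (@mul_preadjointr _ _ _ (F i) a)).
have TE i psi v : pairing (F i) (T i psi) v = pairing (F i) psi (mul (eta (F i) a) v).
  by rewrite /T; case: cid2 => /= T' ->.
have [M MP] := l1_bounded phi.
have Tle : l1_le (fun i => T i (\val phi i)) (`|a| * M).
  by apply: l1_le_dominated MP _ => // i; rewrite /T; case: cid2.
exists (mk_l1 Tle) => y; rewrite vee_pairing; apply: l1_linf_eq.
rewrite (_ : (fun i => _) =
    (fun i => pairing (F i) (\val phi i) (\val (vee_prod (vee_eta a) y) i))).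
  exact: l1_linf_has_sum.
by apply/funext => i; rewrite /= TE vee_pi_eta.
Qed.

Lemma vee_prod_eta a a' : vee_prod (vee_eta a) (vee_eta a') = eta_vee F (mul a a').
Proof.
apply: linf_ext => i; rewrite /= !vee_pi_eta.
by have [_ ->] := eta_hom (F i).
Qed.

Lemma vee_mul_exists : exists (rdot : X -> A -> X) (L : Y -> X -> X) (m : Y -> Y -> Y),
  [/\ forall x a a', b (rdot x a) (vee_eta a') = b x (vee_eta (mul a a')),
    forall nu x a, b (L nu x) (vee_eta a) = b (rdot x a) nu,
    forall mu nu x, b x (m mu nu) = b (L nu x) mu &
    forall mu nu i, vee_pi i (m mu nu) = mul (vee_pi i mu) (vee_pi i nu)].
Proof.
have /choice[rep repE] := vee_q_surj.
have /choice[Lo LoP] : forall p, exists psi : l1 F,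
    (forall y, b (vee_q psi) y = l1_linf p.2 (vee_prod y p.1)) /\
    forall r, l1_le (\val p.2) r -> l1_le (\val psi) (`|p.1| * r).
  by move=> [nu phi]; exact: vee_lmul_exists.
have /choice[Ro RoE] : forall p, exists psi : l1 F,
    forall y, b (vee_q psi) y = l1_linf p.2 (vee_prod (vee_eta p.1) y).
  by move=> [a phi]; exact: vee_rmul_exists.
(* The representative of [x] in the l^1-sum is an arbitrary choice; [rdotq] and [Lq] show
   independence of it, because the image of [A] separates the predual. *)
pose rdot x a := vee_q (Ro (a, rep x)); pose L nu x := vee_q (Lo (nu, rep x)).
have rdotE x a a' : b (rdot x a) (vee_eta a') = b x (vee_eta (mul a a')).
  by rewrite RoE/= vee_prod_eta {2}(repE x) vee_pairing vee_J_eta.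
have LE nu x a : b (L nu x) (vee_eta a) = b (rdot x a) nu.
  by rewrite (LoP _).1 RoE.
have rdotq phi a : rdot (vee_q phi) a = vee_q (Ro (a, phi)).
  apply: vee_eta_sep => a'; rewrite rdotE RoE/= vee_prod_eta.
  by rewrite vee_pairing vee_J_eta.
have Lq nu phi : L nu (vee_q phi) = vee_q (Lo (nu, phi)).
  by apply: vee_eta_sep => a; rewrite LE rdotq RoE (LoP _).1.
have rdotL a c x x' : rdot (c *: x + x') a = c *: rdot x a + rdot x' a.
  apply: vee_eta_sep => a'.
  have [_ D Z] := scalarE (dual_scalarl bP (vee_eta a')); rewrite D Z !rdotE.
  by have [_ -> ->] := scalarE (dual_scalarl bP (vee_eta (mul a a'))).
have LL nu c x x' : L nu (c *: x + x') = c *: L nu x + L nu x'.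
  apply: vee_eta_sep => a; transitivity (b (rdot (c *: x + x') a) nu); first exact: LE.
  have [_ D Z] := scalarE (dual_scalarl bP (vee_eta a)).
  rewrite rdotL D Z (LE nu x a) (LE nu x' a).
  by have [_ -> ->] := scalarE (dual_scalarl bP nu).
(* The bound on [L] is known in terms of l^1-bounds of representatives, which is the form of
   boundedness that [vee_functional_rep] takes. It also places the product in the closure. *)
have mP p : exists z : Y, forall x, b x z = b (L p.2 x) p.1.
  case: p => mu nu /=.
  have [||phi r pr|w [wE _ _]] := @vee_functional_rep _ _ _ _ F (fun x => b (L nu x) mu)
      (`|mu| * `|nu|).
  - by rewrite mulr_ge0.
  - by move=> c x x'; rewrite LL; exact: (dual_scalarl bP mu).
  - rewrite -[vee_q0 phi]/(vee_q phi) Lq (le_trans (dual_norm bP _ _))// mulrC -mulrA ler_wpM2l//.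
    by apply: vee_q0_norm; have [_] := LoP (nu, phi); apply.
  - have [z zE] := vee_J_surj w; exists z => x; have [phi ->] := vee_q_surj x.
    transitivity (l1_linf phi (sval w)); last exact: esym (wE phi).
    by rewrite vee_pairing; congr l1_linf; apply: linf_ext => i; rewrite /= zE.
have /choice[m mE] := mP.
exists rdot, L, (fun mu nu => m (mu, nu)); split=> // mu nu i.
apply: (dual_inj (pairing_dual (F i))) => phi.
by rewrite vee_piE mE/= Lq (LoP _).1/= l1_linf_coordinate.
Qed.

Theorem subdirect_exists : exists V, is_subdirect F V.
Proof.
have [rdot [L [m [rdotE LE mE m_pi]]]] := vee_mul_exists.
have mC : contractive2 m.
  apply/contractive2P => r t y z; apply/vee_mnormP => [|i].
    by rewrite mulr_ge0 ?mnorm_ge0.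
  rewrite (_ : map_mx _ _ = amplify (@mul _ _ (F i)) (map_mx (vee_pi i) y) (map_mx (vee_pi i) z)).
    have /contractive2P h := @mul_contractive _ _ (F i).
    rewrite (le_trans (h _ _ _ _))// ler_pM ?mnorm_ge0//;
      by have /contractiveP := @vee_pi_contractive i; exact.
  by apply/matrixP => p q; rewrite !mxE m_pi.
have h_total x : (forall a, b x (vee_eta a) = 0) -> x = 0.
  move=> x0; apply: vee_eta_sep => a; rewrite x0.
  by have [-> _ _] := scalarE (dual_scalarl bP (vee_eta a)).
exists (introverted_hldba bP vee_eta_linear vee_eta_contractive h_total rdotE LE mE mC).
exists vee_J, vee_q; split.
- move=> i; split; first exact: vee_pi_linear.
  by move=> y z /=; rewrite m_pi.
- by move=> a i; exact: vee_pi_eta.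
- apply/seteqP; split=> [_ [y _ <-]|w wV]; first by have [] := vee_J_rep y.
  have [y yE] := vee_J_surj (exist _ w wV); exists y => //.
  by apply: linf_ext => i; rewrite /= yE.
- by apply/(@subdirect_normP _ _ vee_dual I (fun i => F i) (fun i v => vee_pi i v)); exact: vee_mnormP.
- split; last exact: vee_pairing.
  by apply/seteqP; split=> // x _; have [phi ->] := vee_q_surj x; exists phi.
Qed.

End SubdirectAlgebra.

(** * The least upper bound property *)

Section SubdirectSup.
Variables (R : realType) (s : setting) (A : balgebra R s) (I : choiceType) (F : I -> hldba A).
Variables (V : hldba A) (J : V -> linf F) (q : l1 F -> predual V).
Local Notation C := R[i].
Hypothesis J_hom : forall i, algebra_hom (fun v => \val (J v) i).
Hypothesis J_eta : forall a i, \val (J (eta V a)) i = eta (F i) a.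
Hypothesis J_range : range J = closure (@eta_vee_range R s A I F : set (wprod F)).
Hypothesis J_norm : forall n (v : 'M[V]_n) (c : C), 0 <= c ->
  mnorm v <= c <-> forall i, mnorm (map_mx (fun x => \val (J x) i) v) <= c.
Hypothesis q_surj : range q = setT.
Hypothesis qE : forall phi v, pairing V (q phi) v = l1_linf phi (J v).

Lemma subdirect_upper i : hldba_le (F i) V.
Proof.
exists (fun v => \val (J v) i); split=> //.
- by have [] := J_hom i.
- apply/contractiveP => n v; move: i.
  exact: (J_norm v (mnorm_ge0 v)).1 (lexx _).
- apply/(weakstar_continuousP (pairing (F i)) ((fun v => \val (J v) i) : wstar V -> F i)) => phi.
  rewrite (_ : (fun v => _) = pairing V (q (coordinate_l1 phi))).
    exact: (@weak_ev_continuous R (predual V) V (fun y x => pairing V x y)).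
  by apply/funext => v; rewrite qE l1_linf_coordinate.
Qed.

Lemma subdirect_J_inj v v' : J v = J v' -> v = v'.
Proof.
move=> E; apply: (dual_inj (pairing_dual V)) => x.
have [phi _ <-] : range q x by rewrite q_surj.
by rewrite !qE E.
Qed.

Lemma subdirect_lub (Z : hldba A) : (forall i, hldba_le (F i) Z) -> hldba_le V Z.
Proof.
move=> FZ; pose Phi i := sval (cid (FZ i)).
have PhiP i : hldba_map (Phi i) by rewrite /Phi; case: cid.
have Phi_le z : linf_le (fun i => Phi i z) `|z|.
  by move=> i; have [_ PC _ _] := PhiP i; exact: contractive_norm.
pose mu z := mk_linf (Phi_le z).
have ZP := pairing_dual Z.
have TP i : exists2 T : predual (F i) -> predual Z,
    forall phi z, pairing Z (T phi) z = pairing (F i) phi (Phi i z) &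
    forall phi, `|T phi| <= 1 * `|phi|.
  have [PL PC Pc _] := PhiP i.
  apply: (weakstar_preadjoint ZP (pairing_dual (F i)) PL Pc ler01) => z.
  by rewrite mul1r contractive_norm.
pose T i := sval (cid2 (TP i)).
have TE i phi z : pairing Z (T i phi) z = pairing (F i) phi (Phi i z).
  by rewrite /T; case: cid2 => /= T' ->.
have TM i phi : `|T i phi| <= `|phi|.
  by rewrite /T; case: cid2 => /= T' _ T'M; have := T'M phi; rewrite mul1r.
have zetaP phi : exists zeta, forall z, pairing Z zeta z = l1_linf phi (mu z).
  have [M MP] := l1_bounded phi.
  have Z_complete : fast_complete (predual Z).
    by apply: fast_complete_cvg => e; exact: pow2_small.
  have [D|zeta zetaS] := @abs_summable_has_sum R I _ (fun i => T i (\val phi i)) M Z_complete.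
    by apply: le_trans (MP D); apply: le_partial_sum => i.
  exists zeta => z; apply/esym/l1_linf_eq.
  rewrite (_ : (fun i => _) = (fun x => pairing Z x z) \o (fun i => T i (\val phi i))).
    apply: has_sum_bounded (normr_ge0 z) _ _ zetaS => [x y|x].
      have [_ D' Z'] := scalarE (dual_scalarl ZP z).
      by rewrite D' -scaleN1r Z' mulN1r.
    by rewrite (le_trans (dual_norm ZP _ _))// mulrC.
  by apply/funext => i /=; rewrite TE.
have mu_eta a : mu (eta Z a) = eta_vee F a.
  by apply: linf_ext => i /=; have [_ _ _ ->] := PhiP i.
have muJ z : exists v, J v = mu z.
  suff : range J (mu z) by move=> [v _ <-]; exists v.
  rewrite J_range; apply/closure_eta_veeP => phi phi0.
  have [zeta zetaE] := zetaP phi; rewrite -zetaE.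
  have -> : zeta = 0 by apply: eta_total => a; rewrite zetaE mu_eta.
  by have [-> _ _] := scalarE (dual_scalarl ZP z).
have /choice[Psi PsiE] := muJ.
exists Psi; split.
- move=> c x y; apply: subdirect_J_inj; rewrite PsiE; apply: linf_ext => i.
  have [-> _] := J_hom i; rewrite !PsiE /=.
  by have [-> _ _ _] := PhiP i.
- apply/contractiveP => n z; apply/J_norm => [|i]; first exact: mnorm_ge0.
  have [_ /contractiveP PC _ _] := PhiP i.
  rewrite -map_mx_comp (_ : map_mx _ z = map_mx (Phi i) z)//.
  by apply/matrixP => k l; rewrite !mxE /= PsiE.
- apply/(weakstar_continuousP (pairing V) (Psi : wstar Z -> V)) => x.
  have [phi _ <-] : range q x by rewrite q_surj.
  have [zeta zetaE] := zetaP phi.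
  rewrite (_ : (fun z => _) = pairing Z zeta).
    exact: (@weak_ev_continuous R (predual Z) Z (fun y x => pairing Z x y)).
  by apply/funext => z; rewrite qE PsiE zetaE.
- move=> a; apply: subdirect_J_inj; rewrite PsiE mu_eta.
  by apply: linf_ext => i; rewrite J_eta.
Qed.

End SubdirectSup.

(** * Suprema and infima of arbitrary classes of HLDBAs *)

Section Lattice.
Variables (R : realType) (s : setting) (A : balgebra R s).

Lemma subdirect_is_sup (I : choiceType) (F : I -> hldba A) V : is_subdirect F V ->
  is_sup (@hld_le R s A) (fun p => exists i, p = hld_class (F i)) (hld_class V).
Proof.
move=> [J [q [Jhom Jeta Jrange Jnorm [qsurj qE]]]].
have /(@subdirect_normP _ _ V I (fun i => F i) (fun i v => \val (J v) i)) JN := Jnorm.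
split=> [_ [i ->]|z zF]; first by apply/hld_le_class; exact: (subdirect_upper Jhom Jeta JN qE).
have [Z zE] := hld_classE z; rewrite zE; apply/hld_le_class.
apply: (subdirect_lub Jhom Jeta Jrange JN qsurj qE) => i.
by apply/hld_le_class; rewrite -zE; apply: zF; exists i.
Qed.

Lemma hld_sup_exists (S : HLD A -> Prop) : exists x, is_sup (@hld_le R s A) S x.
Proof.
pose K := (forall n, 'M[(A -> R[i]) -> R[i] -> Prop]_n -> R[i] -> Prop).
(* The codes of the members of [S] form an index set of admissible size, whatever the size of
   [hldba A]. One representative per code suffices, since equal codes mean equivalence. *)
pose I := {k : K | exists V : hldba A, S (hld_class V) /\ hldba_code V = k}.
pose I' : choiceType := {classic I}.
have /choice[F FP] : forall i : I', exists V : hldba A, S (hld_class V) /\ hldba_code V = sval (i : I).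
  by move=> [k kP].
have [V VF] := subdirect_exists F.
have [Vup Vlub] := subdirect_is_sup VF.
exists (hld_class V); split=> [p Sp|z zS].
  have [W pE] := hld_classE p.
  have iP : exists V : hldba A, S (hld_class V) /\ hldba_code V = hldba_code W.
    by exists W; rewrite -pE.
  pose i : I' := exist _ (hldba_code W) iP; have [_ Fi] := FP i.
  apply: Vup; exists i; rewrite pE; apply/hld_classP/hldba_equivP.
  by split; apply: hldba_code_le; rewrite Fi.
by apply: Vlub => _ [i ->]; apply: zS; have [] := FP i.
Qed.

Lemma hld_complete_lattice : complete_lattice (@hld_le R s A).
Proof.
split=> [|S]; first exact: hld_partial_order.
split; first exact: hld_sup_exists.
have [x [xub xlub]] := hld_sup_exists (fun y => forall z, S z -> hld_le y z).
by exists x; split=> [y Sy|z zS]; [apply: xlub => w; apply|apply: xub].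
Qed.

Lemma trivial_exists : exists V : hldba A, is_trivial V.
Proof.
have [V [J [q [_ _ _ _ [qsurj qE]]]]] := subdirect_exists (fun i : void => match i with end : hldba A).
exists V => v; apply: (dual_inj (pairing_dual V)) => x.
have [phi _ <-] : range q x by rewrite qsurj.
rewrite !qE; congr l1_linf; apply: linf_ext; by case.
Qed.

End Lattice.

Theorem theorem3p7 (R : realType) (s : setting) (A : balgebra R s) :
  [/\ forall (I : choiceType) (F : I -> hldba A),
        (exists V, is_subdirect F V) /\
        (forall V, is_subdirect F V ->
           is_sup (@hld_le R s A) (fun p => exists i, p = hld_class (F i))
             (hld_class V)),
      complete_lattice (@hld_le R s A),
      (exists V : hldba A, is_bidual V) /\
      (forall V : hldba A, is_bidual V ->
         is_max (@hld_le R s A) (hld_class V)) &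
      (exists V : hldba A, is_trivial V) /\
      (forall V : hldba A, is_trivial V ->
         is_min (@hld_le R s A) (hld_class V))].
Proof.
split.
- move=> I F; split; first exact: subdirect_exists.
  exact: subdirect_is_sup.
- exact: hld_complete_lattice.
- split=> [|V VB p]; first exact: bidual_exists.
  have [W ->] := hld_classE p; apply/hld_le_class; exact: bidual_largest.
- split=> [|V V0 p]; first exact: trivial_exists.
  have [W ->] := hld_classE p; apply/hld_le_class; exact: trivial_least.
Qed.
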